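(* The Fourier transform $\mathcal{F}$, defined for $f\in L^2(\mathbb{A}_f)$ by $$\mathcal{F}(f)(\xi)=\lim_{\ell\to\infty}\int_{\mathfrak{a}^\ell}\chi(x\xi)f(x)\,dx\qquad\text{(limit in } L^2(\mathbb{A}_f)),$$ is a unitary transformation on the Hilbert space $L^2(\mathbb{A}_f)$. The Fourier inversion formula and the Parseval–Steklov identity hold: writing $\widehat f=\mathcal{F}(f)$, for every $f\in L^2(\mathbb{A}_f)$ one has $f=\mathcal{F}\big[\xi\mapsto\widehat f(-\xi)\big]$ in $L^2(\mathbb{A}_f)$, and for all $f,g\in L^2(\mathbb{A}_f)$, $$\int_{\mathbb{A}_f}f(x)\overline{g(x)}\,dx=\int_{\mathbb{A}_f}\widehat f(\xi)\overline{\widehat g(\xi)}\,d\xi.$$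
   Context: $\mathbb{A}_f$ is the ring of finite adèles of $\mathbb{Q}$ and $\widehat{\mathbb{Z}}=\prod_p\mathbb{Z}_p\subset\mathbb{A}_f$ its maximal compact open subring; $dx$ is the Haar measure on $\mathbb{A}_f$ giving $\widehat{\mathbb{Z}}$ mass one. For $x\in\mathbb{A}_f$, the fractional part $\{x\}$ is the unique rational number in $[0,1)$ with $x-\{x\}\in\widehat{\mathbb{Z}}$, and $\chi(x)=\exp(2\pi i\{x\})$ is the canonical additive character. Let $1=m_0<m_1<m_2<\cdots$ be the increasing enumeration of the distinct values of $\mathrm{lcm}(1,\dots,N)$, $N\ge1$; set $e^{\psi(n)}=m_n$ for $n\ge0$, $e^{\psi(n)}=1/m_{-n}$ for $n<0$, and $\mathfrak{a}^n=e^{-\psi(n)}\widehat{\mathbb{Z}}$ for $n\in\mathbb{Z}$ (an increasing family of compact open subgroups with union $\mathbb{A}_f$). *)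

(* Defs.v *)
From HB Require Import structures.
From mathcomp Require Import all_boot all_order all_algebra.
From mathcomp Require Import complex.
From mathcomp Require Import ring lra.
From mathcomp Require Import all_classical all_reals all_analysis.
From mathcomp Require Import measurable_realfun.

Set Implicit Arguments.
Unset Strict Implicit.
Unset Printing Implicit Defensive.

Import Order.TTheory GRing.Theory Num.Theory.
Import numFieldNormedType.Exports.

Local Open Scope classical_set_scope.
Local Open Scope ring_scope.

(* Products of families of rings, with componentwise operations. *)
Definition dep_prod (I : Type) (T : I -> Type) : Type := forall i, T i.

HB.instance Definition _ (I : Type) (T : I -> Type) :=
  gen_eqMixin (dep_prod T).
HB.instance Definition _ (I : Type) (T : I -> Type) :=
  gen_choiceMixin (dep_prod T).

Section dep_prod_zmod.
Variables (I : Type) (T : I -> zmodType).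
Implicit Types x y z : dep_prod T.

Definition dep_prod_add x y : dep_prod T := fun i => x i + y i.
Definition dep_prod_opp x : dep_prod T := fun i => - x i.
Definition dep_prod_zero : dep_prod T := fun=> 0.

Lemma dep_prod_addA : associative dep_prod_add.
Proof. by move=> x y z; apply: functional_extensionality_dep => i; exact: addrA. Qed.
Lemma dep_prod_addC : commutative dep_prod_add.
Proof. by move=> x y; apply: functional_extensionality_dep => i; exact: addrC. Qed.
Lemma dep_prod_add0 : left_id dep_prod_zero dep_prod_add.
Proof. by move=> x; apply: functional_extensionality_dep => i; exact: add0r. Qed.
Lemma dep_prod_addN : left_inverse dep_prod_zero dep_prod_opp dep_prod_add.
Proof. by move=> x; apply: functional_extensionality_dep => i; exact: addNr. Qed.

HB.instance Definition _ := GRing.isZmodule.Build (dep_prod T)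
  dep_prod_addA dep_prod_addC dep_prod_add0 dep_prod_addN.
End dep_prod_zmod.

Section dep_prod_ring.
Variables (I : Type) (T : I -> comPzRingType).
Implicit Types x y z : dep_prod T.

Definition dep_prod_mul x y : dep_prod T := fun i => x i * y i.
Definition dep_prod_one : dep_prod T := fun=> 1.

Lemma dep_prod_mulA : associative dep_prod_mul.
Proof. by move=> x y z; apply: functional_extensionality_dep => i; exact: mulrA. Qed.
Lemma dep_prod_mulC : commutative dep_prod_mul.
Proof. by move=> x y; apply: functional_extensionality_dep => i; exact: mulrC. Qed.
Lemma dep_prod_mul1 : left_id dep_prod_one dep_prod_mul.
Proof. by move=> x; apply: functional_extensionality_dep => i; exact: mul1r. Qed.
Lemma dep_prod_mulDl : left_distributive dep_prod_mul +%R.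
Proof. by move=> x y z; apply: functional_extensionality_dep => i; exact: mulrDl. Qed.

HB.instance Definition _ := GRing.Zmodule_isComPzRing.Build (dep_prod T)
  dep_prod_mulA dep_prod_mulC dep_prod_mul1 dep_prod_mulDl.
End dep_prod_ring.

Record prime_nat := PrimeNat { prime_val :> nat; prime_natP : prime prime_val }.

HB.instance Definition _ := [isSub for prime_val].
HB.instance Definition _ := [Countable of prime_nat by <:].

Section padic_int.
Variable p : prime_nat.

Lemma pexp_gt1 n : (1 < p ^ n.+1)%N.
Proof. by rewrite -(exp1n n.+1) ltn_exp2r // prime_gt1 // prime_natP. Qed.

(* Z_p is the inverse limit of the rings Z/p^n: component n of a p-adic integer
   is its residue modulo p ^ n.+1.  The shift keeps the modulus above 1, where
   the type 'Z_m really is Z/m. *)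
Definition padic_compatible : {pred dep_prod (fun n => 'Z_(p ^ n.+1))} :=
  [pred x : dep_prod (fun n => 'Z_(p ^ n.+1)) |
    `[< forall n, (x n.+1 : nat)%:R = x n >]].

Lemma padic_red n (a b : nat) :
  a = b %[mod p ^ n.+2] -> a%:R = b%:R :> 'Z_(p ^ n.+1).
Proof.
move=> ab; rewrite -(Zp_nat_mod (pexp_gt1 n) a) -(Zp_nat_mod (pexp_gt1 n) b).
have d : (p ^ n.+1 %| p ^ n.+2)%N by apply: dvdn_exp2l.
by rewrite -(modn_dvdm a d) ab modn_dvdm.
Qed.

Lemma modn_val_Zp n (x : 'Z_(p ^ n.+1)) (a : nat) :
  x = a%:R -> x = a %[mod p ^ n.+1].
Proof. by move=> ->; rewrite val_Zp_nat ?pexp_gt1 // modn_mod. Qed.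

Lemma padic_compatible_subring : subring_closed padic_compatible.
Proof.
split.
- by apply/asboolP => n; rewrite (@padic_red n _ 1%N).
- move=> x y /asboolP xP /asboolP yP; apply/asboolP => n.
  rewrite -[RHS]/(x n - y n) -(xP n) -(yP n).
  apply: (addIr (y n.+1 : nat)%:R); rewrite subrK -natrD.
  apply/padic_red/esym/modn_val_Zp.
  by rewrite natrD !natr_Zp subrK.
- move=> x y /asboolP xP /asboolP yP; apply/asboolP => n.
  rewrite -[RHS]/(x n * y n) -(xP n) -(yP n) -natrM.
  by apply: padic_red; apply: modn_val_Zp; rewrite natrM !natr_Zp.
Qed.

HB.instance Definition _ := GRing.isSubringClosed.Build _ padic_compatible
  padic_compatible_subring.

Record padic_int := PadicInt {
  padic_seq : dep_prod (fun n => 'Z_(p ^ n.+1));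
  padic_seqP : padic_seq \in padic_compatible }.

Definition padic_red_mod (x : padic_int) n : 'Z_(p ^ n.+1) := padic_seq x n.
Coercion padic_red_mod : padic_int >-> Funclass.

HB.instance Definition _ := [isSub for padic_seq].
HB.instance Definition _ := [Choice of padic_int by <:].
HB.instance Definition _ :=
  GRing.SubChoice_isSubComPzRing.Build _ padic_compatible padic_int
    padic_compatible_subring.

Lemma padic_int_compat (x : padic_int) n : (x n.+1 : nat)%:R = x n.
Proof. by have /asboolP := padic_seqP x. Qed.

Lemma padic_int_eq (x y : padic_int) : (forall n, x n = y n) -> x = y.
Proof. by move=> xy; apply/val_inj/functional_extensionality_dep. Qed.

Lemma padic_int_modn (x : padic_int) m n : (m <= n)%N ->
  x n = x m %[mod p ^ m.+1].
Proof.
elim: n => [|n IH]; first by rewrite leqn0 => /eqP ->.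
rewrite leq_eqVlt => /orP[/eqP <- //|]; rewrite ltnS => mn.
rewrite -(IH mn) -(padic_int_compat x n).
have d : (p ^ m.+1 %| p ^ n.+1)%N by apply: dvdn_exp2l.
by rewrite val_Zp_nat ?pexp_gt1 // modn_dvdm.
Qed.

Lemma padic_int_neq0 (x : padic_int) : x != 0 ->
  exists n, forall m, (n <= m)%N -> ~~ (p ^ n.+1 %| x m)%N.
Proof.
move=> x0; have [n xn] : exists n, x n != 0.
  apply: contrapT => xn; move/eqP: x0; apply; apply: padic_int_eq => n.
  by apply/eqP/negPn/negP => xn0; apply: xn; exists n.
exists n => m nm; apply: contra xn => dx.
apply/eqP/val_inj; have := padic_int_modn x nm.
rewrite (eqP dx) modn_small // -[X in (_ < X)%N](Zp_cast (pexp_gt1 n)).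
exact: ltn_ord.
Qed.

Lemma padic_int_oner_neq0 : (1 : padic_int) != 0.
Proof. by apply/eqP => /(congr1 (fun x : padic_int => x 0%N)). Qed.

HB.instance Definition _ :=
  GRing.PzSemiRing_isNonZero.Build padic_int padic_int_oner_neq0.

Definition padic_int_unit : {pred padic_int} :=
  [pred x : padic_int | `[< exists y, y * x = 1 >]].

Definition padic_int_inv (x : padic_int) : padic_int :=
  xget x [set y | y * x = 1].

Lemma padic_int_mulVx : {in padic_int_unit, left_inverse 1 padic_int_inv *%R}.
Proof.
move=> x /asboolP[y yx]; rewrite /padic_int_inv.
by case: xgetP => [z _ //|/(_ y)].
Qed.

Lemma padic_int_unitPl (x y : padic_int) : y * x = 1 -> padic_int_unit x.
Proof. by move=> yx; apply/asboolP; exists y. Qed.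

Lemma padic_int_invr_out : {in [predC padic_int_unit], padic_int_inv =1 id}.
Proof.
move=> x /asboolP xU; rewrite /padic_int_inv.
by case: xgetP => // y _ yx; case: xU; exists y.
Qed.

HB.instance Definition _ := GRing.ComNzRing_hasMulInverse.Build padic_int
  padic_int_mulVx padic_int_unitPl padic_int_invr_out.

Lemma padic_int_integral : GRing.integral_domain_axiom padic_int.
Proof.
move=> x y xy0; have [//|x0] := eqVneq x 0; have [//|y0] := eqVneq y 0.
exfalso; have [m xm] := padic_int_neq0 x0; have [n yn] := padic_int_neq0 y0.
pose k := (m + n).+1.
have xk : ~~ (p ^ m.+1 %| x k)%N by apply: xm; rewrite leqW // leq_addr.
have yk : ~~ (p ^ n.+1 %| y k)%N by apply: yn; rewrite leqW // leq_addl.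
have xyk : ((x k * y k)%N%:R : 'Z_(p ^ k.+1)) = 0.
  rewrite natrM !natr_Zp.
  exact: (congr1 (fun z : padic_int => z k) xy0).
have : (p ^ k.+1 %| x k * y k)%N.
  by rewrite /dvdn -val_Zp_nat ?pexp_gt1 // xyk.
have pp := prime_natP p.
have xk0 : (0 < x k)%N by rewrite lt0n; apply: contra xk => /eqP ->.
have yk0 : (0 < y k)%N by rewrite lt0n; apply: contra yk => /eqP ->.
move: xk yk; rewrite !pfactor_dvdn ?muln_gt0 ?xk0 ?yk0 // lognM // -!ltnNge !ltnS.
by move=> xk yk; rewrite leqNgt ltnS (leq_trans (leq_add xk yk)).
Qed.

HB.instance Definition _ :=
  GRing.ComUnitRing_isIntegral.Build padic_int padic_int_integral.

End padic_int.

(* Q_p, with Z_p inside it as padic_integer; the sets x + p^k Z_p form a basis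
   of its topology. *)
Definition padic (p : prime_nat) : Type := {fraction padic_int p}.

HB.instance Definition _ (p : prime_nat) := GRing.Field.on (padic p).

Section padic_theory.
Variable p : prime_nat.

Definition padic_integer : set (padic p) := range (@tofrac (padic_int p)).

Definition padic_open : set_system (padic p) := [set V | forall x, V x ->
  exists k, forall z, padic_integer z -> V (x + p%:R ^+ k * z)].

Lemma padic_openT : padic_open setT.
Proof. by move=> x _; exists 0%N. Qed.

Lemma padic_integerM (x y : padic p) :
  padic_integer x -> padic_integer y -> padic_integer (x * y).
Proof. by move=> [a _ <-] [b _ <-]; exists (a * b) => //; rewrite rmorphM. Qed.

Lemma padic_integerB (x y : padic p) :
  padic_integer x -> padic_integer y -> padic_integer (x - y).
Proof. by move=> [a _ <-] [b _ <-]; exists (a - b) => //; rewrite rmorphB. Qed.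

Lemma padic_integer_nat n : padic_integer n%:R.
Proof. by exists n%:R => //; rewrite rmorph_nat. Qed.

Lemma padic_openI : setI_closed padic_open.
Proof.
move=> U V Uo Vo x [/Uo[k Uk] /Vo[l Vl]]; exists (k + l)%N => z zZ; split.
  rewrite exprD -mulrA; apply: Uk; apply: padic_integerM => //.
  by rewrite -natrX; exact: padic_integer_nat.
rewrite addnC exprD -mulrA; apply: Vl; apply: padic_integerM => //.
by rewrite -natrX; exact: padic_integer_nat.
Qed.

Lemma padic_open_bigU (I : Type) (f : I -> set (padic p)) :
  (forall i, padic_open (f i)) -> padic_open (\bigcup_i f i).
Proof.
by move=> fo x [i _ /fo[k fk]]; exists k => z zZ; exists i => //; exact: fk.
Qed.

HB.instance Definition _ := isOpenTopological.Build (padic p)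
  padic_openT padic_openI padic_open_bigU.

Lemma coprime_padic_int_unit d :
  coprime p d -> (d%:R : padic_int p) \is a GRing.unit.
Proof.
move=> pd; have dU n : (d%:R : 'Z_(p ^ n.+1)) \is a GRing.unit.
  by rewrite unitZpE ?pexp_gt1 // coprimeXl.
pose u : dep_prod (fun n => 'Z_(p ^ n.+1)) := fun n => d%:R^-1.
have uP : u \in @padic_compatible p.
  apply/asboolP => n; apply: (mulIr (dU n)); rewrite [RHS]mulVr ?dU // -natrM.
  have /modn_val_Zp e : (1 : 'Z_(p ^ n.+2)) = (u n.+1 * d)%N%:R.
    by rewrite natrM natr_Zp mulVr ?dU.
  by rewrite (padic_red (esym e)).
have ud : PadicInt uP * d%:R = 1.
  apply: padic_int_eq => n.
  rewrite -[LHS]/(u n * (d%:R : padic_int p) n).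
  have -> : (d%:R : padic_int p) n = d%:R.
    by elim: d {pd dU u uP} => // d IH; rewrite !mulrSr -IH.
  by rewrite mulVr ?dU.
by apply/unitrP; exists (PadicInt uP); split; rewrite // mulrC.
Qed.

Lemma padic_integer_rat (q : rat) :
  ~~ (p %| `|denq q|)%N -> padic_integer (ratr q).
Proof.
move=> pq; have dU : ((`|denq q|%N)%:R : padic_int p) \is a GRing.unit.
  by apply: coprime_padic_int_unit; rewrite prime_coprime // prime_natP.
exists ((numq q)%:~R / (`|denq q|%N)%:R) => //.
rewrite rmorphM [X in _ * X]rmorphV // rmorph_int rmorph_nat.
by rewrite /ratr -[in RHS]absz_denq.
Qed.

End padic_theory.

Arguments padic_integer : clear implicits.

(* A_f is the restricted product of the Q_p with respect to the Z_p. *)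
Definition adele_restricted : {pred dep_prod (fun p => padic p)} :=
  [pred x : dep_prod (fun p => padic p) |
    `[< finite_set [set p | ~ padic_integer p (x p)] >]].

Lemma adele_restricted_subring : subring_closed adele_restricted.
Proof.
split.
- apply/asboolP; apply: (@sub_finite_set _ _ set0) => // p /=; apply.
  exact: (padic_integer_nat p 1).
- move=> x y /asboolP xf /asboolP yf; apply/asboolP.
  apply: (@sub_finite_set _ _ ([set p | ~ padic_integer p (x p)] `|`
    [set p | ~ padic_integer p (y p)])); last by rewrite finite_setU.
  move=> p /= xy; apply: contrapT => /not_orP[/contrapT xp /contrapT yp].
  exact/xy/padic_integerB.
- move=> x y /asboolP xf /asboolP yf; apply/asboolP.
  apply: (@sub_finite_set _ _ ([set p | ~ padic_integer p (x p)] `|`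
    [set p | ~ padic_integer p (y p)])); last by rewrite finite_setU.
  move=> p /= xy; apply: contrapT => /not_orP[/contrapT xp /contrapT yp].
  exact/xy/padic_integerM.
Qed.

Record finite_adele := FiniteAdele {
  adele_val : dep_prod (fun p => padic p);
  adele_valP : adele_val \in adele_restricted }.

Definition adele_at (x : finite_adele) (p : prime_nat) : padic p :=
  adele_val x p.
Coercion adele_at : finite_adele >-> Funclass.

HB.instance Definition _ := [isSub for adele_val].
HB.instance Definition _ := [Choice of finite_adele by <:].
HB.instance Definition _ := GRing.SubChoice_isSubComPzRing.Build _
  adele_restricted finite_adele adele_restricted_subring.

Lemma finite_adele_oner_neq0 : (1 : finite_adele) != 0.
Proof.
apply/eqP => /(congr1 (fun x : finite_adele => x (PrimeNat (isT : prime 2)))).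
by move/eqP; rewrite -[X in X == _]/(1 : padic _) oner_eq0.
Qed.

HB.instance Definition _ :=
  GRing.PzSemiRing_isNonZero.Build finite_adele finite_adele_oner_neq0.
HB.instance Definition _ := isPointed.Build finite_adele 0.

Definition Zhat : set finite_adele := [set x | forall p, padic_integer p (x p)].

Lemma adele_restricted_rat (q : rat) :
  (fun p => ratr q : padic p) \in adele_restricted.
Proof.
apply/asboolP; apply: (@sub_finite_set _ _
  (prime_val @^-1` [set n | (n <= `|denq q|)%N])).
  move=> p /= qp; apply: contrapT => /negP; rewrite -ltnNge => dp.
  apply/qp/padic_integer_rat/negP => /dvdn_leq.
  by rewrite absz_gt0 denq_neq0 leqNgt dp => /(_ isT).
apply: finite_preimage; last exact: (finite_II `|denq q|.+1).
by move=> p r _ _; exact: val_inj.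
Qed.

Definition adele_of_rat (q : rat) : finite_adele :=
  FiniteAdele (adele_restricted_rat q).

(* The restricted product topology: the open boxes whose sides are equal to Z_p
   for almost all p form a basis. *)
Definition adele_open : set_system finite_adele := [set U | forall x : finite_adele,
  U x ->
  exists V : forall p, set (padic p),
    [/\ forall p, open (V p), forall p, V p (x p),
        finite_set [set p | V p <> padic_integer p]
      & [set y : finite_adele | forall p, V p (y p)] `<=` U]].

Lemma padic_integer_open p : open (padic_integer p).
Proof.
move=> x xZ; exists 0%N => z zZ; rewrite expr0 mul1r -[z]opprK -[- z]add0r.
by apply/padic_integerB => //; apply/padic_integerB => //;
  exact: (padic_integer_nat p 0).
Qed.

Lemma adele_openT : adele_open setT.
Proof.
move=> x _; exists (fun p => [set y | padic_integer p (x p) -> padic_integer p y]).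
split => //.
- move=> p; have [xp|xp] := pselect (padic_integer p (x p)).
    by rewrite (_ : [set _ | _] = padic_integer p);
      [exact: padic_integer_open | apply/seteqP; split => y /=; auto].
  by rewrite (_ : [set _ | _] = setT);
    [exact: openT | apply/seteqP; split => // y _ /xp].
- by move=> p /=.
- apply: (@sub_finite_set _ _ [set p | ~ padic_integer p (x p)]); last first.
    by have /asboolP := adele_valP x.
  move=> p /= Vp xp; apply: Vp.
  by apply/seteqP; split => y /=; auto.
Qed.

Lemma adele_openI : setI_closed adele_open.
Proof.
move=> U U' Uo Uo' x [/Uo[V [Vo Vx Vf VU]] /Uo'[V' [Vo' Vx' Vf' VU']]].
exists (fun p => V p `&` V' p); split.
- by move=> p; exact: openI.
- by move=> p; split.
- apply: (@sub_finite_set _ _ ([set p | V p <> padic_integer p] `|`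
    [set p | V' p <> padic_integer p])); last by rewrite finite_setU.
  move=> p /= VV; apply: contrapT => /not_orP[/contrapT e /contrapT e'].
  by apply: VV; rewrite e e' setIid.
- by move=> y yV; split; [apply: VU|apply: VU'] => p; have [] := yV p.
Qed.

Lemma adele_open_bigU (I : Type) (f : I -> set finite_adele) :
  (forall i, adele_open (f i)) -> adele_open (\bigcup_i f i).
Proof.
move=> fo x [i _ /fo[V [Vo Vx Vf Vs]]]; exists V; split => //.
by move=> y /Vs; exists i.
Qed.

HB.instance Definition _ := isOpenTopological.Build finite_adele
  adele_openT adele_openI adele_open_bigU.

(* The measurable sets of A_f are the Borel sets. *)
HB.instance Definition _ :=
  @isMeasurable.Build (sigma_display (@open finite_adele)) finite_adele
    <<s @open finite_adele >> (@sigma_algebra0 _ setT _)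
    (@sigma_algebraC finite_adele _) (@sigma_algebra_bigcup _ setT _).

(* No regularity condition: every Borel measure on A_f that is finite on compact
   sets is regular, as A_f is locally compact and second countable. *)
Definition is_haar (R : realType)
    (mu : {measure set finite_adele -> \bar R}) : Prop :=
  [/\ forall (a : finite_adele) (A : set finite_adele), measurable A ->
        mu [set a + x | x in A] = mu A,
      forall K : set finite_adele, compact K -> (mu K < +oo)%E
    & forall U : set finite_adele, open U -> U !=set0 -> (0 < mu U)%E].

Definition lcm_upto (N : nat) : nat := \big[lcmn/1%N]_(1 <= i < N.+1) i.

Lemma lcm_upto_gt0 N : (0 < lcm_upto N)%N.
Proof.
rewrite /lcm_upto big_seq; elim/big_ind: _ => // [m n|i].
  by rewrite lcmn_gt0 => -> ->.
by rewrite mem_index_iota => /andP[].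
Qed.

Lemma lcm_upto_unbounded v : exists N, (v < lcm_upto N)%N.
Proof.
exists v.+1; apply: dvdn_leq; first exact: lcm_upto_gt0.
by rewrite /lcm_upto big_nat_recr //= dvdn_lcmr.
Qed.

(* The integers m_0 < m_1 < ... : m_(n+1) is the first value of lcm_upto above
   m_n. *)
Fixpoint lcm_value (n : nat) : nat :=
  if n is n'.+1 then lcm_upto (ex_minn (lcm_upto_unbounded (lcm_value n')))
  else 1.

Lemma lcm_value_lt n : (lcm_value n < lcm_value n.+1)%N.
Proof. by rewrite /=; case: ex_minnP. Qed.

Lemma lcm_upto_mono : {homo lcm_upto : M N / (M <= N)%N}.
Proof.
apply: homo_leq => // [m n k|n]; first exact: leq_trans.
apply: dvdn_leq; first exact: lcm_upto_gt0.
by rewrite /lcm_upto [X in (_ %| X)%N]big_nat_recr //= dvdn_lcml.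
Qed.

Lemma range_lcm_value :
  range lcm_value = [set lcm_upto N | N in [set N | (1 <= N)%N]].
Proof.
apply/seteqP; split => [_ [n _ <-]|_ [N N1 <-]].
  case: n => [|n] /=; first by exists 1%N; rewrite // /lcm_upto big_nat1.
  case: ex_minnP => N lN _; exists N => //=; rewrite lt0n.
  apply: contraTN lN => /eqP ->; rewrite /lcm_upto big_geq // -leqNgt.
  by case: n => // n; rewrite lcm_upto_gt0.
have [n nP nm] : exists2 n, (lcm_value n <= lcm_upto N)%N &
    (lcm_upto N < lcm_value n.+1)%N.
  have ge n : (n <= lcm_value n)%N.
    by elim: n => // n IH; rewrite (leq_ltn_trans IH) ?lcm_value_lt.
  have ex0 : exists n, (lcm_value n <= lcm_upto N)%N.
    by exists 0%N; exact: lcm_upto_gt0.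
  have ub n : (lcm_value n <= lcm_upto N)%N -> (n <= lcm_upto N)%N.
    exact: leq_trans.
  case: (ex_maxnP ex0 ub) => n nN nmax; exists n => //.
  by rewrite ltnNge; apply/negP => /nmax; rewrite ltnn.
exists n => //; apply/eqP; rewrite eqn_leq nP /= leqNgt; apply/negP => lt.
move: nm; rewrite /=; case: ex_minnP => M _ /(_ _ lt) /lcm_upto_mono.
by rewrite ltnNge => ->.
Qed.

(* exp_psi n is e^(psi(n)); recall that Negz k is the integer - (k + 1). *)
Definition exp_psi (n : int) : rat :=
  match n with
  | Posz k => (lcm_value k)%:R
  | Negz k => ((lcm_value k.+1)%:R)^-1
  end.

Definition frak_a (n : int) : set finite_adele :=
  [set adele_of_rat (exp_psi n)^-1 * z | z in Zhat].

(* The set below is always a singleton, so the default value 0 plays no role. *)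
Definition fractional_part (x : finite_adele) : rat :=
  xget 0 [set q : rat | 0 <= q < 1 /\ Zhat (x - adele_of_rat q)].

(* expi t is exp(i t). *)
Definition expi (R : realType) (t : R) : R[i] := (cos t +i* sin t)%C.

(* chi(x) = exp(2 pi i {x}) *)
Definition add_char (R : realType) (x : finite_adele) : R[i] :=
  expi (2 * pi * ratr (fractional_part x)).

Section L2.
Context d (T : measurableType d) (R : realType).
Variable mu : {measure set T -> \bar R}.

(* R[i] carries no measurable structure: measurability and integration of
   complex functions are componentwise. *)
Definition cintegral (D : set T) (f : T -> R[i]) : R[i] :=
  ((\int[mu]_(x in D) complex.Re (f x)) +i*
   (\int[mu]_(x in D) complex.Im (f x)))%C.

Definition square_integrable (f : T -> R[i]) : Prop :=
  [/\ measurable_fun setT (fun x => complex.Re (f x)),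
      measurable_fun setT (fun x => complex.Im (f x))
    & (\int[mu]_x (complex.Re (f x) ^+ 2 + complex.Im (f x) ^+ 2)%:E
         < +oo)%E].

Definition l2 : {pred (T -> R[i])} :=
  [pred f : T -> R[i] | `[< square_integrable f >]].

Lemma l2_scale (c : R[i]) (f : T -> R[i]) :
  f \in l2 -> (fun x => c * f x) \in l2.
Proof.
case: c => a b /asboolP[mr mi fi]; apply/asboolP.
have ReM x : complex.Re ((a +i* b)%C * f x) =
    a * complex.Re (f x) - b * complex.Im (f x) by case: (f x).
have ImM x : complex.Im ((a +i* b)%C * f x) =
    a * complex.Im (f x) + b * complex.Re (f x) by case: (f x).
split.
- under eq_fun do rewrite ReM.
  by apply: measurable_funB; apply: measurable_funM.
- under eq_fun do rewrite ImM.
  by apply: measurable_funD; apply: measurable_funM.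
- under eq_integral => x _.
    rewrite ReM ImM (_ : _ + _ = (a ^+ 2 + b ^+ 2) *
      (complex.Re (f x) ^+ 2 + complex.Im (f x) ^+ 2)); last by ring.
    rewrite EFinM; over.
  rewrite ge0_integralZl //=.
  + by rewrite lte_mul_pinfty // lee_fin addr_ge0 // sqr_ge0.
  + by apply/measurable_EFinP; apply: measurable_funD; exact: measurable_funX.
  + by move=> x _; rewrite lee_fin addr_ge0 // sqr_ge0.
  + by rewrite lee_fin addr_ge0 // sqr_ge0.
Qed.

Lemma l2_zmod : zmod_closed l2.
Proof.
split.
  apply/asboolP; split; [exact: measurable_cst|exact: measurable_cst|].
  under eq_integral do rewrite /= expr0n /= addr0.
  by rewrite integral0.
move=> f g /asboolP[fr fm fi] /asboolP[gr gm gi]; apply/asboolP.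
have ReB x : complex.Re ((f - g) x) = complex.Re (f x) - complex.Re (g x).
  by rewrite -[(f - g) x]/(f x - g x); case: (f x) (g x) => ? ? [].
have ImB x : complex.Im ((f - g) x) = complex.Im (f x) - complex.Im (g x).
  by rewrite -[(f - g) x]/(f x - g x); case: (f x) (g x) => ? ? [].
have sqm (h : T -> R[i]) : measurable_fun setT (fun x => complex.Re (h x)) ->
    measurable_fun setT (fun x => complex.Im (h x)) ->
    measurable_fun setT
      (fun x => (complex.Re (h x) ^+ 2 + complex.Im (h x) ^+ 2)%:E).
  by move=> hr hi; apply/measurable_EFinP; apply: measurable_funD;
    exact: measurable_funX.
have sq0 (h : T -> R[i]) x :
    (0 <= (complex.Re (h x) ^+ 2 + complex.Im (h x) ^+ 2)%:E :> \bar R)%E.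
  by rewrite lee_fin addr_ge0 // sqr_ge0.
have mr : measurable_fun setT (fun x => complex.Re ((f - g) x)).
  by under eq_fun do rewrite ReB; exact: measurable_funB.
have mi : measurable_fun setT (fun x => complex.Im ((f - g) x)).
  by under eq_fun do rewrite ImB; exact: measurable_funB.
split => //.
apply: (@le_lt_trans _ _ (\int[mu]_x
    (2%:E * (complex.Re (f x) ^+ 2 + complex.Im (f x) ^+ 2)%:E +
     2%:E * (complex.Re (g x) ^+ 2 + complex.Im (g x) ^+ 2)%:E))%E).
  apply: ge0_le_integral => //.
  - exact: sqm.
  - by apply: emeasurable_funD; apply: measurable_funeM; exact: sqm.
  - move=> x _; rewrite -!EFinM -EFinD lee_fin ReB ImB.
    move: (complex.Re (f x)) (complex.Im (f x)) => a b.
    move: (complex.Re (g x)) (complex.Im (g x)) => a' b'.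
    have := sqr_ge0 (a + a'); have := sqr_ge0 (b + b').
    by rewrite !expr2; lra.
rewrite ge0_integralD //=.
- rewrite !ge0_integralZl //; try exact: sqm.
  by rewrite lte_add_pinfty // lte_mul_pinfty.
- by move=> x _; rewrite mule_ge0.
- by apply: measurable_funeM; exact: sqm.
- by move=> x _; rewrite mule_ge0.
- by apply: measurable_funeM; exact: sqm.
Qed.

HB.instance Definition _ := GRing.isZmodClosed.Build _ l2 l2_zmod.

Record l2fun := L2Fun { l2fun_val :> T -> R[i]; l2fun_valP : l2fun_val \in l2 }.

HB.instance Definition _ := [isSub for l2fun_val].
HB.instance Definition _ := [Choice of l2fun by <:].
HB.instance Definition _ := [SubChoice_isSubZmodule of l2fun by <:].

Definition ae_zero : {pred l2fun} :=
  [pred f : l2fun | `[< \forall x \ae mu, f x = 0 >]].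

Lemma ae_zero_zmod : zmod_closed ae_zero.
Proof.
split; first by apply/asboolP; exact: aeW.
move=> f g /asboolP f0 /asboolP g0; apply/asboolP.
apply: filterS2 f0 g0 => x fx gx.
by rewrite -[LHS]/(f x - g x) fx gx subr0.
Qed.

HB.instance Definition _ := GRing.isZmodClosed.Build _ ae_zero ae_zero_zmod.

(* The L^2 space of mu: square-integrable functions modulo equality almost
   everywhere.  An element is coerced to one of its representatives. *)
Definition L2 : Type := {ideal_quot ae_zero}.

HB.instance Definition _ := GRing.Zmodule.on L2.
HB.instance Definition _ := EqQuotient.on L2.

Definition L2_fun (f : L2) : T -> R[i] := repr f.
Coercion L2_fun : L2 >-> Funclass.

End L2.

Section L2_theory.
Context d (T : measurableType d) (R : realType).
Variable mu : {measure set T -> \bar R}.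
Implicit Types f g : l2fun mu.

Local Open Scope quotient_scope.

Lemma L2P f g :
  \pi_(L2 mu) f = \pi_(L2 mu) g <-> \forall x \ae mu, f x = g x.
Proof.
split.
  move/eqP; rewrite -Quotient.idealrBE => /asboolP; apply: filterS => x.
  by rewrite -[LHS]/(f x - g x) => /eqP; rewrite subr_eq0 => /eqP.
move=> fg; apply/eqP; rewrite -Quotient.idealrBE; apply/asboolP.
by apply: filterS fg => x e; rewrite -[LHS]/(f x - g x) e subrr.
Qed.

Lemma repr_L2 f : \forall x \ae mu, (\pi_(L2 mu) f : L2 mu) x = f x.
Proof. by apply/L2P; rewrite reprK. Qed.

Definition l2fun_scale (c : R[i]) f : l2fun mu := L2Fun (l2_scale c (l2fun_valP f)).

Definition L2_scale (c : R[i]) (u : L2 mu) : L2 mu :=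
  \pi_(L2 mu) (l2fun_scale c (repr u)).

Lemma L2_scale_pi c f :
  L2_scale c (\pi_(L2 mu) f) = \pi_(L2 mu) (l2fun_scale c f).
Proof. by apply/L2P; apply: filterS (repr_L2 f) => x; rewrite /L2_fun /= => ->. Qed.

Lemma L2_scaleA a b u : L2_scale a (L2_scale b u) = L2_scale (a * b) u.
Proof.
elim/quotW: u => f; rewrite [L2_scale b _]L2_scale_pi !L2_scale_pi.
by congr (\pi_(L2 mu) _); apply/val_inj/funext => x; exact: mulrA.
Qed.

Lemma L2_scale1 : left_id 1 L2_scale.
Proof.
elim/quotW => f; rewrite !L2_scale_pi; congr (\pi_(L2 mu) _).
by apply/val_inj/funext => x; exact: mul1r.
Qed.

Lemma L2_piD f g : \pi_(L2 mu) (f + g) = \pi_(L2 mu) f + \pi_(L2 mu) g.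
Proof. by rewrite !piE. Qed.

Lemma L2_scaleDr : right_distributive L2_scale +%R.
Proof.
move=> c; elim/quotW => f; elim/quotW => g.
rewrite -L2_piD !L2_scale_pi -L2_piD; congr (\pi_(L2 mu) _).
by apply/val_inj/funext => x; exact: mulrDr.
Qed.

Lemma L2_scaleDl u : {morph L2_scale^~ u : a b / a + b}.
Proof.
elim/quotW: u => f a b; rewrite !L2_scale_pi -L2_piD; congr (\pi_(L2 mu) _).
by apply/val_inj/funext => x; exact: mulrDl.
Qed.

HB.instance Definition _ := GRing.Zmodule_isLmodule.Build R[i] (L2 mu)
  L2_scaleA L2_scale1 L2_scaleDr L2_scaleDl.

(* The class of f; by convention it is 0 when f is not square-integrable. *)
Definition toL2 (f : T -> R[i]) : L2 mu := \pi_(L2 mu) (insubd 0 f).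

Definition L2dot (u v : L2 mu) : R[i] :=
  cintegral mu setT (fun x => u x * (v x)^*%C).

Definition L2norm (u : L2 mu) : R := Num.sqrt (complex.Re (L2dot u u)).

(* Convergence in L^2.  Membership of each f n is demanded explicitly, so that
   the default value of toL2 is never involved. *)
Definition L2lim (f : nat -> T -> R[i]) (u : L2 mu) : Prop :=
  (forall n, square_integrable mu (f n)) /\
  L2norm (toL2 (f n) - u) @[n --> \oo] --> (0 : R).

Definition unitary (U : L2 mu -> L2 mu) : Prop :=
  [/\ linear U, bijective U & forall u v, L2dot (U u) (U v) = L2dot u v].

End L2_theory.

Section fourier.
Variables (R : realType) (mu : {measure set finite_adele -> \bar R}).

Definition fourier_partial (f : finite_adele -> R[i]) (l : nat)
    (xi : finite_adele) : R[i] :=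
  cintegral mu (frak_a l) (fun x => add_char R (x * xi) * f x).

(* The default value 0 would only matter for an f whose truncated integrals do
   not converge in L^2. *)
Definition fourier (f : L2 mu) : L2 mu :=
  xget 0 [set g : L2 mu | L2lim (fourier_partial f) g].

End fourier.

(* Main.v *)
(* Balls a + frak_a n form a countable basis of the topology of A_f, stable under
   nonempty intersections, so a translation-invariant measure is determined by the
   volumes exp_psi n of the lattices frak_a n.  The annihilator of frak_a n for the
   pairing chi(x xi) is frak_a (- n), hence the transform of the indicator of
   a + frak_a n is chi(a xi) exp_psi n on frak_a (- n) and 0 elsewhere, and transforming
   once more gives the indicator of - a + frak_a n.  Comparing Gram matrices, the
   truncated transforms are contractions on the span of indicators of balls; this span
   is dense (Dynkin's lemma and simple functions), and by Fatou's lemma they are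
   contractions on all of L^2.  On the span the truncated transforms are eventually
   constant, so they converge on L^2 by completeness.  The limit F is a linear contraction,
   and F composed with reflection and F is a contraction fixing a dense subspace, hence
   the identity.  Therefore |f| = |F (reflect (F f))| <= |F f| <= |f|, so F is isometric,
   and polarization gives Parseval. *)
From HB Require Import structures.
Require Import Defs.
From mathcomp Require Import all_boot all_order all_algebra.
From mathcomp Require Import complex.
From mathcomp Require Import ring lra zify.
From mathcomp Require Import all_classical all_reals all_analysis.
From mathcomp Require Import measurable_realfun.

Set Implicit Arguments.
Unset Strict Implicit.
Unset Printing Implicit Defensive.

Import Order.TTheory GRing.Theory Num.Theory.
Import numFieldNormedType.Exports.

Local Open Scope classical_set_scope.
Local Open Scope ring_scope.

(** * Arithmetic of p-adic integers *)

(** The arithmetic rests on $\mathbb{A}_f=\mathbb{Q}+\widehat{\mathbb{Z}}$,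
    $\mathbb{Q}\cap\widehat{\mathbb{Z}}=\mathbb{Z}$ and the fact that every positive integer divides
    some $m_k$. The first two make $\chi$ computable from any rational representative, with kernel
    exactly $\widehat{\mathbb{Z}}$; the third reduces the topology to the lattices. The analytic
    obstacle is that the truncated transform of a general [u] is not known beforehand to be
    square-integrable, so it cannot be extended by density as an operator. For fixed [xi], however,
    its value is an inner product against a fixed kernel, so approximation in $L^2$ gives pointwise
    convergence, and Fatou yields integrability and the bound at once. The constant must be exactly
    1, since the final chain of inequalities closes only for contractions; this is why Young's
    inequality with a free parameter [t] is used rather than a bound with factor 2. *)

Section padic_int_structure.
Variable p : prime_nat.
Implicit Types x y : padic_int p.

Lemma padic_intM x y n : (x * y) n = x n * y n. Proof. by []. Qed.

Lemma padic_intB x y n : (x - y) n = x n - y n. Proof. by []. Qed.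

Lemma padic_int_nat m n : (m%:R : padic_int p) n = m%:R.
Proof. by elim: m => // m IH; rewrite !mulrSr -IH. Qed.

Lemma padic_int_ltn x n : (x n < p ^ n.+1)%N.
Proof. by rewrite -[X in (_ < X)%N](Zp_cast (pexp_gt1 p n)) ltn_ord. Qed.

(** Division by p costs one digit of precision: component [n] of the quotient is read off component
    [n.+1] of [x], whose representative is divisible by p. *)
Lemma padic_int_divp x : x 0%N = 0 -> exists y, x = p%:R * y.
Proof.
move=> x0; have pp : (0 < p)%N by rewrite prime_gt0 // prime_natP.
have dx n : (p %| x n)%N.
  have := padic_int_modn x (leq0n n); rewrite x0 expn1 => /eqP.
  by rewrite /dvdn mod0n.
pose u : dep_prod (fun n => 'Z_(p ^ n.+1)) := fun n => (x n.+1 %/ p)%N%:R.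
have uE n : (u n : nat) = (x n.+1 %/ p)%N.
  rewrite val_Zp_nat ?pexp_gt1 // modn_small // ltn_divLR // -expnSr.
  exact: padic_int_ltn.
have uP : u \in @padic_compatible p.
  apply/asboolP => n; rewrite uE.
  have aux (a b : nat) : (p %| a)%N -> (p %| b)%N -> a = b %[mod p ^ n.+2] ->
      (a %/ p)%N%:R = (b %/ p)%N%:R :> 'Z_(p ^ n.+1).
    move=> /divnK {1}<- /divnK {1}<-; rewrite [(p ^ n.+2)%N]expnSr.
    rewrite -!muln_modl => /eqP; rewrite eqn_pmul2r // => /eqP ab.
    by rewrite -Zp_nat_mod ?pexp_gt1 // ab Zp_nat_mod ?pexp_gt1.
  by apply: aux => //; exact: padic_int_modn.
exists (PadicInt uP); apply: padic_int_eq => n.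
rewrite padic_intM padic_int_nat -[PadicInt uP n]/(u n) /u -natrM mulnC divnK //.
by rewrite padic_int_compat.
Qed.

Lemma padic_int_divpX k x : x k = 0 -> exists y, x = p%:R ^+ k.+1 * y.
Proof.
have pp : (0 < p)%N by rewrite prime_gt0 // prime_natP.
elim: k x => [|k IH] x xk; first by have [y ->] := padic_int_divp xk; exists y.
have x0 : x 0%N = 0.
  apply/val_inj; have := padic_int_modn x (leq0n k.+1).
  by rewrite xk mod0n modn_small // padic_int_ltn.
have [y xy] := padic_int_divp x0; have [|z yz] := IH y.
  apply/val_inj => /=; have := congr1 (fun z : padic_int p => z k.+1) xy.
  rewrite xk padic_intM padic_int_nat -[y k.+1]natr_Zp -natrM => /esym.
  move/(congr1 val); rewrite /= val_Zp_nat ?pexp_gt1 // => /eqP; rewrite -/(dvdn _ _).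
  (* Vanishing of component [k.+1] of [p * y] only gives $p^{k+1}\mid y_{k+1}$; this kills component
     [k] of [y] and feeds the induction. *)
  have aux (b : nat) : (p ^ k.+2 %| p * b)%N -> (p ^ k.+1 %| b)%N.
    by rewrite expnS dvdn_pmul2l.
  move=> /aux /eqP yk.
  have := padic_int_modn y (leqnSn k); rewrite yk => /esym.
  by rewrite modn_small // padic_int_ltn.
by exists z; rewrite xy yz mulrA -exprS.
Qed.

(** All components are prime to p because they reduce to [x 0] modulo p. Their inverses are
    compatible since multiplication by the unit [x n] turns both sides into 1. *)
Lemma padic_int_unit0 x : x 0%N != 0 -> x \is a GRing.unit.
Proof.
move=> x0; have pp := prime_natP p.
have cx n : coprime p (x n).
  rewrite prime_coprime //; apply: contra x0 => dx.
  have /eqP {}dx : (p ^ 1 %| x n)%N by rewrite expn1.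
  apply/eqP/val_inj; have := padic_int_modn x (leq0n n).
  by rewrite dx modn_small //; exact: padic_int_ltn.
have xU n : (x n : 'Z_(p ^ n.+1)) \is a GRing.unit.
  by rewrite -[x n]natr_Zp unitZpE ?pexp_gt1 // coprimeXl.
pose u : dep_prod (fun n => 'Z_(p ^ n.+1)) := fun n => (x n)^-1.
have uP : u \in @padic_compatible p.
  apply/asboolP => n; apply: (mulIr (xU n)); rewrite [RHS]mulVr ?xU //.
  rewrite -[X in _ * X](padic_int_compat x n) -natrM.
  have /modn_val_Zp e : (1 : 'Z_(p ^ n.+2)) = (u n.+1 * x n.+1)%N%:R.
    by rewrite natrM !natr_Zp mulVr ?xU.
  by rewrite (padic_red (esym e)).
have ux : PadicInt uP * x = 1.
  by apply: padic_int_eq => n; rewrite -[LHS]/(u n * x n) mulVr ?xU.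
by apply/unitrP; exists (PadicInt uP); split; rewrite // mulrC.
Qed.

(** Induction on the index of a nonzero component, which drops by one with each division by p; the
    process stops at a nonzero residue modulo p, that is, at a unit. *)
Lemma padic_int_valuation x : x != 0 ->
  exists k y, y \is a GRing.unit /\ x = p%:R ^+ k * y.
Proof.
move=> x0; have [n /(_ n (leqnn n)) xn] := padic_int_neq0 x0.
have {x0 xn} : x n != 0.
  by apply: contra xn => /eqP ->.
elim: n x => [|n IH] x xn.
  by exists 0%N, x; rewrite expr0 mul1r; split => //; exact: padic_int_unit0.
have [x0|/padic_int_unit0 xU] := eqVneq (x 0%N) 0; last first.
  by exists 0%N, x; rewrite expr0 mul1r.
have [y xy] := padic_int_divp x0; have [|k [z [zU yz]]] := IH y.
  apply: contra xn => /eqP yn; have [z yz] := padic_int_divpX yn.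
  by rewrite xy yz mulrA -exprS -natrX padic_intM padic_int_nat pchar_Zp ?pexp_gt1 ?mul0r.
by exists k.+1, z; split => //; rewrite xy yz mulrA -exprS.
Qed.

(** Characteristic zero: since $m<p^{m+1}$, component [m] of the integer [m] is [m] itself. *)
Lemma padic_int_nat_eq0 m : ((m%:R : padic_int p) == 0) = (m == 0)%N.
Proof.
apply/eqP/eqP => [m0|->//].
have := congr1 (fun z : padic_int p => z m : nat) m0.
rewrite padic_int_nat /= val_Zp_nat ?pexp_gt1 // modn_small //.
by rewrite (leq_trans (ltn_expl m (prime_gt1 (prime_natP p)))) // leq_exp2l //
  prime_gt1 // prime_natP.
Qed.

Lemma padic_nat_eq0 m : ((m%:R : padic p) == 0) = (m == 0)%N.
Proof. by rewrite -(rmorph_nat (@tofrac (padic_int p))) tofrac_eq0 padic_int_nat_eq0. Qed.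

Lemma padic_frac (x : padic p) :
  exists a b : padic_int p, b != 0 /\ x = tofrac a / tofrac b.
Proof.
elim/quotW: x => r; have b0 := denom_ratioP r.
exists (frac r).1, (frac r).2; split => //.
have bF : tofrac (frac r).2 != 0 by rewrite tofrac_eq0.
apply: (mulIf bF); rewrite divfK //.
rewrite -[tofrac _]/(FracField.tofrac _) -[_ * _]/(FracField.mul _ _).
rewrite !piE; apply/eqP; rewrite FracField.equivf_def /=.
rewrite /FracField.mulf !numden_Ratio ?mulr1 ?oner_eq0 //.
by rewrite mulrC.
Qed.

Lemma padic_natX_neq0 k : (p%:R ^+ k : padic p) != 0.
Proof.
by rewrite expf_neq0 // padic_nat_eq0 -lt0n prime_gt0 // prime_natP.
Qed.

(** With $x=c/p^k$ and $c\in\mathbb{Z}_p$, take for [m] the residue of [c]. Component [k] is a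
    residue modulo $p^{k+1}$, so the error even lies in $p\mathbb{Z}_p$. *)
Lemma padic_approx (x : padic p) :
  exists m k : nat, padic_integer p (x - m%:R / p%:R ^+ k).
Proof.
have [a [b [b0 ->]]] := padic_frac x.
have [k [u [uU ->]]] := padic_int_valuation b0.
pose c := a / u.
have pk0 := padic_natX_neq0 k.
exists (c k : nat), k.
have [|d cd] := @padic_int_divpX k (c - (c k : nat)%:R).
  by rewrite padic_intB padic_int_nat natr_Zp subrr.
exists (p%:R * d) => //.
apply: (mulIf pk0); rewrite mulrBl divfK // -!(rmorph_nat (@tofrac (padic_int p))).
rewrite -rmorphXn -rmorphM.
rewrite mulrAC -exprS -cd rmorphB rmorph_nat; congr (_ - _).
have uF : tofrac u != 0.
  by rewrite tofrac_eq0; apply: contraTneq uU => ->; rewrite unitr0.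
have pF : tofrac (p%:R ^+ k : padic_int p) != 0.
  by rewrite tofrac_eq0 expf_neq0 // padic_int_nat_eq0 -lt0n prime_gt0 // prime_natP.
transitivity (tofrac a / tofrac u : padic p).
  by rewrite /c [LHS]rmorphM [X in _ * X]rmorphV.
by rewrite [tofrac (_ * u)]rmorphM invfM mulrA mulrAC divfK.
Qed.

End padic_int_structure.

(** * Rational approximation of finite adeles *)

Section char0_ratr.
Variable F : fieldType.
Hypothesis F0 : forall n, (n%:R == 0 :> F) = (n == 0)%N.

Let intr_F_eq0 (z : int) : (z%:~R == 0 :> F) = (z == 0).
Proof.
by case: z => n; rewrite ?NegzE ?mulrNz ?oppr_eq0 -[X in X == _]/(_%:R) F0 ?oppr_eq0.
Qed.

(** Nonzero integers stay nonzero in [F], so cross-multiplication lets [ratr] be computed from any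
    fraction, reduced or not; additivity and multiplicativity follow. *)
Lemma ratr_frac (a b : int) : b != 0 ->
  ratr (a%:~R / b%:~R) = a%:~R / b%:~R :> F.
Proof.
move=> b0; pose q : rat := a%:~R / b%:~R; rewrite /ratr -/q; apply/eqP.
rewrite eqr_div ?intr_F_eq0 ?denq_neq0 // -!intrM; apply/eqP; congr (_ %:~R).
apply: (@intr_inj rat); rewrite !intrM.
have b0' : (b%:~R : rat) != 0 by rewrite intr_eq0.
have d0' : ((denq q)%:~R : rat) != 0 by rewrite intr_eq0 denq_neq0.
by apply/eqP; rewrite -eqr_div // divq_num_den /q eqxx.
Qed.

Lemma char0_ratrB : {morph (@ratr F) : x y / x - y}.
Proof.
move=> x y; rewrite {2 3}/ratr -{1}[x]divq_num_den -{1}[y]divq_num_den.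
have dxQ : ((denq x)%:~R : rat) != 0 by rewrite intr_eq0 denq_neq0.
have dyQ : ((denq y)%:~R : rat) != 0 by rewrite intr_eq0 denq_neq0.
have dxF : ((denq x)%:~R : F) != 0 by rewrite intr_F_eq0 denq_neq0.
have dyF : ((denq y)%:~R : F) != 0 by rewrite intr_F_eq0 denq_neq0.
rewrite -!mulNr !addf_div // !mulNr -!intrM -!rmorphB /=.
by rewrite ratr_frac // mulf_neq0 ?denq_neq0.
Qed.

Lemma char0_ratrM : {morph (@ratr F) : x y / x * y}.
Proof.
move=> x y; rewrite {2 3}/ratr -{1}[x]divq_num_den -{1}[y]divq_num_den.
by rewrite !mulf_div -!intrM ratr_frac // mulf_neq0 ?denq_neq0.
Qed.

End char0_ratr.

Lemma adele_of_rat_zmod : zmod_morphism adele_of_rat.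
Proof.
move=> x y; apply/val_inj/functional_extensionality_dep => p.
by apply: char0_ratrB => n; exact: padic_nat_eq0.
Qed.

Lemma adele_of_rat_monoid : monoid_morphism adele_of_rat.
Proof.
split => [|x y]; apply/val_inj/functional_extensionality_dep => p.
  exact: (ratr_nat (padic p) 1).
by apply: char0_ratrM => n; exact: padic_nat_eq0.
Qed.

HB.instance Definition _ := GRing.isZmodMorphism.Build rat finite_adele
  adele_of_rat adele_of_rat_zmod.
HB.instance Definition _ := GRing.isMonoidMorphism.Build rat finite_adele
  adele_of_rat adele_of_rat_monoid.

Lemma ZhatB x y : Zhat x -> Zhat y -> Zhat (x - y).
Proof. by move=> xZ yZ p; exact: padic_integerB. Qed.

Lemma ZhatM x y : Zhat x -> Zhat y -> Zhat (x * y).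
Proof. by move=> xZ yZ p; exact: padic_integerM. Qed.

Lemma Zhat0 : Zhat 0.
Proof. by move=> p; exact: (padic_integer_nat p 0). Qed.

Lemma Zhat1 : Zhat 1.
Proof. by move=> p; exact: (padic_integer_nat p 1). Qed.

Lemma ZhatN x : Zhat x -> Zhat (- x).
Proof. by move=> xZ; rewrite -sub0r; apply: ZhatB => //; exact: Zhat0. Qed.

Lemma ZhatD x y : Zhat x -> Zhat y -> Zhat (x + y).
Proof. by move=> xZ yZ; rewrite -[y]opprK; apply: ZhatB => //; exact: ZhatN. Qed.

Lemma Zhat_nat n : Zhat n%:R.
Proof.
by elim: n => [|n IH]; [exact: Zhat0 | rewrite mulrS; apply: ZhatD => //; exact: Zhat1].
Qed.

Lemma Zhat_int (z : int) : Zhat (adele_of_rat z%:~R).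
Proof.
rewrite rmorph_int; case: z => n; first exact: Zhat_nat.
by rewrite NegzE mulrNz; apply: ZhatN; exact: Zhat_nat.
Qed.

Lemma Zp_nat_eq0 n m : (1 < n)%N -> (m%:R : 'Z_n) = 0 <-> (n %| m)%N.
Proof.
move=> n1; split => [m0|/eqP m0]; first by rewrite /dvdn -(val_Zp_nat n1) m0.
by apply/val_inj; rewrite /= val_Zp_nat.
Qed.

(** A prime p dividing the denominator would divide the numerator too, as component 0 of the
    equality numerator = denominator times [z] shows; this contradicts coprimality. *)
Lemma Zhat_rat q : Zhat (adele_of_rat q) -> exists z : int, q = z%:~R.
Proof.
move=> qZ; have [d1|d1] := eqVneq `|denq q|%N 1%N.
  exists (numq q); rewrite -{1}[q]divq_num_den.
  by rewrite -[denq q]absz_denq d1 divr1.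
have dgt1 : (1 < `|denq q|)%N.
  by rewrite ltn_neqAle eq_sym d1 absz_gt0 denq_neq0.
have /pdivP[p pp pd] := dgt1.
pose P := PrimeNat pp.
have [z _ zq] := qZ P.
have e : ((numq q)%:~R : padic_int P) = (`|denq q|%N)%:R * z.
  apply/eqP; rewrite -tofrac_eq; apply/eqP.
  rewrite (rmorphM (@tofrac (padic_int P))) [X in _ = _ * X]zq.
  rewrite (rmorph_int (@tofrac (padic_int P))) (rmorph_nat (@tofrac (padic_int P))).
  rewrite -[adele_at _ _]/(ratr q : padic P) /ratr -[in X in _ / X]absz_denq.
  rewrite mulrC divfK //; change ((`|denq q|%N%:R : padic P) != 0).
  by rewrite padic_nat_eq0 absz_eq0 denq_neq0.
have Pp m : (m%:R : 'Z_(P ^ 1)) = 0 <-> (p %| m)%N.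
  have -> : p = (P ^ 1)%N by rewrite expn1.
  exact: Zp_nat_eq0 (pexp_gt1 P 0).
have pn : (p %| `|numq q|)%N.
  have := congr1 (fun x : padic_int P => x 0%N) e.
  rewrite padic_intM padic_int_nat ((Pp _).2 pd) mul0r => n0; apply/Pp.
  rewrite -padic_int_nat; case: (numq q) n0 => // n n0.
  by apply: oppr_inj; rewrite oppr0.
have := coprime_num_den q; rewrite /coprime => /eqP g1.
have := dvdn_gcd p `|numq q|%N `|denq q|%N; rewrite g1 pn pd dvdn1.
by move/eqP => pe; have := pp; rewrite pe.
Qed.

Lemma padic_ratr_frac (p q : prime_nat) m k :
  ratr (m%:R / q%:R ^+ k) = m%:R / q%:R ^+ k :> padic p.
Proof.
have qk0 : (q ^ k)%:Z != 0 by rewrite -lt0n expn_gt0 prime_gt0 // prime_natP.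
have := @ratr_frac (padic p) (@padic_nat_eq0 p) m%:Z _ qk0.
by rewrite -!pmulrn !natrX.
Qed.

Lemma padic_integer_frac (p q : prime_nat) m k : p != q ->
  padic_integer p (ratr (m%:R / q%:R ^+ k)).
Proof.
move=> pq; rewrite padic_ratr_frac.
apply: padic_integerM; first exact: padic_integer_nat.
have qU : ((q ^ k)%:R : padic_int p) \is a GRing.unit.
  apply: coprime_padic_int_unit; rewrite coprimeXr //.
  rewrite prime_coprime ?prime_natP // dvdn_prime2 ?prime_natP //.
exists ((q ^ k)%:R^-1) => //.
by rewrite [LHS]rmorphV // (rmorph_nat (@tofrac (padic_int p))) natrX.
Qed.

(** Induction on a finite list of primes outside of which [x] is integral. The correction made at p
    has a power of p as denominator, so it is integral at every other prime and does not spoil those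
    already treated. *)
Lemma adele_mod_rat (x : finite_adele) : exists q, Zhat (x - adele_of_rat q).
Proof.
have [s sP] : exists s : seq prime_nat, forall p, p \notin s -> padic_integer p (x p).
  have /asboolP/finite_seqP[s es] := adele_valP x; exists s => p ps.
  apply: contrapT => xp; have : [set p | ~ padic_integer p (x p)] p by [].
  by rewrite es /= (negPf ps).
suff [q [qs qs']] : exists q, (forall p, p \in s -> padic_integer p (x p - ratr q)) /\
    (forall p, p \notin s -> padic_integer p (ratr q)).
  exists q => p; have [ps|ps] := boolP (p \in s); first exact: qs.
  by apply: padic_integerB; [exact: sP|exact: qs'].
elim: s {sP} => [|p s [q [qs qs']]].
  by exists 0; split => // p _; rewrite (ratr_nat _ 0); exact: (padic_integer_nat p 0).
have [ps|ps] := boolP (p \in s).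
  exists q; split => p'.
    by rewrite inE => /predU1P[->|]; exact: qs.
  by rewrite inE negb_or => /andP[_]; exact: qs'.
have [m [k mk]] := padic_approx (x p - ratr q).
have F0 p' := @padic_nat_eq0 p'.
exists (q + m%:R / p%:R ^+ k).
have rE p' : ratr (q + m%:R / p%:R ^+ k) = ratr q + ratr (m%:R / p%:R ^+ k) :> padic p'.
  exact: (congr1 (fun x : finite_adele => x p') (rmorphD adele_of_rat q _)).
split => p'; rewrite inE rE; last first.
  rewrite negb_or => /andP[pp' p's]; rewrite -[X in _ + X]opprK.
  apply: padic_integerB; first exact: qs'.
  by rewrite -sub0r; apply: padic_integerB;
    [exact: (padic_integer_nat p' 0)|exact: padic_integer_frac].
have [-> _|pp' /= p's] := eqVneq p' p; last first.
  by rewrite opprD addrA; apply: padic_integerB; [exact: qs|exact: padic_integer_frac].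
by rewrite opprD addrA padic_ratr_frac.
Qed.

(** * The canonical character *)

(** Subtracting its floor moves any rational congruent to [x] modulo [Zhat] into [0,1), so the
    default value of [xget] is never taken. *)
Lemma fractional_partP (x : finite_adele) :
  0 <= fractional_part x < 1 /\ Zhat (x - adele_of_rat (fractional_part x)).
Proof.
rewrite /fractional_part; case: xgetP => [q _ //|/= no].
have [q xq] := adele_mod_rat x.
case: (no (q - (Num.floor q)%:~R)); split.
  by rewrite subr_ge0 floor_le_tmp ltrBlDl -{2}[1]/(1%:~R) -intrD floorD1_gt.
rewrite rmorphB /= opprB addrCA addrC; apply: ZhatD => //; exact: Zhat_int.
Qed.

Section add_char.
Variable R : realType.
Notation chi := (@add_char R).

Lemma expiD (s t : R) : expi (s + t) = expi s * expi t.
Proof. by rewrite /expi cosD sinD; congr Complex; rewrite addrC [sin s * _]mulrC. Qed.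

Lemma expi_2pi_int (z : int) : expi (2 * pi * ratr z%:~R : R) = 1.
Proof.
have nat_case n : expi (2 * pi * n%:R : R) = 1.
  elim: n => [|n IH]; first by rewrite mulr0 /expi cos0 sin0.
  rewrite -[n.+1%:R]natr1 [_ * (n%:R + 1)]mulrDr mulr1 expiD IH mul1r mulr_natl /expi.
  by rewrite cos2pi sin2pi.
rewrite ratr_int; case: z => n; first exact: nat_case.
rewrite NegzE mulrNz mulrN -[RHS](nat_case n.+1) /expi cosN sinN.
have [_ ->] : cos (2 * pi * n.+1%:R : R) = 1 /\ sin (2 * pi * n.+1%:R : R) = 0.
  by have [-> ->] := nat_case n.+1.
by rewrite oppr0.
Qed.

(** Two rationals congruent to [x] modulo [Zhat] differ by an integer, which the exponential does
    not see. Additivity of the character becomes immediate. *)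
Lemma add_charE x q : Zhat (x - adele_of_rat q) -> chi x = expi (2 * pi * ratr q).
Proof.
move=> xq; have [_ xf] := fractional_partP x.
have [|z qz] := @Zhat_rat (fractional_part x - q).
  have := ZhatB xq xf; rewrite opprB addrC addrA subrK => h.
  by rewrite rmorphB.
rewrite /add_char -[fractional_part x](subrK q) qz rmorphD /= mulrDr expiD.
by rewrite expi_2pi_int mul1r.
Qed.

Lemma add_charD x y : chi (x + y) = chi x * chi y.
Proof.
have [_ xf] := fractional_partP x; have [_ yf] := fractional_partP y.
rewrite (@add_charE _ (fractional_part x + fractional_part y)).
  by rewrite rmorphD [X in expi X]mulrDr expiD.
by rewrite rmorphD /= opprD addrACA; exact: ZhatD.
Qed.

Lemma add_char_Zhat x : Zhat x -> chi x = 1.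
Proof.
move=> xZ; rewrite (@add_charE _ 0%:~R) ?expi_2pi_int //.
by rewrite rmorph_int subr0.
Qed.

(** With $q=\{x\}$, $1=\cos 2\pi q=1-2\sin^2\pi q$ forces $\sin\pi q=0$, whereas $\sin\pi q>0$ for
    $0<q<1$. *)
Lemma add_char_eq1 x : chi x = 1 -> Zhat x.
Proof.
have [/andP[q0 q1] xf] := fractional_partP x.
rewrite /add_char; move: (fractional_part x) q0 q1 xf => q q0 q1 xq.
have [q00|qn0] := eqVneq q 0; first by move: xq; rewrite q00 rmorph0 subr0.
move=> [c1 _]; exfalso.
have q0' : 0 < q by rewrite lt_def qn0.
have : 0 < sin (pi * ratr q : R).
  apply: sin_gt0_pi; rewrite mulr_gt0 ?pi_gt0 ?ltr0q //= gtr_pMr ?pi_gt0 //.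
  by rewrite -(rmorph1 (@ratr R)) ltr_rat.
move: c1; rewrite -mulrA mulr_natl cos_mulr2n cos2sin2 => c1.
have : sin (pi * ratr q : R) ^+ 2 = 0 by move: c1; rewrite mulr2n; lra.
by move/eqP; rewrite sqrf_eq0 => /eqP ->; rewrite ltxx.
Qed.

Lemma add_charN x : chi (- x) = (chi x)^*%C.
Proof.
have [_ xf] := fractional_partP x.
rewrite (@add_charE _ (- fractional_part x)); last first.
  by rewrite rmorphN opprK addrC -opprB; exact: ZhatN.
by rewrite rmorphN mulrN /expi cosN sinN.
Qed.

Lemma add_char_norm x : complex.Re (chi x) ^+ 2 + complex.Im (chi x) ^+ 2 = 1.
Proof. exact: cos2Dsin2. Qed.

End add_char.

Lemma exp_psi_gt0 n : 0 < exp_psi n.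
Proof.
have lv k : (0 < lcm_value k)%N by case: k => // k; exact: lcm_upto_gt0.
by case: n => k; rewrite /exp_psi ?invr_gt0 ltr0n; exact: lv.
Qed.

Lemma exp_psi_neq0 n : exp_psi n != 0. Proof. exact: lt0r_neq0 (exp_psi_gt0 n). Qed.

Lemma exp_psiN n : exp_psi (- n) = (exp_psi n)^-1.
Proof.
by case: n => [[|n]|n]; [by rewrite oppr0 /= invr1|by []|exact: (esym (invrK _))].
Qed.

Lemma lcm_upto_dvd m n : (m <= n)%N -> (lcm_upto m %| lcm_upto n)%N.
Proof.
move=> mn; rewrite -(subnKC mn); elim: (n - m)%N => [|k IH]; first by rewrite addn0.
rewrite addnS (dvdn_trans IH) // [X in (_ %| X)%N]/lcm_upto big_nat_recr //=.
exact: dvdn_lcml.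
Qed.

Lemma lcm_value_dvd n : (lcm_value n %| lcm_value n.+1)%N.
Proof.
have [N e] : exists N, lcm_value n = lcm_upto N.
  have : range lcm_value (lcm_value n) by exists n.
  by rewrite range_lcm_value => -[N _ <-]; exists N.
rewrite /= {1}e; case: ex_minnP => M lt _; apply: lcm_upto_dvd.
by apply/ltnW; rewrite ltnNge; apply/negP => /lcm_upto_mono; rewrite -e leqNgt lt.
Qed.

(** Cofinality for divisibility: it makes the lattices exhaust the adeles and shrink to a basis of
    neighbourhoods of 0. *)
Lemma lcm_value_multiple N : (0 < N)%N -> exists k, (N %| lcm_value k)%N.
Proof.
move=> N0; have : [set lcm_upto N | N in [set N | (1 <= N)%N]] (lcm_upto N) by exists N.
rewrite -range_lcm_value => -[k _ e]; exists k; rewrite e.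
case: N N0 {e} => // N _; rewrite /lcm_upto big_nat_recr //=; exact: dvdn_lcmr.
Qed.

(** The integer [N] is the index of [frak_a m] in [frak_a n]; it gives both the nesting of the
    lattices and the ratio of their volumes. *)
Lemma exp_psi_dvd m n : m <= n -> exists2 N, (0 < N)%N & exp_psi n = N%:R * exp_psi m.
Proof.
have step i : exists2 N, (0 < N)%N & exp_psi (i + 1) = N%:R * exp_psi i.
  have lv k : (lcm_value k)%:R != 0 :> rat by exact: (exp_psi_neq0 k).
  have /all_sig[c cE] k : {c | lcm_value k.+1 = (c * lcm_value k)%N}.
    by exists (lcm_value k.+1 %/ lcm_value k)%N; rewrite divnK ?lcm_value_dvd.
  have c0 k : (0 < c k)%N.
    have := lcm_upto_gt0 (ex_minn (lcm_upto_unbounded (lcm_value k))).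
    by rewrite -[lcm_upto _]/(lcm_value k.+1) cE muln_gt0 => /andP[].
  (* The cases are i >= 0, i = -1 and i <= -2. Passing from -1 to 0 multiplies by $m_1$; for
     $i=-(k+2)$ the factor is $m_{k+2}/m_{k+1}$. *)
  case: i => [k|[|k]].
  - exists (c k) => //; have -> : Posz k + 1 = Posz k.+1 by rewrite -addn1 PoszD.
    by rewrite /exp_psi cE natrM.
  - by exists (lcm_value 1) => //; [exact: lcm_upto_gt0 | rewrite divff].
  - exists (c k.+1) => //.
    have -> : Negz k.+1 + 1 = Negz k by rewrite !NegzE -addn1 PoszD opprD subrK.
    rewrite /exp_psi (cE k.+1) natrM invfM mulrA divff ?mul1r //.
    by rewrite pnatr_eq0 -lt0n.
move=> mn; have -> : n = m + (`|n - m|%N)%:Z by rewrite gez0_abs ?subr_ge0 // subrKC.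
elim: `|n - m|%N => [|k [N N0 IH]]; first by exists 1%N; rewrite ?addr0 ?mul1r.
have [c c0 cE] := step (m + k%:Z); exists (c * N)%N; first by rewrite muln_gt0 c0.
by rewrite -addn1 PoszD addrA cE IH natrM mulrA.
Qed.

(** * The lattices [frak_a n] *)

Notation aq := adele_of_rat.

Lemma adele_of_rat_nat n : aq n%:R = n%:R. Proof. exact: rmorph_nat. Qed.

Lemma frak_aE n x : frak_a n x <-> Zhat (aq (exp_psi n) * x).
Proof.
have e0 := exp_psi_neq0 n; split => [[z zZ <-]|xZ].
  by rewrite mulrA -rmorphM divff // rmorph1 mul1r.
by exists (aq (exp_psi n) * x) => //; rewrite mulrA -rmorphM mulVf // rmorph1 mul1r.
Qed.

Lemma frak_a0 n : frak_a n 0.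
Proof. by apply/frak_aE; rewrite mulr0; exact: Zhat0. Qed.

Lemma frak_aB n x y : frak_a n x -> frak_a n y -> frak_a n (x - y).
Proof. by move=> /frak_aE xa /frak_aE ya; apply/frak_aE; rewrite mulrBr; exact: ZhatB. Qed.

Lemma frak_aN n x : frak_a n x -> frak_a n (- x).
Proof. by rewrite -sub0r; apply: frak_aB; exact: frak_a0. Qed.

Lemma frak_aD n x y : frak_a n x -> frak_a n y -> frak_a n (x + y).
Proof. by move=> xa ya; rewrite -[y]opprK; apply: frak_aB => //; exact: frak_aN. Qed.

Lemma frak_aNE n x : frak_a n (- x) <-> frak_a n x.
Proof. by split; [rewrite -{2}[x]opprK|]; exact: frak_aN. Qed.

Lemma sub_frak_a m n : m <= n -> frak_a m `<=` frak_a n.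
Proof.
move=> /exp_psi_dvd[N N0 e] x /frak_aE xa; apply/frak_aE.
by rewrite e rmorphM -mulrA; apply: ZhatM => //; rewrite rmorph_nat; exact: Zhat_nat.
Qed.

(** Modulo [Zhat] the adele is a rational [q], and multiplication by an $m_k$ divisible by the
    denominator of [q] makes it integral. *)
Lemma bigcup_frak_a x : exists l : nat, frak_a l x.
Proof.
have [q xq] := adele_mod_rat x.
have [|k dk] := @lcm_value_multiple `|denq q|%N; first by rewrite absz_gt0 denq_neq0.
exists k; apply/frak_aE; rewrite -[x](subrK (aq q)) mulrDr -rmorphM.
apply: ZhatD; first by apply: ZhatM => //; rewrite rmorph_nat; exact: Zhat_nat.
have -> : exp_psi k * q = ((lcm_value k %/ `|denq q|)%N%:Z * numq q)%:~R.
  rewrite intrM numqE -{2}(absz_denq q) /= -!pmulrn -{1}(divnK dk) natrM mulrA.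
  by rewrite mulrAC.
exact: Zhat_int.
Qed.

(** [frak_a (- k)] is $m_k\widehat{\mathbb{Z}}$, contained in $N\widehat{\mathbb{Z}}$ as soon as [N]
    divides $m_k$. *)
Lemma frak_a_basis N : (0 < N)%N ->
  exists k : nat, forall x, frak_a (- k%:Z) x -> exists2 z, Zhat z & x = N%:R * z.
Proof.
move=> N0; have [k dk] := lcm_value_multiple N0; exists k => x /frak_aE.
rewrite exp_psiN => xa.
exists (aq N%:R^-1 * x); last first.
  by rewrite mulrA -adele_of_rat_nat -rmorphM divff ?rmorph1 ?mul1r // pnatr_eq0 -lt0n.
have -> : N%:R^-1 = (lcm_value k %/ N)%N%:R * (exp_psi k)^-1 :> rat.
  rewrite /= -{2}(divnK dk) natrM invfM mulrA divff ?mul1r //.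
  by rewrite pnatr_eq0 -lt0n divn_gt0 // dvdn_leq // -(ltr0n rat) (exp_psi_gt0 k).
by rewrite rmorphM -mulrA; apply: ZhatM => //; rewrite rmorph_nat; exact: Zhat_nat.
Qed.

Lemma frak_a_Zhat_nat (k : nat) z : Zhat z -> frak_a (- k%:Z) ((lcm_value k)%:R * z).
Proof.
move=> zZ; apply/frak_aE; rewrite exp_psiN -adele_of_rat_nat mulrA -rmorphM.
by rewrite mulVf ?rmorph1 ?mul1r // (exp_psi_neq0 k).
Qed.

Lemma frak_a_dual n x y : frak_a n x -> frak_a (- n) y -> Zhat (x * y).
Proof.
move=> /frak_aE xa /frak_aE; rewrite exp_psiN => ya.
have := ZhatM xa ya; rewrite mulrACA -rmorphM divff ?exp_psi_neq0 //.
by rewrite rmorph1 mul1r.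
Qed.

Lemma frak_a_gen n : frak_a n (aq (exp_psi n)^-1).
Proof. by exists 1; [exact: Zhat1|rewrite mulr1]. Qed.

Lemma add_char_frak_a (R : realType) n x y : frak_a n x -> frak_a (- n) y ->
  add_char R (x * y) = 1.
Proof. by move=> xa ya; apply: add_char_Zhat; exact: frak_a_dual ya. Qed.

(** As the kernel of the character is [Zhat], one generator of [frak_a n] suffices to detect its
    annihilator. *)
Lemma add_char_gen (R : realType) n y :
  add_char R (aq (exp_psi n)^-1 * y) = 1 -> frak_a (- n) y.
Proof. by move=> /add_char_eq1 h; apply/frak_aE; rewrite exp_psiN. Qed.

(** * The topology of the adeles in terms of lattices *)

Section adele_topology.

Lemma padic_integerD (p : prime_nat) (x y : padic p) :
  padic_integer p x -> padic_integer p y -> padic_integer p (x + y).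
Proof. by move=> [a _ <-] [b _ <-]; exists (a + b) => //; rewrite rmorphD. Qed.

Lemma padic_integer_pX_div (p : prime_nat) N : (0 < N)%N ->
  exists k, padic_integer p (p%:R ^+ k / N%:R).
Proof.
move=> N0; have Np0 : (N%:R : padic_int p) != 0 by rewrite padic_int_nat_eq0 -lt0n.
have [k [u [uU e]]] := padic_int_valuation Np0; exists k.
exists u^-1 => //; have NF : (N%:R : padic p) != 0 by rewrite padic_nat_eq0 -lt0n.
apply: (mulIf NF); rewrite divfK // -(rmorph_nat (@tofrac (padic_int p)) N).
rewrite e -(rmorph_nat (@tofrac (padic_int p))) -(rmorphXn (@tofrac (padic_int p))).
by rewrite -[LHS](rmorphM (@tofrac (padic_int p))) mulrCA mulVr ?mulr1.
Qed.

Lemma padic_integer_nat_inv (p : prime_nat) N : ~~ (p %| N)%N ->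
  padic_integer p (N%:R^-1).
Proof.
move=> pN; have NU : (N%:R : padic_int p) \is a GRing.unit.
  by apply: coprime_padic_int_unit; rewrite prime_coprime // prime_natP.
exists N%:R^-1 => //.
by rewrite [LHS]rmorphV // (rmorph_nat (@tofrac (padic_int p))).
Qed.

(** Only finitely many sides of a box differ from $\mathbb{Z}_p$, so a single integer [N]
    accommodates them all. Conversely $x+N\widehat{\mathbb{Z}}$ is itself a box, with sides
    $x_p+N\mathbb{Z}_p$. *)
Lemma adele_openP (U : set finite_adele) : open U <->
  (forall x, U x -> exists2 N, (0 < N)%N & forall z, Zhat z -> U (x + N%:R * z)).
Proof.
rewrite -[open U]/(adele_open U).
split => [Uo x /(Uo x)[V [Vo Vx Vf VU]]|Uo x /Uo[N N0 NU]].
  have /finite_seqP[s es] := Vf.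
  have /all_sig[k kP] p : {k | forall z, padic_integer p z -> V p (x p + p%:R ^+ k * z)}.
    by apply: cid; exact: (Vo p _ (Vx p)).
  exists (\prod_(p <- undup s) p ^ k p)%N.
    by rewrite big_seq prodn_cond_gt0 // => p _; rewrite expn_gt0 prime_gt0 // prime_natP.
  move=> z zZ; apply: VU => p; rewrite -[adele_at (_ + _) p]/(x p + adele_at _%:R p * z p).
  have natp (m : nat) : (m%:R : finite_adele) p = m%:R.
    by elim: m => // m IH; rewrite !mulrSr -IH.
  rewrite natp.
  have [ps|ps] := boolP (p \in s); last first.
    have Vp : V p = padic_integer p.
      apply: contrapT => Vp; have : [set p | V p <> padic_integer p] p by [].
      by rewrite es /= (negPf ps).
    move: (Vx p); rewrite Vp => xp; apply: padic_integerD => //.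
    by apply: padic_integerM => //; exact: padic_integer_nat.
  rewrite (bigD1_seq p) ?undup_uniq ?mem_undup //= natrM natrX -mulrA.
  by apply: kP; apply: padic_integerM => //; exact: padic_integer_nat.
have NF p : (N%:R : padic p) != 0 by rewrite padic_nat_eq0 -lt0n.
exists (fun p => [set y | padic_integer p ((y - x p) / N%:R)]); split.
- move=> p; rewrite -[open _]/(padic_open _) => y /= yV.
  have [k kP] := padic_integer_pX_div p N0; exists k => z zZ /=.
  rewrite addrAC mulrDl; apply: padic_integerD => //.
  by rewrite mulrAC; exact: padic_integerM.
- by move=> p /=; rewrite subrr mul0r; exact: (padic_integer_nat p 0).
- apply: (@sub_finite_set _ _ ([set p | ~ padic_integer p (x p)] `|`
     (prime_val @^-1` [set n | (n <= N)%N]))).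
    move=> p /= Vp; have [xp|] := pselect (padic_integer p (x p)); last by left.
    (* For p > N the integer [N] is a unit of $\mathbb{Z}_p$, so the side through an integral [x p]
       is $\mathbb{Z}_p$ itself. *)
    right; rewrite leqNgt; apply/negP => pN; apply: Vp.
    have NV : padic_integer p (N%:R^-1).
      by apply: padic_integer_nat_inv; apply/negP => /(dvdn_leq N0); rewrite leqNgt pN.
    apply/seteqP; split => y /= yp; last by apply: padic_integerM => //; exact: padic_integerB.
    rewrite -[y](subrK (x p)); apply: padic_integerD => //.
    by rewrite -[_ - _](divfK (NF p)); apply: padic_integerM => //; exact: padic_integer_nat.
  rewrite finite_setU; split; first by have /asboolP := adele_valP x.
  by apply: finite_preimage; [move=> p r _ _; exact: val_inj|exact: (finite_II N.+1)].
- move=> y yV /=; have -> : y = x + N%:R * (aq N%:R^-1 * (y - x)).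
    rewrite mulrA -adele_of_rat_nat -rmorphM divff ?rmorph1 ?mul1r ?subrKC //.
    by rewrite pnatr_eq0 -lt0n.
  apply: NU => p; have := yV p; rewrite /= mulrC.
  congr (padic_integer p (_ * _)).
  have := @ratr_frac (padic p) (@padic_nat_eq0 p) 1 N%:Z.
  by rewrite -!pmulrn !mul1r => -> //; rewrite -lt0n.
Qed.

Lemma adele_openE (U : set finite_adele) : open U <->
  (forall x, U x -> exists k : nat, forall z, frak_a (- k%:Z) z -> U (x + z)).
Proof.
split => [/adele_openP Uo x /Uo[N N0 NU]|Uo].
  by have [k kP] := frak_a_basis N0; exists k => _ /kP[z zZ ->]; exact: NU.
apply/adele_openP => x /Uo[k kU]; exists (lcm_value k).
  by rewrite -(ltr0n rat) (exp_psi_gt0 k).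
by move=> z zZ; apply: kU; exact: frak_a_Zhat_nat.
Qed.

End adele_topology.

(** * Balls and Haar measure *)

Definition adele_ball (a : finite_adele) (n : int) : set finite_adele :=
  [set x | frak_a n (x - a)].

Lemma leN_absz (n : int) : - (`|n|%N%:Z) <= n.
Proof. by rewrite abszE lerNl -[X in _ <= X]normrN ler_norm. Qed.

Lemma adele_ball_open a n : open (adele_ball a n).
Proof.
apply/adele_openE => x ax; exists `|n|%N => z za; rewrite /adele_ball /= addrAC.
apply: frak_aD => //; apply: sub_frak_a za.
exact: leN_absz.
Qed.

Lemma adele_ball0 n : adele_ball 0 n = frak_a n.
Proof. by apply/seteqP; split => x; rewrite /adele_ball /= subr0. Qed.

(** The ultrametric phenomenon: two balls with a common point are nested, so an intersection of two
    balls is a ball or empty. *)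
Lemma adele_ball_sub a b m n x : m <= n -> adele_ball a m x -> adele_ball b n x ->
  adele_ball a m `<=` adele_ball b n.
Proof.
move=> mn ax bx y ay; rewrite /adele_ball /= in ax bx ay *.
have -> : y - b = (y - a) - (x - a) + (x - b) by ring.
by apply: frak_aD => //; apply: frak_aB; exact: (sub_frak_a mn).
Qed.

Lemma adele_ballI a b m n : m <= n ->
  adele_ball a m `&` adele_ball b n = if `[< frak_a n (a - b) >] then adele_ball a m else set0.
Proof.
move=> mn; have am : adele_ball a m a by rewrite /adele_ball /= subrr; exact: frak_a0.
case: asboolP => ab.
  by apply/setIidPl; exact: (adele_ball_sub mn am).
apply/seteqP; split => // x [ax bx]; apply: ab.
exact: (adele_ball_sub mn ax bx am).
Qed.

(** The empty set is adjoined to make the family stable under intersection, as uniqueness of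
    measures and Dynkin's lemma demand. *)
Definition adele_balls : set_system finite_adele :=
  [set A | A = set0 \/ exists a n, A = adele_ball a n].

Lemma adele_balls_setI : setI_closed adele_balls.
Proof.
move=> _ _ [->|[a [m ->]]] [->|[b [n ->]]]; rewrite ?set0I ?setI0; try by left.
wlog mn : a b m n / m <= n.
  by move=> W; have /orP[|] := le_total m n; [|rewrite setIC]; exact: W.
by rewrite adele_ballI //; case: asboolP; [right; exists a, m|left].
Qed.

Lemma adele_open_measurable (U : set finite_adele) : open U -> measurable U.
Proof. by move=> Uo; exact: sub_sigma_algebra. Qed.

Lemma adele_ball_measurable a n : measurable (adele_ball a n).
Proof. by apply: adele_open_measurable; exact: adele_ball_open. Qed.

Lemma frak_a_measurable n : measurable (frak_a n).
Proof. by rewrite -adele_ball0; exact: adele_ball_measurable. Qed.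

(* Rational points are dense, so countably many balls suffice. *)
Lemma adele_ball_rat (n : int) x : exists q, frak_a n (x - aq q).
Proof.
have [q xq] := adele_mod_rat (aq (exp_psi n) * x).
exists ((exp_psi n)^-1 * q); apply/frak_aE.
by rewrite mulrBr -rmorphM mulrA divff ?mul1r // exp_psi_neq0.
Qed.

Lemma adele_measurableE : @measurable _ finite_adele = <<s adele_balls >>.
Proof.
apply/seteqP; split; last first.
  apply: smallest_sub; first exact: sigma_algebra_measurable.
  by move=> _ [->|[a [n ->]]] //; exact: adele_ball_measurable.
apply: smallest_sub; first exact: smallest_sigma_algebra.
move=> U /adele_openE Uo.
(* Only rational centres and indices [- k] are enumerated, a countable family; a ball not contained
   in [U] contributes the empty set. *)
pose F (i : rat * nat) : set (g_sigma_algebraType adele_balls) :=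
  if `[< adele_ball (aq i.1) (- i.2%:Z) `<=` U >]
  then adele_ball (aq i.1) (- i.2%:Z) else set0.
have -> : U = \bigcup_i F i.
  apply/seteqP; split => [x Ux|x [i _]]; last first.
    by rewrite /F; case: asboolP => // iU; exact: iU.
  have [k kU] := Uo x Ux; have [q xq] := adele_ball_rat (- k%:Z) x.
  exists (q, k) => //; rewrite /F; case: asboolP => //= -[].
  move=> y yq; rewrite -[y](subrKC x); apply: kU.
  have -> : y - x = (y - aq q) - (x - aq q) by rewrite opprB addrA subrK.
  exact: frak_aB.
apply: (@countable_bigcupT_measurable _ (g_sigma_algebraType adele_balls)).
  exact: countableP.
move=> i; rewrite /F; case: asboolP => _; last exact: measurable0.
by apply: sub_sigma_algebra; right; exists (aq i.1), (- i.2%:Z).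
Qed.

Lemma locally_constant_measurable (R : realType) n (f : finite_adele -> R) :
  (forall x z, frak_a n z -> f (x + z) = f x) -> measurable_fun setT f.
Proof.
move=> fc _ B _; rewrite setTI; apply: adele_open_measurable.
apply/adele_openE => x Bx; exists `|n|%N => z za; rewrite /preimage /= fc //.
by apply: sub_frak_a za; exact: leN_absz.
Qed.

Section haar_measure.
Variables (R : realType) (mu : {measure set finite_adele -> \bar R}).
Hypothesis mu_haar : is_haar mu.
Hypothesis mu_Zhat : mu Zhat = 1%E.

Lemma haar_ball a n : mu (adele_ball a n) = mu (frak_a n).
Proof.
have [tr _ _] := mu_haar; rewrite -(tr a _ (frak_a_measurable n)); congr (mu _).
apply/seteqP; split => [x ax|_ [y ya <-]].
  by exists (x - a) => //; rewrite subrKC.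
by rewrite /adele_ball /= addrC addKr.
Qed.

Lemma frak_a0E : frak_a 0 = Zhat.
Proof.
apply/seteqP; split => x; rewrite frak_aE [exp_psi 0]/= rmorph1 mul1r //.
Qed.

(** After multiplication by [exp_psi n] this is the decomposition of $\widehat{\mathbb{Z}}$ into the
    classes of 0, ..., N-1 modulo $N\widehat{\mathbb{Z}}$. *)
Lemma frak_a_cosets m n N : exp_psi n = N%:R * exp_psi m -> (0 < N)%N ->
  frak_a n = \big[setU/set0]_(i < N) adele_ball (aq (i%:R / exp_psi n)) m /\
  trivIset setT (fun i : 'I_N => adele_ball (aq (i%:R / exp_psi n)) m).
Proof.
move=> e N0; have NQ : (N%:R : rat) != 0 by rewrite pnatr_eq0 -lt0n.
have mE : exp_psi m = N%:R^-1 * exp_psi n by rewrite e mulrA mulVf ?mul1r.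
have ballE i x : adele_ball (aq (i%:R / exp_psi n)) m x <->
    Zhat (aq (N%:R^-1) * (aq (exp_psi n) * x - i%:R)).
  rewrite /adele_ball /= frak_aE mE rmorphM -mulrA mulrBr -[X in _ - X]rmorphM.
  by rewrite [exp_psi n * _]mulrCA divff ?exp_psi_neq0 // mulr1 rmorph_nat.
split.
  apply/seteqP; split => x;
    rewrite -(bigcup_mkord N (fun i => adele_ball (aq (i%:R / exp_psi n)) m));
    last first.
    move=> [i _ /ballE h]; apply/frak_aE.
    have := ZhatM (Zhat_nat N) h; rewrite mulrA -adele_of_rat_nat -rmorphM divff //.
    by rewrite rmorph1 mul1r => h'; have := ZhatD h' (Zhat_nat i); rewrite subrK.
  move=> /frak_aE xn; set y := aq (exp_psi n) * x in xn.
  (* The class of [y] is read off the fractional part of y/N: [N] times it is an integer by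
     [Zhat_rat], and lies in [0,N). *)
  have [/andP[q0 q1] yq] := fractional_partP (aq (N%:R^-1) * y).
  set q := fractional_part _ in q0 q1 yq.
  have yN : Zhat (y - aq (N%:R * q)).
    have := ZhatM (Zhat_nat N) yq; rewrite mulrBr mulrA -adele_of_rat_nat -rmorphM.
    by rewrite divff // rmorph1 mul1r -rmorphM.
  have [|z qz] := @Zhat_rat (N%:R * q).
    by have := ZhatB xn yN; rewrite opprB addrC subrK.
  have z0 : 0 <= z by rewrite -(ler_int rat) -qz mulr_ge0.
  have zN : z < N%:Z.
    by rewrite -(ltr_int rat) -qz gtr_pMr // ltr0n.
  exists `|z|%N.
    by rewrite /= -ltz_nat gez0_abs.
  apply/ballE; rewrite -/y mulrBr -adele_of_rat_nat -rmorphM.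
  have -> : (`|z|%N)%:R = N%:R * q by rewrite qz pmulrn gez0_abs.
  by rewrite mulrA mulVf ?mul1r.
apply/trivIsetP => i j _ _ ij; apply/seteqP; split => // x [/ballE xi /ballE xj].
(* A common point makes (j - i)/N an integer, and |j - i| < N then makes it zero. *)
have : Zhat (aq N%:R^-1 * (j%:R - i%:R)).
  have -> : aq N%:R^-1 * (j%:R - i%:R) = aq N%:R^-1 * (aq (exp_psi n) * x - i%:R) -
    aq N%:R^-1 * (aq (exp_psi n) * x - j%:R) by ring.
  exact: ZhatB.
rewrite -!adele_of_rat_nat -rmorphB -rmorphM => /Zhat_rat[z].
move/(congr1 (fun q => N%:R * q)); rewrite mulrA divff // mul1r !pmulrn -intrM -intrB.
move/intr_inj => e'; move/eqP: ij; apply; apply/val_inj => /=.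
have iN := ltn_ord i; have jN := ltn_ord j.
have [z1|z1|z0] := ltgtP z 0; [exfalso|exfalso|by move: e'; rewrite z0; lia]; nia.
Qed.

(** Coset counting and translation invariance make the volume proportional to the index, normalised
    at [frak_a 0], which is [Zhat]. For negative [n] the relation is read backwards, as
    $1=N\mu(\mathfrak{a}^n)$. *)
Lemma haar_frak_a n : mu (frak_a n) = (ratr (exp_psi n))%:E.
Proof.
have scale m k : m <= k -> exists2 N, exp_psi k = N%:R * exp_psi m &
    mu (frak_a k) = (N%:R%:E * mu (frak_a m))%E.
  move=> /exp_psi_dvd[N N0 e]; exists N => //.
  have [-> tI] := frak_a_cosets e N0.
  rewrite measure_bigsetU_ord //; last by move=> i; exact: adele_ball_measurable.
  rewrite (eq_bigr (fun=> mu (frak_a m))); last by move=> i _; exact: haar_ball.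
  by rewrite sumr_const card_ord mule_natl.
have [n0|n0] := leP 0 n.
  have [N -> ->] := scale _ _ n0.
  by rewrite frak_a0E mu_Zhat mule1 mulr1 ratr_nat.
have [N e] := scale _ _ (ltW n0); rewrite frak_a0E mu_Zhat => e'.
have N0 : (N%:R : R) != 0.
  by apply: contra_eq_neq e' => ->; rewrite mul0e eqe oner_eq0.
have -> : ratr (exp_psi n) = N%:R^-1 :> R.
  move: e; rewrite [exp_psi 0]/= => /(congr1 (@ratr R)).
  rewrite rmorph1 rmorphM /= ratr_nat => /(canLR (mulKf N0)).
  by rewrite mulr1.
have /(congr1 (fun t => (N%:R^-1)%:E * t)%E) := e'.
by rewrite mule1 muleA -EFinM mulVf // mul1e.
Qed.

End haar_measure.

(** * Complex square-integrable functions *)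

Section complex_functions.
Context d (T : measurableType d) (R : realType).
Implicit Types (f g : T -> R[i]) (D : set T).

Lemma cReB (x y : R[i]) : complex.Re (x - y) = complex.Re x - complex.Re y.
Proof. by case: x y => ? ? []. Qed.
Lemma cImB (x y : R[i]) : complex.Im (x - y) = complex.Im x - complex.Im y.
Proof. by case: x y => ? ? []. Qed.
Lemma cReD (x y : R[i]) : complex.Re (x + y) = complex.Re x + complex.Re y.
Proof. by case: x y => ? ? []. Qed.
Lemma cImD (x y : R[i]) : complex.Im (x + y) = complex.Im x + complex.Im y.
Proof. by case: x y => ? ? []. Qed.
Lemma cReM (x y : R[i]) : complex.Re (x * y) =
  complex.Re x * complex.Re y - complex.Im x * complex.Im y.
Proof. by case: x y => ? ? []. Qed.
Lemma cImM (x y : R[i]) : complex.Im (x * y) =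
  complex.Re x * complex.Im y + complex.Im x * complex.Re y.
Proof. by case: x y => ? ? []. Qed.
Lemma cReJ (x : R[i]) : complex.Re x^*%C = complex.Re x. Proof. by case: x. Qed.
Lemma cImJ (x : R[i]) : complex.Im x^*%C = - complex.Im x. Proof. by case: x. Qed.

Definition normsq (x : R[i]) : R := complex.Re x ^+ 2 + complex.Im x ^+ 2.

Lemma normsq_ge0 x : 0 <= normsq x. Proof. by rewrite addr_ge0 ?sqr_ge0. Qed.

Lemma normsqM x y : normsq (x * y) = normsq x * normsq y.
Proof. by rewrite /normsq cReM cImM; ring. Qed.

Lemma normsq_eq0 x : normsq x = 0 -> x = 0.
Proof.
case: x => a b /eqP; rewrite /normsq /= paddr_eq0 ?sqr_ge0 // !sqrf_eq0.
by move=> /andP[/eqP -> /eqP ->].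
Qed.

Lemma normsqJ x : normsq x^*%C = normsq x.
Proof. by rewrite /normsq cReJ cImJ sqrrN. Qed.

Lemma mulcJ x : x * x^*%C = (normsq x)%:C%C.
Proof.
case: x => a b; rewrite /normsq; apply/eqP; rewrite eq_complex /=.
by apply/andP; split; apply/eqP; ring.
Qed.

(* Young's inequality; the free parameter [t] turns density arguments into sharp bounds. *)
Lemma normsqD t x y : 0 < t ->
  normsq (x + y) <= (1 + t) * normsq x + (1 + t^-1) * normsq y.
Proof.
move=> t0; rewrite /normsq cReD cImD.
have young (a b : R) : (a + b) ^+ 2 <= (1 + t) * a ^+ 2 + (1 + t^-1) * b ^+ 2.
  rewrite -subr_ge0.
  have -> : (1 + t) * a ^+ 2 + (1 + t^-1) * b ^+ 2 - (a + b) ^+ 2 =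
    t^-1 * (t * a - b) ^+ 2 by field; exact: lt0r_neq0.
  by rewrite mulr_ge0 ?sqr_ge0 // invr_ge0 ltW.
have := young (complex.Re x) (complex.Re y).
have := young (complex.Im x) (complex.Im y).
by rewrite !mulrDr; lra.
Qed.

Definition cmeasurable D f := measurable_fun D (fun x => complex.Re (f x)) /\
  measurable_fun D (fun x => complex.Im (f x)).

Lemma cmeasurableD D f g : cmeasurable D f -> cmeasurable D g ->
  cmeasurable D (fun x => f x + g x).
Proof.
move=> [fr fi] [gr gi]; split.
  by under eq_fun do rewrite cReD; exact: measurable_funD.
by under eq_fun do rewrite cImD; exact: measurable_funD.
Qed.

Lemma cmeasurableB D f g : cmeasurable D f -> cmeasurable D g ->
  cmeasurable D (fun x => f x - g x).
Proof.
move=> [fr fi] [gr gi]; split.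
  by under eq_fun do rewrite cReB; exact: measurable_funB.
by under eq_fun do rewrite cImB; exact: measurable_funB.
Qed.

Lemma cmeasurableM D f g : cmeasurable D f -> cmeasurable D g ->
  cmeasurable D (fun x => f x * g x).
Proof.
move=> [fr fi] [gr gi]; split.
  by under eq_fun do rewrite cReM; apply: measurable_funB; exact: measurable_funM.
by under eq_fun do rewrite cImM; apply: measurable_funD; exact: measurable_funM.
Qed.

Lemma cmeasurableJ D f : cmeasurable D f -> cmeasurable D (fun x => (f x)^*%C).
Proof.
move=> [fr fi]; split; first by under eq_fun do rewrite cReJ.
by under eq_fun do rewrite cImJ; exact: measurableT_comp.
Qed.

Lemma cmeasurable_cst D (c : R[i]) : cmeasurable D (fun=> c).
Proof. by split; exact: measurable_cst. Qed.

Lemma cmeasurable_normsq D f : cmeasurable D f ->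
  measurable_fun D (fun x => (normsq (f x))%:E).
Proof.
by move=> [fr fi]; apply/measurable_EFinP; apply: measurable_funD; exact: measurable_funX.
Qed.

Lemma cmeasurableS D f : measurable D -> cmeasurable setT f -> cmeasurable D f.
Proof. by move=> mD [fr fi]; split; exact: measurable_funTS. Qed.

Definition cindic (A : set T) (x : T) : R[i] := ((x \in A)%:R)%:C%C.

Lemma cmeasurable_indic D A : measurable A -> cmeasurable D (cindic A).
Proof.
move=> mA; split; last exact: measurable_cst.
by apply: measurable_funTS; exact: measurable_indic.
Qed.

End complex_functions.

Arguments cindic {d T R} A x.

Section complex_integral.
Context d (T : measurableType d) (R : realType).
Variable mu : {measure set T -> \bar R}.
Implicit Types (f g : T -> R[i]) (D : set T).

Definition cintegrable D f := mu.-integrable D (fun x => (complex.Re (f x))%:E) /\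
  mu.-integrable D (fun x => (complex.Im (f x))%:E).

Lemma eq_cintegral D f g : (forall x, D x -> f x = g x) ->
  cintegral mu D f = cintegral mu D g.
Proof.
by move=> fg; congr Complex; apply: eq_Rintegral => x; rewrite inE => /fg ->.
Qed.

Lemma ae_eq_cintegral D f g : measurable D -> cmeasurable D f -> cmeasurable D g ->
  (\forall x \ae mu, f x = g x) -> cintegral mu D f = cintegral mu D g.
Proof.
move=> mD [fr fi] [gr gi] fg; congr Complex; congr fine; apply: ae_eq_integral => //;
  try exact/measurable_EFinP; by apply: filterS fg => x /= -> .
Qed.

Lemma cintegralD D f g : measurable D -> cintegrable D f -> cintegrable D g ->
  cintegral mu D (fun x => f x + g x) = cintegral mu D f + cintegral mu D g.
Proof.
move=> mD [fr fi] [gr gi]; rewrite /cintegral.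
rewrite -[RHS]/((_ + _) +i* (_ + _))%C; congr Complex.
  by rewrite -RintegralD //; apply: eq_Rintegral => x _; rewrite cReD.
by rewrite -RintegralD //; apply: eq_Rintegral => x _; rewrite cImD.
Qed.

Lemma cintegralZ D c f : measurable D -> cintegrable D f ->
  cintegral mu D (fun x => c * f x) = c * cintegral mu D f.
Proof.
case: c => a b mD [fr fi]; rewrite /cintegral.
have iZ (k : R) (g : T -> R) : mu.-integrable D (fun x => (g x)%:E) ->
    mu.-integrable D (EFin \o (fun x => k * g x)).
  move=> ig; rewrite (_ : _ \o _ = (fun x => k%:E * (g x)%:E)%E); last first.
    by apply/funext => x /=; rewrite EFinM.
  exact: integrableZl.
rewrite -[RHS]/((_ - _) +i* (_ + _))%C; congr Complex.
  rewrite -!RintegralZl // -RintegralB; [|by []|exact: iZ|exact: iZ].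
  by apply: eq_Rintegral => x _; rewrite cReM.
rewrite -!RintegralZl // -RintegralD; [|by []|exact: iZ|exact: iZ].
by apply: eq_Rintegral => x _; rewrite cImM.
Qed.

Lemma cintegralJ D f : measurable D -> cintegrable D f ->
  cintegral mu D (fun x => (f x)^*%C) = (cintegral mu D f)^*%C.
Proof.
move=> mD [fr fi]; congr Complex.
  by apply: eq_Rintegral => x _; rewrite cReJ.
rewrite -[RHS]mulN1r -RintegralZl //; apply: eq_Rintegral => x _.
by rewrite cImJ mulN1r.
Qed.

Lemma cintegral_setI_indic D A f :
  cintegral mu D (fun x => f x * cindic A x) = cintegral mu (D `&` A) f.
Proof.
congr Complex; rewrite Rintegral_mkcondr; apply: eq_Rintegral => x _.
  by rewrite cReM /= mulr0 subr0 /patch; case: ifP; rewrite ?mulr1 ?mulr0.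
by rewrite cImM /= mulr0 add0r /patch; case: ifP; rewrite ?mulr1 ?mulr0.
Qed.

Lemma bounded_cintegrable D f M : measurable D -> (mu D < +oo)%E -> cmeasurable D f ->
  (forall x, normsq (f x) <= M) -> cintegrable D f.
Proof.
move=> mD muD [fr fi] fM.
have bnd (h : T -> R) : measurable_fun D h -> (forall x, h x ^+ 2 <= normsq (f x)) ->
    mu.-integrable D (EFin \o h).
  move=> mh hf; apply: measurable_bounded_integrable => //.
  (* The bound comes from $|h|\le 1+h^2\le 1+M$, which spares a square root. *)
  exists (1 + M); split; first exact: num_real.
  move=> r rM x _ /=; apply: le_trans (ltW rM).
  have := le_trans (hf x) (fM x); rewrite -real_normK ?num_real // => h2.
  have := sqr_ge0 (`|h x| - 1); rewrite sqrrB1 mulr2n; have := sqr_ge0 `|h x|; lra.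
split; apply: bnd => // x; rewrite /normsq ?lerDl ?lerDr sqr_ge0 //.
Qed.

End complex_integral.

(** * Norm and inner product on L^2 *)

Section L2_structure.
Context d (T : measurableType d) (R : realType).
Variable mu : {measure set T -> \bar R}.
Implicit Types (f g : T -> R[i]) (u v w : L2 mu).

Definition nsq f : \bar R := (\int[mu]_x (normsq (f x))%:E)%E.

Lemma sqintP f : square_integrable mu f <-> cmeasurable setT f /\ (nsq f < +oo)%E.
Proof. by split=> [[]|[[]]]. Qed.

Lemma nsq_ge0 f : (0 <= nsq f)%E.
Proof. by apply: integral_ge0 => x _; rewrite lee_fin normsq_ge0. Qed.

Lemma nsq_fin_num f : square_integrable mu f -> nsq f \is a fin_num.
Proof. by move=> /sqintP[_ foo]; rewrite ge0_fin_numE // nsq_ge0. Qed.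

Lemma sqint_integrable f : square_integrable mu f ->
  mu.-integrable setT (fun x => (normsq (f x))%:E).
Proof.
move=> /sqintP[mf foo]; apply/integrableP; split; first exact: cmeasurable_normsq.
by under eq_integral do rewrite /= ger0_norm ?normsq_ge0 //.
Qed.

Lemma ae_eq_nsq f g : cmeasurable setT f -> cmeasurable setT g ->
  (\forall x \ae mu, f x = g x) -> nsq f = nsq g.
Proof.
move=> mf mg fg; apply: ge0_ae_eq_integral => //; try exact: cmeasurable_normsq.
- by move=> x _; rewrite lee_fin normsq_ge0.
- by move=> x _; rewrite lee_fin normsq_ge0.
- by apply: filterS fg => x /= ->.
Qed.

Lemma nsqD t f g : 0 < t -> cmeasurable setT f -> cmeasurable setT g ->
  (nsq (fun x => f x + g x)%R <= (1 + t)%:E * nsq f + (1 + t^-1)%:E * nsq g)%E.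
Proof.
move=> t0 mf mg.
have t1 : 0 <= 1 + t by rewrite addr_ge0 // ltW.
have t2 : 0 <= 1 + t^-1 by rewrite addr_ge0 // invr_ge0 ltW.
have n0 (h : T -> R[i]) x : setT x -> (0 <= (normsq (h x))%:E)%E.
  by move=> _; rewrite lee_fin normsq_ge0.
rewrite /nsq -!ge0_integralZl_EFin //; try by [exact: n0|exact: cmeasurable_normsq].
rewrite -ge0_integralD //; first last.
- by apply: measurable_funeM; exact: cmeasurable_normsq.
- by move=> x _; rewrite mule_ge0 ?lee_fin ?normsq_ge0.
- by apply: measurable_funeM; exact: cmeasurable_normsq.
- by move=> x _; rewrite mule_ge0 ?lee_fin ?normsq_ge0.
apply: ge0_le_integral => //.
- by move=> x _; rewrite lee_fin normsq_ge0.
- by apply: cmeasurable_normsq; exact: cmeasurableD.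
- by apply: emeasurable_funD; apply: measurable_funeM; exact: cmeasurable_normsq.
- by move=> x _; rewrite -!EFinM -EFinD lee_fin normsqD.
Qed.

Lemma nsqZ c f : cmeasurable setT f -> nsq (fun x => c * f x) = ((normsq c)%:E * nsq f)%E.
Proof.
move=> mf; rewrite /nsq -ge0_integralZl_EFin ?normsq_ge0 //; last 2 first.
- by move=> x _; rewrite lee_fin normsq_ge0.
- exact: cmeasurable_normsq.
by apply: eq_integral => x _; rewrite normsqM EFinM.
Qed.

Lemma sqintD f g : square_integrable mu f -> square_integrable mu g ->
  square_integrable mu (fun x => f x + g x).
Proof.
move=> fi gi; have [mf _] := (sqintP f).1 fi; have [mg _] := (sqintP g).1 gi.
apply/sqintP; split; first exact: cmeasurableD.
apply: (le_lt_trans (nsqD ltr01 mf mg)).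
by rewrite -(fineK (nsq_fin_num fi)) -(fineK (nsq_fin_num gi)) -!EFinM -EFinD ltry.
Qed.

Lemma sqintZ c f : square_integrable mu f -> square_integrable mu (fun x => c * f x).
Proof.
move=> fi; have [mf _] := (sqintP f).1 fi.
apply/sqintP; split; first by apply: cmeasurableM => //; exact: cmeasurable_cst.
by rewrite nsqZ // -(fineK (nsq_fin_num fi)) -EFinM ltry.
Qed.

Lemma sqintB f g : square_integrable mu f -> square_integrable mu g ->
  square_integrable mu (fun x => f x - g x).
Proof.
move=> fi gi; have := sqintD fi (sqintZ (-1) gi).
by congr square_integrable; apply/funext => x; rewrite mulN1r.
Qed.

(** Real and imaginary parts of the product are dominated by $|f|^2+|g|^2$. *)
Lemma cintegrable_mulJ f g : square_integrable mu f -> square_integrable mu g ->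
  cintegrable mu setT (fun x => f x * (g x)^*%C).
Proof.
move=> fi gi; have [mf _] := (sqintP f).1 fi; have [mg _] := (sqintP g).1 gi.
have [mr mi] := cmeasurableM mf (cmeasurableJ mg).
have fgi := integrableD measurableT (sqint_integrable fi) (sqint_integrable gi).
have bound (a b c e : R) : `|a * b + c * e| <= a ^+ 2 + c ^+ 2 + (b ^+ 2 + e ^+ 2).
  have h1 := sqr_ge0 (a + b); have h2 := sqr_ge0 (a - b).
  have h3 := sqr_ge0 (c + e); have h4 := sqr_ge0 (c - e).
  have h5 := sqr_ge0 a; have h6 := sqr_ge0 b; have h7 := sqr_ge0 c; have h8 := sqr_ge0 e.
  by rewrite ler_norml; apply/andP; split; nra.
split; apply: le_integrable fgi => //; try exact/measurable_EFinP.
- move=> x _; rewrite -EFinD !abse_EFin lee_fin [leRHS]ger0_norm;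
    last by apply: addr_ge0; exact: normsq_ge0.
  rewrite cReM cReJ cImJ mulrN opprK; exact: bound.
- move=> x _; rewrite -EFinD !abse_EFin lee_fin [leRHS]ger0_norm;
    last by apply: addr_ge0; exact: normsq_ge0.
  rewrite cImM cReJ cImJ mulrN addrC -mulNr.
  have := bound (complex.Im (f x)) (complex.Re (g x)) (- complex.Re (f x)) (complex.Im (g x)).
  by rewrite sqrrN /normsq; lra.
Qed.

Lemma cintegral_mulJ_self f : square_integrable mu f ->
  cintegral mu setT (fun x => f x * (f x)^*%C) = (fine (nsq f))%:C%C.
Proof.
move=> fi; congr Complex.
  by apply: eq_Rintegral => x _; rewrite mulcJ.
by rewrite /Rintegral integral0_eq // => x _; rewrite mulcJ.
Qed.

Lemma L2_sqint u : square_integrable mu u.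
Proof. exact/asboolP/(l2fun_valP (repr u)). Qed.

Lemma L2_cmeasurable u : cmeasurable setT u.
Proof. by have [] := (sqintP u).1 (L2_sqint u). Qed.

Hint Resolve L2_sqint L2_cmeasurable : core.

Lemma toL2_ae f : square_integrable mu f -> \forall x \ae mu, toL2 mu f x = f x.
Proof.
move=> fi; have fl : f \in l2 mu by exact/asboolP.
have := repr_L2 (insubd (0 : l2fun mu) f); apply: filterS => x ->.
by have -> : l2fun_val (insubd (0 : l2fun mu) f) = f by exact: insubdK.
Qed.

Lemma L2_eq u v : (\forall x \ae mu, u x = v x) -> u = v.
Proof. by move=> uv; rewrite -[u]reprK -[v]reprK; apply/L2P. Qed.

Lemma toL2_eq f g : square_integrable mu f -> square_integrable mu g ->
  (\forall x \ae mu, f x = g x) -> toL2 mu f = toL2 mu g.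
Proof.
move=> fi gi fg; apply: L2_eq; apply: filterS3 (toL2_ae fi) (toL2_ae gi) fg => x.
by move=> -> -> .
Qed.

Lemma toL2K u : toL2 mu u = u.
Proof. by apply: L2_eq; exact: toL2_ae. Qed.

Lemma L2D_ae u v : \forall x \ae mu, (u + v : L2 mu) x = u x + v x.
Proof.
have := repr_L2 (repr u + repr v); apply: filterS => x.
by rewrite L2_piD !reprK.
Qed.

Lemma L2Z_ae c u : \forall x \ae mu, (c *: u : L2 mu) x = c * u x.
Proof. exact: (repr_L2 (l2fun_scale c (repr u))). Qed.

Lemma L2B_ae u v : \forall x \ae mu, (u - v : L2 mu) x = u x - v x.
Proof.
rewrite -scaleN1r; apply: filterS2 (L2D_ae u (-1 *: v)) (L2Z_ae (-1) v) => x -> ->.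
by rewrite mulN1r.
Qed.

Lemma toL2D f g : square_integrable mu f -> square_integrable mu g ->
  toL2 mu (fun x => f x + g x) = toL2 mu f + toL2 mu g.
Proof.
move=> fi gi; apply: L2_eq.
apply: filterS2 (filterI (toL2_ae fi) (toL2_ae gi))
  (filterI (toL2_ae (sqintD fi gi)) (L2D_ae (toL2 mu f) (toL2 mu g))).
by move=> x [fx gx] [-> ->]; rewrite fx gx.
Qed.

Lemma toL2Z c f : square_integrable mu f ->
  toL2 mu (fun x => c * f x) = c *: toL2 mu f.
Proof.
move=> fi; apply: L2_eq.
apply: filterS3 (toL2_ae fi) (toL2_ae (sqintZ c fi)) (L2Z_ae c (toL2 mu f)).
by move=> x fx -> ->; rewrite fx.
Qed.

Lemma sqint0 : square_integrable mu (fun=> 0 : R[i]).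
Proof.
apply/sqintP; split; first exact: cmeasurable_cst.
by rewrite /nsq /normsq /= expr0n addr0 integral0.
Qed.

Lemma toL2_0 : toL2 mu (fun=> 0) = 0.
Proof.
rewrite -[RHS](scale0r (toL2 mu (fun=> 0))) -(toL2Z 0 sqint0).
by congr (toL2 mu _); apply/funext => x; rewrite mul0r.
Qed.

(** The squared norm as a real number. Estimates are made on squares, where they stay polynomial;
    [L2limP] translates them to [L2norm]. *)
Definition Nsq u : R := fine (nsq u).

Lemma NsqE u : (Nsq u)%:E = nsq u.
Proof. by rewrite fineK // nsq_fin_num. Qed.

Lemma Nsq_ge0 u : 0 <= Nsq u.
Proof. by rewrite fine_ge0 // nsq_ge0. Qed.

Lemma nsq_toL2 f : square_integrable mu f -> nsq (toL2 mu f) = nsq f.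
Proof.
by move=> fi; apply: ae_eq_nsq => //; [case: ((sqintP f).1 fi)|exact: toL2_ae].
Qed.

Lemma NsqD t u v : 0 < t -> Nsq (u + v) <= (1 + t) * Nsq u + (1 + t^-1) * Nsq v.
Proof.
move=> t0; rewrite -lee_fin EFinD !EFinM !NsqE.
rewrite (ae_eq_nsq _ _ (L2D_ae u v)) //; last exact: cmeasurableD.
exact: nsqD.
Qed.

Lemma NsqZ c u : Nsq (c *: u) = normsq c * Nsq u.
Proof.
apply: EFin_inj; rewrite EFinM !NsqE (ae_eq_nsq _ _ (L2Z_ae c u)) ?nsqZ //.
by apply: cmeasurableM => //; exact: cmeasurable_cst.
Qed.

Lemma Nsq0 : Nsq 0 = 0.
Proof. by rewrite -(scale0r (0 : L2 mu)) NsqZ /normsq /= expr0n addr0 mul0r. Qed.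

Lemma NsqN u : Nsq (- u) = Nsq u.
Proof. by rewrite -scaleN1r NsqZ /normsq /= oppr0 expr0n addr0 sqrrN expr1n mul1r. Qed.

Lemma NsqD2 u v : Nsq (u + v) <= 2 * Nsq u + 2 * Nsq v.
Proof. by have := NsqD u v ltr01; rewrite invr1. Qed.

Lemma NsqB2 u v : Nsq (u - v) <= 2 * Nsq u + 2 * Nsq v.
Proof. by rewrite -[Nsq v]NsqN; exact: NsqD2. Qed.

Lemma Nsq_eq0 u : Nsq u = 0 -> u = 0.
Proof.
move=> u0; rewrite -[0](scale0r u); apply: L2_eq.
have : ae_eq mu setT (fun x => (normsq (u x))%:E) (cst 0%E).
  apply/ae_eq_integral_abs => //; first exact: cmeasurable_normsq.
  under eq_integral do rewrite /= ger0_norm ?normsq_ge0 //.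
  by have := NsqE u; rewrite u0.
apply: filterS2 (L2Z_ae 0 u) => x ->; rewrite mul0r => /(_ I) /= [] .
exact: normsq_eq0.
Qed.

(** [L2dot] is defined on chosen representatives; this frees computations from that choice. *)
Lemma L2dotE f g u v : square_integrable mu f -> square_integrable mu g ->
  (\forall x \ae mu, u x = f x) -> (\forall x \ae mu, v x = g x) ->
  L2dot u v = cintegral mu setT (fun x => f x * (g x)^*%C).
Proof.
move=> /sqintP[mf _] /sqintP[mg _] uf vg; apply: ae_eq_cintegral => //.
- by apply: cmeasurableM => //; exact: cmeasurableJ.
- by apply: cmeasurableM => //; exact: cmeasurableJ.
- by apply: filterS2 uf vg => x -> ->.
Qed.

Lemma L2dotDl u v w : L2dot (u + v) w = L2dot u w + L2dot v w.
Proof.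
rewrite (@L2dotE (fun x => u x + v x) w) //; [|exact: sqintD|exact: L2D_ae|exact: aeW].
rewrite -cintegralD //; try exact: cintegrable_mulJ.
by apply: eq_cintegral => x _; rewrite mulrDl.
Qed.

Lemma L2dotZl c u w : L2dot (c *: u) w = c * L2dot u w.
Proof.
rewrite (@L2dotE (fun x => c * u x) w) //; [|exact: sqintZ|exact: L2Z_ae|exact: aeW].
rewrite -cintegralZ //; last exact: cintegrable_mulJ.
by apply: eq_cintegral => x _; rewrite mulrA.
Qed.

Lemma L2dotC u v : L2dot u v = (L2dot v u)^*%C.
Proof.
rewrite /L2dot -cintegralJ //; last exact: cintegrable_mulJ.
by apply: eq_cintegral => x _; rewrite rmorphM /= conjcK mulrC.
Qed.

Lemma L2dotDr u v w : L2dot w (u + v) = L2dot w u + L2dot w v.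
Proof. by rewrite L2dotC L2dotDl rmorphD (L2dotC w u) (L2dotC w v). Qed.

Lemma L2dotZr c u w : L2dot w (c *: u) = c^*%C * L2dot w u.
Proof. by rewrite L2dotC L2dotZl rmorphM (L2dotC w u). Qed.

Lemma L2dot_self u : L2dot u u = (Nsq u)%:C%C.
Proof. exact: cintegral_mulJ_self. Qed.

Lemma L2dot0l u : L2dot 0 u = 0 :> R[i].
Proof. by rewrite -(scale0r (0 : L2 mu)) L2dotZl mul0r. Qed.

Lemma L2dot0r u : L2dot u 0 = 0 :> R[i].
Proof. by rewrite -(scale0r (0 : L2 mu)) L2dotZr conjc0 mul0r. Qed.

(** Expand the squared norm of $\|v\|^2u-\langle u,v\rangle v$, which involves no division. A factor
    $\|v\|^2$ is cancelled at the end, whence the separate case $\|v\|=0$. *)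
Lemma L2_cauchy_schwarz u v : normsq (L2dot u v) <= Nsq u * Nsq v.
Proof.
have [v0|v0] := eqVneq (Nsq v) 0.
  rewrite (Nsq_eq0 v0) -(scale0r (0 : L2 mu)) L2dotZr conjc0 mul0r.
  by rewrite /normsq /= expr0n addr0 mulr_ge0 // Nsq_ge0.
have {}v0 : 0 < Nsq v by rewrite lt_def v0 Nsq_ge0.
pose c := L2dot u v; pose a : R[i] := (Nsq v)%:C%C.
have := Nsq_ge0 (a *: u + (- c) *: v).
suff -> : Nsq (a *: u + (- c) *: v) = Nsq v * (Nsq u * Nsq v - normsq c).
  by rewrite pmulr_rge0 // subr_ge0.
apply: (@complexI R); rewrite -L2dot_self L2dotDl !L2dotDr !L2dotZl !L2dotZr.
rewrite !L2dot_self (L2dotC v u) -/c -/a.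
have -> : (- c)^*%C = - c^*%C by exact: rmorphN.
have -> : a^*%C = a by exact: conjc_real.
have -> : (Nsq v * (Nsq u * Nsq v - normsq c))%:C%C = a * ((Nsq u)%:C%C * a - c * c^*%C).
  by rewrite mulcJ -!rmorphM -rmorphB -rmorphM.
move: ((Nsq u)%:C%C) a c (c^*%C) => x y z z'.
by ring.
Qed.

(** The norm of a sum determines the real part of the inner product, and the imaginary part of
    $\langle f,g\rangle$ is the real part of $\langle f,ig\rangle$. *)
Lemma L2dot_polarization (U : L2 mu -> L2 mu) :
  (forall u v, U (u + v) = U u + U v) -> (forall c u, U (c *: u) = c *: U u) ->
  (forall u, Nsq (U u) = Nsq u) -> forall u v, L2dot (U u) (U v) = L2dot u v.
Proof.
move=> UD UZ UN u v.
have re (f g : L2 mu) : Nsq (f + g) = Nsq f + Nsq g + 2 * complex.Re (L2dot f g).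
  apply: (@complexI R); rewrite -L2dot_self L2dotDl !L2dotDr !L2dot_self (L2dotC g f).
  rewrite !rmorphD; case: (L2dot f g) => a b; apply/eqP; rewrite eq_complex /=.
  by apply/andP; split; apply/eqP; ring.
have reU (f g : L2 mu) : complex.Re (L2dot (U f) (U g)) = complex.Re (L2dot f g).
  by have := UN (f + g); rewrite UD !re !UN; lra.
have im (f g : L2 mu) : complex.Im (L2dot f g) = complex.Re (L2dot f ('i%C *: g)).
  by rewrite L2dotZr; case: (L2dot f g) => a b /=; ring.
apply/eqP; rewrite eq_complex; apply/andP; split; apply/eqP; first exact: reU.
by rewrite !im -UZ; exact: reU.
Qed.

Lemma L2normE u : L2norm u = Num.sqrt (Nsq u).
Proof. by rewrite /L2norm L2dot_self. Qed.

Lemma L2limP (f : nat -> T -> R[i]) u : L2lim f u <->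
  (forall n, square_integrable mu (f n)) /\
  (forall e, 0 < e -> exists n0, forall n, (n0 <= n)%N -> Nsq (toL2 mu (f n) - u) < e).
Proof.
split=> -[fi fu]; split => //.
  move=> e e0; have se0 : 0 < Num.sqrt e by rewrite sqrtr_gt0.
  have /cvgr0Pnorm_lt/(_ _ se0)[n0 _ n0P] := fu; exists n0 => n /n0P /=.
  by rewrite L2normE ger0_norm ?sqrtr_ge0 // ltr_sqrt.
apply/cvgr0Pnorm_lt => e e0.
have [|n0 n0P] := fu (e ^+ 2); first by rewrite exprn_gt0.
exists n0 => // n /= /n0P; rewrite L2normE ger0_norm ?sqrtr_ge0 //.
by move=> h; rewrite -(gtr0_norm e0) -sqrtr_sqr ltr_sqrt ?exprn_gt0.
Qed.

Lemma L2lim_unique (f : nat -> T -> R[i]) u v : L2lim f u -> L2lim f v -> u = v.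
Proof.
move=> /L2limP[fi fu] /L2limP[_ fv]; apply/eqP; rewrite -subr_eq0; apply/eqP/Nsq_eq0.
apply/eqP; rewrite eq_le Nsq_ge0 andbT; apply/ler_addgt0Pl => e e0; rewrite addr0.
have e4 : 0 < e / 4 by rewrite divr_gt0.
have [m mP] := fu _ e4; have [n nP] := fv _ e4.
have := mP (maxn m n) (leq_maxl m n); have := nP (maxn m n) (leq_maxr m n).
set w := toL2 mu _; have -> : u - v = (w - v) - (w - u) by rewrite opprB [RHS]addrC subrKA.
have := NsqB2 (w - v) (w - u); lra.
Qed.

End L2_structure.

#[global] Hint Resolve L2_sqint L2_cmeasurable : core.

Lemma cvg_geometric_steps (R : realType) (a : R^nat) (C : R) :
  (forall k, `|a k.+1 - a k| <= C / (2 ^ k)%:R) -> cvgn a.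
Proof.
move=> aC; have C0 : 0 <= C.
  by have := aC 0%N; rewrite expn0 divr1; apply: le_trans.
have /normed_cvg ca : cvgn [normed series (telescope a)].
  apply: (@series_le_cvg _ _ (geometric C (2^-1))) => //.
  - by move=> n; exact: normr_ge0.
  - by move=> n; apply: geometric_ge0 => //; rewrite invr_ge0.
  - by move=> n; rewrite /= exprVn -natrX; exact: aC.
  - by apply: is_cvg_geometric_series; rewrite ger0_norm ?invr_ge0 // invf_lt1 ?ltr1n.
have -> : a = (fun n => a 0%N + series (telescope a) n).
  by apply/funext => n; rewrite -eq_sum_telescope.
by apply: is_cvgD => //; exact: is_cvg_cst.
Qed.

(** * Completeness of L^2 *)

Section L2_completeness.
Context d (T : measurableType d) (R : realType).
Variable mu : {measure set T -> \bar R}.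
Implicit Types (f g : T -> R[i]) (u v w : L2 mu).

(** Fatou's lemma lets a bound on squared norms survive almost everywhere convergence without a
    dominating function. It serves both completeness and the extension of the contraction property
    beyond the span of balls. *)
Lemma nsq_fatou (f : nat -> T -> R[i]) g (M : R) :
  (forall n, cmeasurable setT (f n)) -> cmeasurable setT g ->
  (\forall x \ae mu, (complex.Re (f n x) @[n --> \oo] --> complex.Re (g x)) /\
    (complex.Im (f n x) @[n --> \oo] --> complex.Im (g x))) ->
  (forall n, (nsq mu (f n) <= M%:E)%E) -> (nsq mu g <= M%:E)%E.
Proof.
move=> mf mg fg fM.
pose h n x : \bar R := (normsq (f n x))%:E.
have h0 n x : (0 <= h n x)%E by rewrite lee_fin normsq_ge0.
have mh n : measurable_fun setT (h n) by exact: cmeasurable_normsq.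
have e0 (x : T) n : (0 <= einfs (h ^~ x) n)%E.
  by apply: le_ereal_inf_tmp => _ [m /= _ <-]; exact: h0.
have -> : nsq mu g = (\int[mu]_x limn_einf (h ^~ x))%E.
  apply: ge0_ae_eq_integral => //; first exact: cmeasurable_normsq.
  - apply: (emeasurable_fun_cvg (fun n x => einfs (h ^~ x) n)).
      by move=> n; exact: measurable_fun_einfs.
    by move=> x _; rewrite limn_einf_lim; exact: is_cvg_einfs.
  - by move=> x _; rewrite lee_fin normsq_ge0.
  - move=> x _; rewrite limn_einf_lim; apply: lime_ge; first exact: is_cvg_einfs.
    exact: nearW.
  - apply: filterS fg => x [cr ci] _; symmetry.
    have cvh : h n x @[n --> \oo] --> (normsq (g x))%:E.
      apply: cvg_EFin; first exact: nearW.
      by apply: cvgD; rewrite ?expr2; apply: cvgM.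
    by rewrite is_cvg_limn_einfE; [exact/cvg_lim|apply/cvg_ex; eexists; exact: cvh].
apply: (le_trans (fatou mu measurableT mh _)); first by move=> n x _; exact: h0.
rewrite limn_einf_lim; apply: lime_le; first exact: is_cvg_einfs.
apply: nearW => n; apply: le_trans (fM n).
by apply: ereal_inf_lbound; exists n => //=.
Qed.

(** The factor $4^k$ pays for the weights that force pointwise steps of order $2^{-k}$; the factor
    $2^{k+1}$ makes the integrals of the weighted squared steps sum to at most 1. *)
Let eps k : R := ((4 ^ k)%:R * (2 ^ k.+1)%:R)^-1.

(** The Riesz-Fischer argument: along a fast subsequence the weighted sum [S] of squared steps is
    integrable, hence finite almost everywhere; there the k-th step is at most $\sqrt{S}/2^k$ and
    the subsequence converges. *)
Lemma L2_complete (s : nat -> L2 mu) :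
  (forall e, 0 < e -> exists n0, forall m n, (n0 <= m)%N -> (n0 <= n)%N ->
    Nsq (s m - s n) < e) ->
  exists u, forall e, 0 < e -> exists n0, forall n, (n0 <= n)%N -> Nsq (s n - u) < e.
Proof.
move=> cs; have eps0 k : 0 < eps k by rewrite invr_gt0 mulr_gt0 ?ltr0n ?expn_gt0.
have /all_sig[phi phiP] k : {n0 | forall m n, (n0 <= m)%N -> (n0 <= n)%N ->
    Nsq (s m - s n) < eps k} by apply: cid; exact: cs.
(* Summing the thresholds makes the indices of the subsequence nondecreasing while keeping them
   above [phi k]. *)
pose ph k := (\sum_(i < k.+1) phi i)%N.
have phi_ph k : (phi k <= ph k)%N by rewrite /ph big_ord_recr leq_addl.
have phS k : (ph k <= ph k.+1)%N by rewrite /ph [leqRHS]big_ord_recr leq_addr.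
pose w k := s (ph k).
have mw k : cmeasurable setT (w k) by exact: L2_cmeasurable.
pose D k x := normsq (w k.+1 x - w k x).
have D0 k x : 0 <= D k x by exact: normsq_ge0.
have mD k : measurable_fun setT (fun x => ((4 ^ k)%:R * D k x)%:E).
  under eq_fun do rewrite EFinM.
  apply: measurable_funeM; apply: cmeasurable_normsq; exact: cmeasurableB.
have D4 k x : (0 <= ((4 ^ k)%:R * D k x)%:E)%E by rewrite lee_fin mulr_ge0.
have intD k : (\int[mu]_x ((4 ^ k)%:R * D k x)%:E <= (1 / (2 ^ (k + 0).+1)%:R)%:E)%E.
  under eq_integral do rewrite EFinM.
  rewrite ge0_integralZl_EFin //; last first.
  - by apply: cmeasurable_normsq; exact: cmeasurableB.
  - by move=> x _; rewrite lee_fin.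
  have -> : (\int[mu]_x (D k x)%:E = (Nsq (w k.+1 - w k))%:E)%E.
    rewrite NsqE; apply: ae_eq_nsq; [exact: cmeasurableB|exact: L2_cmeasurable|].
    by apply: filterS (L2B_ae (w k.+1) (w k)) => x ->.
  rewrite -EFinM lee_fin addn0 div1r.
  have : Nsq (w k.+1 - w k) <= eps k.
    by apply/ltW/phiP => //; exact: leq_trans (phi_ph k) (phS k).
  by rewrite /eps invfM mulrC ler_pdivlMr ?ltr0n ?expn_gt0 // mulrC.
pose S x : \bar R := (\sum_(k <oo) ((4 ^ k)%:R * D k x)%:E)%E.
have Soo : (\int[mu]_x S x < +oo)%E.
  rewrite integral_nneseries //.
  apply: (@le_lt_trans _ _ (\sum_(k <oo) (1 / (2 ^ (k + 0).+1)%:R)%:E)%E).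
    by apply: lee_nneseries => [i _ _|i _]; [apply: integral_ge0|exact: intD].
  have := @cvg_geometric_eseries_half R 1 0.
  under eq_fun do rewrite addnS.
  by move/cvg_lim => -> //; exact: ltry.
have mS : measurable_fun setT S.
  exact: (@ge0_emeasurable_sum _ _ _ _ (fun k x => ((4 ^ k)%:R * D k x)%:E) xpredT).
have S0 x : (0 <= S x)%E by exact: nneseries_ge0.
have Sfin : \forall x \ae mu, S x \is a fin_num.
  have : mu.-integrable setT S.
    apply/integrableP; split => //.
    by under eq_integral do rewrite gee0_abs //.
  by move/(integrable_ae measurableT); apply: filterS => x; exact.
(* Upper limits give a function measurable on all of [T], including the null set where the
   subsequence may diverge. *)
pose g x : R[i] := (fine (limn_esup (fun k => (complex.Re (w k x))%:E)) +i*
  fine (limn_esup (fun k => (complex.Im (w k x))%:E)))%C.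
have mg : cmeasurable setT g.
  split; apply: measurableT_comp => //; apply: measurable_fun_limn_esup => k;
    by apply/measurable_EFinP; case: (mw k).
have wg : \forall x \ae mu, (complex.Re (w n x) @[n --> \oo] --> complex.Re (g x)) /\
    (complex.Im (w n x) @[n --> \oo] --> complex.Im (g x)).
  apply: filterS Sfin => x Sx.
  have aux (a : nat -> R) : (forall k, (a k.+1 - a k) ^+ 2 <= D k x) ->
      a n @[n --> \oo] --> fine (limn_esup (fun k => (a k)%:E)).
    move=> aD; have ca : cvgn a.
      apply: (@cvg_geometric_steps _ _ (Num.sqrt (fine (S x)))) => k.
      rewrite -sqrtr_sqr -[X in _ / X]ger0_norm // -[X in _ / X]sqrtr_sqr -sqrtrV ?sqr_ge0 //.
      rewrite -sqrtrM ?fine_ge0 // ler_wsqrtr // (le_trans (aD k)) //.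
      rewrite ler_pdivlMr ?exprn_gt0 ?ltr0n ?expn_gt0 //.
      rewrite -lee_fin fineK // mulrC -natrX -expnM mulnC expnM.
      have := @nneseries_lim_ge R _ xpredT 0 k.+1 (fun n _ _ => D4 n x).
      apply: le_trans; rewrite big_nat_recr //= leeDr // sume_ge0 // => i _; exact: D4.
    have /cvg_ex[l al] := ca.
    have aE : (a n)%:E @[n --> \oo] --> l%:E by apply: cvg_EFin => //; exact: nearW.
    by have [_ ->] := cvg_limn_einf_sup aE.
  split; apply: aux => k; rewrite /D /normsq -?cReB -?cImB ?lerDl ?lerDr sqr_ge0 //.
(* Fatou along the shifted subsequence controls every late term of the whole sequence, not only of
   the subsequence. *)
have close k n : (phi k <= n)%N -> (nsq mu (fun x => s n x - g x)%R <= (eps k)%:E)%E.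
  move=> kn; apply: (@nsq_fatou (fun j x => s n x - w (k + j)%N x)).
  - by move=> j; apply: cmeasurableB; exact: L2_cmeasurable.
  - by apply: cmeasurableB => //; exact: L2_cmeasurable.
  - apply: filterS wg => x [gr gi]; split.
      under eq_fun do rewrite cReB; rewrite cReB; apply: cvgB; first exact: cvg_cst.
      by rewrite -(cvg_shiftn k) in gr; under eq_fun do rewrite addnC; exact: gr.
    under eq_fun do rewrite cImB; rewrite cImB; apply: cvgB; first exact: cvg_cst.
    by rewrite -(cvg_shiftn k) in gi; under eq_fun do rewrite addnC; exact: gi.
  - move=> j; have -> : nsq mu (fun x => s n x - w (k + j)%N x) = (Nsq (s n - w (k + j)%N))%:E.
      rewrite NsqE; apply: ae_eq_nsq;
        [by apply: cmeasurableB; exact: L2_cmeasurable|exact: L2_cmeasurable|].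
      by apply: filterS (L2B_ae (s n) (w (k + j)%N)) => x ->.
    rewrite lee_fin; apply/ltW/phiP => //.
    apply: leq_trans (phi_ph k) _; elim: j => [|j IH]; first by rewrite addn0.
    by rewrite addnS (leq_trans IH).
have gi : square_integrable mu g.
  have h : square_integrable mu (fun x => s (phi 0%N) x - g x).
    apply/sqintP; split; first by apply: cmeasurableB => //; exact: L2_cmeasurable.
    exact: le_lt_trans (close 0%N _ (leqnn _)) (ltry _).
  have := sqintB (L2_sqint (s (phi 0%N))) h.
  by congr square_integrable; apply/funext => x; rewrite subKr.
exists (toL2 mu g) => e e0.
have [k ke] : exists k, eps k < e.
  have [k _ /(_ k (leqnn k)) /= ke] := near_infty_natSinv_lt (PosNum e0).
  exists k; apply: le_lt_trans ke; rewrite lef_pV2 ?posrE ?mulr_gt0 ?ltr0n ?expn_gt0 //.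
  rewrite -natrM ler_nat; apply: (leq_trans (ltnW (ltn_expl k.+1 (ltnSn 1)))).
  by rewrite leq_pmull // expn_gt0.
exists (phi k) => n kn; apply: le_lt_trans ke; rewrite -lee_fin NsqE.
apply: le_trans (close _ _ kn); rewrite le_eqVlt; apply/orP; left; apply/eqP.
apply: ae_eq_nsq; [exact: L2_cmeasurable|by apply: cmeasurableB => //; exact: L2_cmeasurable|].
by apply: filterS2 (toL2_ae gi) (L2B_ae (s n) (toL2 mu g)) => x gx ->; rewrite gx.
Qed.

End L2_completeness.

(** * Invariance of Haar measure and transforms of balls *)

Lemma adele_continuous_measurable (phi : finite_adele -> finite_adele) :
  (forall U : set finite_adele, open U -> open (phi @^-1` U)) -> measurable_fun setT phi.
Proof.
move=> pc; apply: (measurability (@open finite_adele)) => //.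
by move=> _ [U Uo <-]; rewrite setTI; apply: adele_open_measurable; exact: pc.
Qed.

Lemma adele_shift_measurable (a : finite_adele) :
  measurable_fun setT (fun x : finite_adele => x + a).
Proof.
apply: adele_continuous_measurable => U /adele_openE Uo; apply/adele_openE => x Ux.
by have [k kU] := Uo _ Ux; exists k => z za; rewrite /preimage /= addrAC; exact: kU.
Qed.

Lemma adele_opp_measurable : measurable_fun setT (fun x : finite_adele => - x).
Proof.
apply: adele_continuous_measurable => U /adele_openE Uo; apply/adele_openE => x Ux.
have [k kU] := Uo _ Ux; exists k => z za; rewrite /preimage /= opprD.
by apply: kU; exact: frak_aN.
Qed.

(** * Change of variables under measure-preserving maps *)

Section measure_preserving.
Context d (T : measurableType d) (R : realType) (mu : {measure set T -> \bar R}).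
Variable phi : T -> T.
Hypothesis mphi : measurable_fun setT phi.
Hypothesis mu_phi : forall A, measurable A -> mu (phi @^-1` A) = mu A.

Lemma ge0_integral_preserving D (f : T -> \bar R) : measurable D ->
  measurable_fun D f -> (forall x, D x -> (0 <= f x)%E) ->
  (\int[mu]_(x in phi @^-1` D) f (phi x) = \int[mu]_(x in D) f x)%E.
Proof.
move=> mD mf f0; rewrite -[LHS](ge0_integral_pushforward mphi mu mD mf).
  by apply: eq_measure_integral => A mA _; exact: mu_phi.
by move=> x; rewrite inE; exact: f0.
Qed.

Lemma integral_preserving D (f : T -> \bar R) : measurable D ->
  measurable_fun D f ->
  (\int[mu]_(x in phi @^-1` D) f (phi x) = \int[mu]_(x in D) f x)%E.
Proof.
move=> mD mf; rewrite integralE [RHS]integralE; congr (_ - _)%E.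
  rewrite -[RHS]ge0_integral_preserving //; last exact: measurable_funepos.
  by apply: eq_integral => x _; rewrite -[RHS]/((f^\+ \o phi)%E x) -funepos_comp.
rewrite -[RHS]ge0_integral_preserving //; last exact: measurable_funeneg.
by apply: eq_integral => x _; rewrite -[RHS]/((f^\- \o phi)%E x) -funeneg_comp.
Qed.

Lemma cintegral_preserving D (f : T -> R[i]) : measurable D -> cmeasurable D f ->
  cintegral mu (phi @^-1` D) (fun x => f (phi x)) = cintegral mu D f.
Proof.
move=> mD [fr fi]; congr Complex; congr fine.
  by apply: (@integral_preserving D (fun x => (complex.Re (f x))%:E)) => //; exact/measurable_EFinP.
by apply: (@integral_preserving D (fun x => (complex.Im (f x))%:E)) => //; exact/measurable_EFinP.
Qed.

Lemma cmeasurable_comp (f : T -> R[i]) : cmeasurable setT f ->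
  cmeasurable setT (fun x => f (phi x)).
Proof.
by move=> [fr fi]; split; [exact: (measurableT_comp fr mphi)|exact: (measurableT_comp fi mphi)].
Qed.

Lemma nsq_preserving (f : T -> R[i]) : cmeasurable setT f ->
  nsq mu (fun x => f (phi x)) = nsq mu f.
Proof.
move=> mf; rewrite /nsq -[RHS]ge0_integral_preserving ?preimage_setT //.
  exact: cmeasurable_normsq.
by move=> x _; rewrite lee_fin normsq_ge0.
Qed.

Lemma sqint_preserving (f : T -> R[i]) : square_integrable mu f ->
  square_integrable mu (fun x => f (phi x)).
Proof.
move=> /sqintP[mf foo]; apply/sqintP; split; first exact: cmeasurable_comp.
by rewrite nsq_preserving.
Qed.

Lemma ae_preserving (P : T -> Prop) : (\forall x \ae mu, P x) -> \forall x \ae mu, P (phi x).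
Proof.
move=> [N [mN N0 PN]]; exists (phi @^-1` N); split.
- by rewrite -[_ @^-1` _]setTI; exact: mphi.
- by rewrite mu_phi.
- by move=> x /= nP; exact: PN.
Qed.

End measure_preserving.

Section add_char_products.
Variable R : realType.
Notation chi := (add_char R).
Implicit Types x y a b : finite_adele.

Lemma add_char_shift x a y : chi ((x + a) * y) = chi (a * y) * chi (x * y).
Proof. by rewrite mulrDl add_charD; exact: mulrC. Qed.

Lemma add_char_mulC x y : chi (x * y) = chi (y * x).
Proof. exact: (congr1 chi (mulrC x y)). Qed.

Lemma add_charDr x y a : chi (x * (y + a)) = chi (x * y) * chi (a * x).
Proof.
rewrite mulrDr add_charD.
exact: (congr1 (fun c => chi (x * y) * c) (add_char_mulC x a)).
Qed.

Lemma add_charBr x a b : chi (x * (a - b)) = chi (a * x) * (chi (b * x))^*%C.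
Proof.
rewrite mulrBr add_charD add_charN.
exact: (f_equal2 (fun c e => c * e^*%C) (add_char_mulC x a) (add_char_mulC x b)).
Qed.

End add_char_products.

(** * Reflection invariance, integrals of characters, Gram matrices of balls *)

Section haar_invariance.
Variables (R : realType) (mu : {measure set finite_adele -> \bar R}).
Hypothesis mu_haar : is_haar mu.
Hypothesis mu_Zhat : mu Zhat = 1%E.

Lemma haar_shift (a : finite_adele) (A : set finite_adele) : measurable A ->
  mu ((fun x => x + a) @^-1` A) = mu A.
Proof.
move=> mA; have [tr _ _] := mu_haar; rewrite -(tr (- a) _ mA); congr (mu _).
apply/seteqP; split => [x Ax|_ [y Ay <-]]; last by rewrite /preimage /= addrAC addNr add0r.
by exists (x + a) => //; rewrite addrC addrK.
Qed.

(** Balls generate the Borel sets and are stable under intersection, and the adeles are exhausted by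
    lattices of finite volume, so the uniqueness theorem for measures applies. *)
Lemma haar_unique (nu : {measure set finite_adele -> \bar R}) :
  (forall a n, nu (adele_ball a n) = mu (adele_ball a n)) ->
  forall A, measurable A -> mu A = nu A.
Proof.
move=> e; apply: (measure_unique adele_balls (fun k : nat => frak_a k)
    adele_measurableE adele_balls_setI).
- by move=> k; right; exists 0, k%:Z; rewrite adele_ball0.
- apply/seteqP; split => // x _; have [k xk] := bigcup_frak_a x; by exists k.
- by move=> _ [->|[a [n ->]]]; rewrite ?measure0.
- by move=> k; rewrite (haar_frak_a mu_haar mu_Zhat) ltry.
Qed.

(** Among symmetries, [is_haar] provides only translations. The image of [mu] under negation agrees
    with [mu] on balls, because negation sends a ball to one of the same index; uniqueness extends
    this. *)
Lemma haar_opp (A : set finite_adele) : measurable A -> mu ((fun x => - x) @^-1` A) = mu A.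
Proof.
move=> mA; rewrite -[LHS]/(pushforward mu (fun x : finite_adele => - x) A).
symmetry; apply: haar_unique mA; first exact: adele_opp_measurable.
move=> mo a n; rewrite /= /pushforward.
rewrite (_ : _ @^-1` _ = adele_ball (- a) n) ?haar_ball //.
apply/seteqP; split => x; rewrite /preimage /adele_ball /= -opprD => /frak_aNE.
  by rewrite opprK.
by rewrite opprK.
Qed.

Lemma cmeasurable_locally_constant n (f : finite_adele -> R[i]) :
  (forall x z, frak_a n z -> f (x + z) = f x) -> cmeasurable setT f.
Proof.
by move=> fc; split; apply: (@locally_constant_measurable _ n) => x z za; rewrite fc.
Qed.

Lemma add_char_locally_constant y :
  exists n, forall x z, frak_a n z -> add_char R ((x + z) * y) = add_char R (x * y).
Proof.
have [l yl] := bigcup_frak_a y; exists (- l%:Z) => x z za.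
by rewrite mulrDl add_charD (add_char_frak_a R za) ?mulr1 // opprK.
Qed.

Lemma cmeasurable_add_char (y : finite_adele) :
  cmeasurable setT (fun x : finite_adele => add_char R (x * y)).
Proof.
have [n h] := add_char_locally_constant y.
exact: (@cmeasurable_locally_constant n).
Qed.

Lemma normsq_add_char y : normsq (add_char R y) = 1.
Proof. exact: add_char_norm. Qed.

Lemma haar_frak_a_fin n : (mu (frak_a n) < +oo)%E.
Proof. by rewrite (haar_frak_a mu_haar mu_Zhat) ltry. Qed.

Lemma cintegrable_add_char n (y : finite_adele) :
  cintegrable mu (frak_a n) (fun x : finite_adele => add_char R (x * y)).
Proof.
apply: (@bounded_cintegrable _ _ _ _ _ _ 1).
- exact: frak_a_measurable.
- exact: haar_frak_a_fin.
- by apply: cmeasurableS; [exact: frak_a_measurable|exact: cmeasurable_add_char].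
- by move=> x; rewrite normsq_add_char.
Qed.

Lemma cintegral_shift_frak_a n a (f : finite_adele -> R[i]) : cmeasurable setT f ->
  cintegral mu (adele_ball a n) f = cintegral mu (frak_a n) (fun x => f (x + a)).
Proof.
move=> mf; rewrite -(cintegral_preserving (adele_shift_measurable a) (haar_shift a)).
- congr (cintegral _ _ _); apply/seteqP; split => x; rewrite /preimage /adele_ball /= addrK //.
- exact: adele_ball_measurable.
- by apply: cmeasurableS => //; exact: adele_ball_measurable.
Qed.

(** The measure of [frak_a n], by [haar_frak_a], placed in the complex numbers so that transforms
    become ring expressions. *)
Definition vol n : R[i] := (ratr (exp_psi n) : R)%:C%C.

Lemma volN n : vol n * vol (- n) = 1.
Proof.
by rewrite /vol -rmorphM -rmorphM exp_psiN divff ?exp_psi_neq0 // rmorph1.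
Qed.

Lemma cintegral_cst_frak_a n c : cintegral mu (frak_a n) (fun=> c) = c * vol n.
Proof.
case: c => a b; rewrite /cintegral /= !Rintegral_cst; try exact: frak_a_measurable.
rewrite (haar_frak_a mu_haar mu_Zhat) /vol /=.
by apply/eqP; rewrite eq_complex /=; apply/andP; split; apply/eqP; ring.
Qed.

(* The annihilator of [frak_a n] is [frak_a (- n)]; outside of it the character is
   nontrivial on [frak_a n], and translating by a point where it is not 1 kills the
   integral. *)
Lemma cintegral_add_char n (y : finite_adele) :
  cintegral mu (frak_a n) (fun x : finite_adele => add_char R (x * y)) =
  vol n * cindic (frak_a (- n)) y.
Proof.
rewrite /cindic; have [ya|ya] := boolP (y \in frak_a (- n)).
  rewrite mulr1 -[RHS]mul1r -cintegral_cst_frak_a; apply: eq_cintegral => x xa.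
  by move: ya; rewrite inE => ya; exact: add_char_frak_a ya.
rewrite mulr0; set I := cintegral _ _ _; pose g := aq (exp_psi n)^-1.
have I_eq : I = add_char R (g * y) * I.
  rewrite {1}/I -adele_ball0.
  rewrite (_ : adele_ball 0 n = adele_ball g n).
    rewrite cintegral_shift_frak_a; last exact: cmeasurable_add_char.
    rewrite -cintegralZ //; [|exact: frak_a_measurable|exact: cintegrable_add_char].
    by apply: eq_cintegral => x _; exact: add_char_shift.
  have g0 : adele_ball 0 n g by rewrite /adele_ball /= subr0; exact: frak_a_gen.
  have gg : adele_ball g n g by rewrite /adele_ball /= subrr; exact: frak_a0.
  by apply/seteqP; split => x xa; [exact: (adele_ball_sub (lexx n) g0 gg xa)
    |exact: (adele_ball_sub (lexx n) gg g0 xa)].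
apply/eqP; apply: contraNT ya => I0; rewrite inE; apply: (@add_char_gen R).
by apply: (mulIf I0); rewrite mul1r -I_eq.
Qed.

(** The transform of the indicator of [adele_ball a n], obtained in [fourier_partial_ball] for every
    truncation containing the ball. *)
Definition fball (a : finite_adele) n (xi : finite_adele) : R[i] :=
  add_char R (a * xi) * (vol n * cindic (frak_a (- n)) xi).

Lemma fourier_partial_ball a n (l : nat) : adele_ball a n `<=` frak_a l ->
  fourier_partial mu (cindic (adele_ball a n)) l = fball a n.
Proof.
move=> al; apply/funext => xi; rewrite /fourier_partial cintegral_setI_indic.
rewrite (setIidr al) cintegral_shift_frak_a; last exact: cmeasurable_add_char.
rewrite /fball -cintegral_add_char -cintegralZ;
  [|exact: frak_a_measurable|exact: cintegrable_add_char].
by apply: eq_cintegral => x _; exact: add_char_shift.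
Qed.

(** The two characters combine into $\chi(\xi(x+a))$, integrated over [frak_a (- n)], whose
    annihilator is [frak_a n]; the volumes cancel by [volN]. The condition $x+a\in\mathfrak{a}^n$
    explains the sign of the centre. *)
Lemma fourier_partial_fball a (n : int) (l : nat) : - n <= l ->
  fourier_partial mu (fball a n) l = cindic (adele_ball (- a) n).
Proof.
move=> nl; apply/funext => x; rewrite /fourier_partial.
under eq_cintegral => xi _.
  rewrite (_ : _ * _ = vol n * add_char R (xi * (x + a)) * cindic (frak_a (- n)) xi).
    over.
  by rewrite /fball add_charDr 2!mulrA; congr (_ * _); exact: mulrC.
rewrite cintegral_setI_indic (setIidr (sub_frak_a nl)).
rewrite cintegralZ; [|exact: frak_a_measurable|exact: cintegrable_add_char].
rewrite cintegral_add_char mulrA volN mul1r opprK.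
congr ((_ : bool)%:R%:C)%C; apply/idP/idP; rewrite !inE /adele_ball /= opprK //.
Qed.

Lemma cmeasurable_fball a n : cmeasurable setT (fball a n).
Proof.
apply: cmeasurableM; first by under eq_fun do rewrite mulrC; exact: cmeasurable_add_char.
apply: cmeasurableM; first exact: cmeasurable_cst.
by apply: cmeasurable_indic; exact: frak_a_measurable.
Qed.

Lemma conjcM (x y : R[i]) : (x * y)^*%C = x^*%C * y^*%C. Proof. exact: rmorphM. Qed.

Lemma volJ n : (vol n)^*%C = vol n. Proof. exact: conjc_real. Qed.

(** The product is the single character $\chi(\xi(a-b))$, up to volumes, on the intersection of the
    two supports. In use, [k] is the larger of [m] and [n]. *)
Lemma fball_gram_annihilator a b m n k :
  frak_a (- m) `&` frak_a (- n) = frak_a (- k) ->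
  cintegral mu setT (fun xi => fball a m xi * (fball b n xi)^*%C) =
  vol m * vol n * (vol (- k) * cindic (frak_a k) (a - b)).
Proof.
move=> mnk; under eq_cintegral => xi _.
  rewrite (_ : _ * _ = vol m * vol n * add_char R (xi * (a - b)) * cindic (frak_a (- k)) xi).
    over.
  rewrite /fball !conjcM volJ add_charBr.
  have -> : (cindic (frak_a (- n)) xi)^*%C = cindic (frak_a (- n)) xi :> R[i].
    exact: conjc_real.
  have -> : cindic (frak_a (- k)) xi = cindic (frak_a (- m)) xi * cindic (frak_a (- n)) xi :> R[i].
    rewrite /cindic -rmorphM -natrM mulnb; congr ((_ : bool)%:R%:C)%C.
    by rewrite -mnk in_setI.
  by ring.
rewrite cintegral_setI_indic setTI cintegralZ;
  [|exact: frak_a_measurable|exact: cintegrable_add_char].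
by rewrite cintegral_add_char opprK.
Qed.

(** Both sides are the volume of the smaller lattice times the indicator of [a - b] in the larger
    one: for $m\le n$, [vol m * vol n * vol (- n)] collapses to [vol m]. *)
Lemma fball_gram a b m n :
  cintegral mu setT (fun xi => fball a m xi * (fball b n xi)^*%C) =
  (fine (mu (adele_ball a m `&` adele_ball b n)))%:C%C.
Proof.
have mu_ballI a' b' m' n' : m' <= n' ->
    (fine (mu (adele_ball a' m' `&` adele_ball b' n')))%:C%C =
    vol m' * cindic (frak_a n') (a' - b').
  move=> mn; rewrite adele_ballI // /cindic; case: asboolP => ab.
    by rewrite (haar_ball mu_haar) (haar_frak_a mu_haar mu_Zhat) mem_set // mulr1.
  by rewrite measure0 memNset // mulr0.
have [mn|nm] := leP m n.
  rewrite mu_ballI // (fball_gram_annihilator a b (k := n)).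
    by rewrite -mulrA [vol n * _]mulrA volN mul1r.
  by apply/setIidPr/sub_frak_a; rewrite lerN2.
rewrite setIC mu_ballI ?(ltW nm) // (fball_gram_annihilator a b (k := m)).
  rewrite [vol m * _]mulrC -mulrA [vol m * _]mulrA volN mul1r; congr (_ * _).
  rewrite -opprB /cindic; congr ((_ : bool)%:R%:C)%C.
  by apply/idP/idP; rewrite !inE => /frak_aNE.
by apply/setIidPl/sub_frak_a; rewrite lerN2 ltW.
Qed.

End haar_invariance.

(** * Density *)

Import HBNNSimple.

Section L2_density.
Context d (T : measurableType d) (R : realType).
Variable mu : {measure set T -> \bar R}.
Implicit Types (f g : T -> R[i]) (u v w : L2 mu).

Lemma sqint_dominated f g : cmeasurable setT f -> square_integrable mu g ->
  (forall x, normsq (f x) <= normsq (g x)) -> square_integrable mu f.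
Proof.
move=> mf /sqintP[mg goo] fg; apply/sqintP; split => //; apply: le_lt_trans goo.
apply: ge0_le_integral => //; try exact: cmeasurable_normsq.
  by move=> x _; rewrite lee_fin normsq_ge0.
by move=> x _; rewrite lee_fin.
Qed.

Lemma sqint_cindic A : measurable A -> (mu A < +oo)%E ->
  square_integrable mu (cindic A).
Proof.
move=> mA Aoo; apply/sqintP; split; first exact: cmeasurable_indic.
rewrite /nsq (_ : (fun x => _) = EFin \o \1_A) ?integral_indic ?setIT //.
apply/funext => x /=; rewrite /normsq /cindic /= indicE.
by case: (x \in A); rewrite ?expr1n ?expr0n /= ?addr0 ?mulr0.
Qed.

Lemma L2_dominated (f_ : nat -> T -> R[i]) f g :
  (forall n, square_integrable mu (f_ n)) -> square_integrable mu f ->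
  square_integrable mu g ->
  (forall x, normsq (f x - f_ n x) @[n --> \oo] --> (0 : R)) ->
  (forall n x, normsq (f x - f_ n x) <= normsq (g x)) ->
  forall e, 0 < e -> exists n, Nsq (toL2 mu f - toL2 mu (f_ n)) < e.
Proof.
move=> fi_ fi gi cf fg e e0.
have [mf _] := (sqintP _ f).1 fi.
have mf_ n : cmeasurable setT (f_ n) by have [] := (sqintP _ (f_ n)).1 (fi_ n).
have [|||||_ _] := @dominated_convergence _ _ R mu setT measurableT
  (fun n x => (normsq (f x - f_ n x))%:E) (cst 0%E) (fun x => (normsq (g x))%:E).
- by move=> n; apply: cmeasurable_normsq; exact: cmeasurableB.
- exact: measurable_cst.
- by apply: aeW => x _; apply: cvg_EFin; [exact: nearW|exact: cf].
- exact: sqint_integrable.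
- by apply: aeW => x n _; rewrite abse_EFin lee_fin ger0_norm ?normsq_ge0.
rewrite integral_cst // mul0e => /fine_cvgP[_ /cvgr0Pnorm_lt/(_ _ e0)[n _ /(_ n (leqnn n))]].
rewrite /= => h; exists n; apply: le_lt_trans (ler_norm _) _; move: h; congr (`|fine _| < e).
rewrite -[LHS]/(nsq mu (fun x => f x - f_ n x)); apply: ae_eq_nsq.
- exact: cmeasurableB.
- exact: L2_cmeasurable.
- apply: filterS3 (toL2_ae fi) (toL2_ae (fi_ n)) (L2B_ae (toL2 mu f) (toL2 mu (f_ n))).
  by move=> x fx fnx ->; rewrite fx fnx.
Qed.

Section closed_subspace.
Variable K : L2 mu -> Prop.
Hypotheses (K0 : K 0) (KD : forall u v, K u -> K v -> K (u + v)).
Hypothesis KZ : forall c u, K u -> K (c *: u).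
Hypothesis Kcl : forall u, (forall e, 0 < e -> exists2 v, K v & Nsq (u - v) < e) -> K u.

Lemma closed_subspace_dominated (f_ : nat -> T -> R[i]) f g :
  (forall n, square_integrable mu (f_ n)) -> square_integrable mu f ->
  square_integrable mu g ->
  (forall x, normsq (f x - f_ n x) @[n --> \oo] --> (0 : R)) ->
  (forall n x, normsq (f x - f_ n x) <= normsq (g x)) ->
  (forall n, K (toL2 mu (f_ n))) -> K (toL2 mu f).
Proof.
move=> fi_ fi gi cf fg Kf; apply: Kcl => e e0.
by have [n nP] := L2_dominated fi_ fi gi cf fg e0; exists (toL2 mu (f_ n)).
Qed.

Variable F : nat -> set T.
Hypotheses (mF : forall l, measurable (F l)) (Foo : forall l, (mu (F l) < +oo)%E).
Hypotheses (Fnd : forall m n, (m <= n)%N -> F m `<=` F n) (FT : \bigcup_l F l = setT).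
Hypothesis KF : forall A l, measurable A -> K (toL2 mu (cindic (A `&` F l))).

Let sqint_cindicI A l : measurable A -> square_integrable mu (cindic (A `&` F l)).
Proof.
move=> mA; apply: sqint_cindic; first exact: measurableI.
apply: le_lt_trans (Foo l); apply: le_measure; rewrite ?inE //; exact: measurableI.
Qed.

Lemma toL2_sum_in (I : Type) (r : seq I) (c : I -> R[i]) (A : I -> set T) l :
  (forall i, measurable (A i)) ->
  square_integrable mu (fun x => \sum_(i <- r) c i * cindic (A i `&` F l) x) /\
  K (toL2 mu (fun x => \sum_(i <- r) c i * cindic (A i `&` F l) x)).
Proof.
move=> mA; elim: r => [|i r [IHi IHK]].
  under eq_fun do rewrite big_nil.
  by split; [exact: sqint0|rewrite toL2_0].
under eq_fun do rewrite big_cons.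
have si := sqint_cindicI l (mA i).
split; first by apply: sqintD => //; exact: sqintZ.
by rewrite toL2D //; [rewrite toL2Z //; apply: KD => //; apply: KZ; exact: KF|exact: sqintZ].
Qed.

(** Simple functions increase to [h] and the errors are dominated by [h] itself, so dominated
    convergence and closedness of [K] conclude. *)
Lemma closed_subspace_ge0 (h : T -> R) : measurable_fun setT h -> (forall x, 0 <= h x) ->
  square_integrable mu (fun x => (h x)%:C%C) -> K (toL2 mu (fun x => (h x)%:C%C)).
Proof.
move=> mh h0 hi; have mh' : measurable_fun setT (EFin \o h) by exact/measurable_EFinP.
pose s n := nnsfun_approx measurableT mh' n.
(* Cutting off at [F n] gives every level set, including that of the value 0, finite measure, and
   puts its indicator in the form covered by [KF]. *)
pose f_ n x : R[i] := (s n x)%:C%C * cindic (F n) x.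
have sh_cvg x : s n x @[n --> \oo] --> h x.
  have : EFin \o s ^~ x @ \oo --> (h x)%:E.
    by apply: cvg_nnsfun_approx => // y _; rewrite lee_fin.
  by move/fine_cvgP => [].
have sh n x : s n x <= h x.
  have snd : nondecreasing_seq (fun n => s n x).
    by move=> i j ij; have /lefP := nd_nnsfun_approx measurableT mh' ij; exact.
  by rewrite -(cvg_lim _ (sh_cvg x)) //; apply: nondecreasing_cvgn_le => //;
    apply/cvg_ex; exists (h x).
have f_E n : f_ n = fun x => \sum_(y <- finmap.enum_fset (fset_set (range (s n))))
    y%:C%C * cindic ((s n) @^-1` [set y] `&` F n) x.
  apply/funext => x; rewrite /f_ (fimfunE (s n) x) fsbig_finite //= rmorph_sum mulr_suml.
  apply: eq_bigr => y _; rewrite rmorphM -mulrA; congr (_ * _).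
  by rewrite /cindic -rmorphM in_setI indicE; case: (_ \in _); rewrite ?mul1r ?mul0r.
have fK n : square_integrable mu (f_ n) /\ K (toL2 mu (f_ n)).
  by rewrite f_E; apply: toL2_sum_in => y; exact: measurable_sfunP.
apply: (@closed_subspace_dominated f_ _ (fun x => (h x)%:C%C)) => //.
- by move=> n; have [] := fK n.
- move=> x; have [m _ mx] : (\bigcup_l F l) x by rewrite FT.
  have c0 : (h x - s n x) ^+ 2 @[n --> \oo] --> (0 : R).
    have -> : (0 : R) = (h x - h x) ^+ 2 by rewrite subrr expr0n.
    rewrite expr2; under eq_fun do rewrite expr2.
    by apply: cvgM; apply: cvgB => //; exact: cvg_cst.
  apply: cvg_trans c0; apply: near_eq_cvg; exists m => // n /= mn.
  rewrite /f_ /cindic mem_set; last exact: (Fnd mn).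
  by rewrite mulr1 -rmorphB /normsq /= expr0n addr0.
- move=> n x; rewrite /f_ /cindic; case: (x \in F n); rewrite ?mulr1 ?mulr0 ?subr0 //.
  rewrite -rmorphB /normsq /= expr0n !addr0 ler_sqr ?nnegrE ?subr_ge0 //.
  by rewrite lerBlDr lerDl; exact: fun_ge0.
- by move=> n; have [] := fK n.
Qed.

(** Split into real and imaginary parts, then into positive and negative parts; each is dominated by
    [u], hence square-integrable, and falls under [closed_subspace_ge0]. *)
Lemma closed_subspace_full u : K u.
Proof.
have [mr mi] := L2_cmeasurable u.
have ui := L2_sqint u.
have pos (h : T -> R) : measurable_fun setT h -> (forall x, h x ^+ 2 <= normsq (u x)) ->
    let hp (x : T) : R[i] := (Num.max (h x) 0)%:C%C in
    square_integrable mu hp /\ K (toL2 mu hp).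
  move=> mh hu hp.
  have mhp : measurable_fun setT (fun x => Num.max (h x) 0).
    by apply: measurable_maxr => //; exact: measurable_cst.
  have hpi : square_integrable mu hp.
    apply: (@sqint_dominated _ u _ ui); first by split => //; exact: measurable_cst.
    move=> x; apply: (le_trans _ (hu x)); rewrite /normsq /= expr0n addr0.
    by case: (leP (h x) 0) => _; rewrite ?expr0n ?sqr_ge0.
  split => //; apply: closed_subspace_ge0 => // x.
  by rewrite le_max lexx orbT.
have signed (h : T -> R) : measurable_fun setT h -> (forall x, h x ^+ 2 <= normsq (u x)) ->
    square_integrable mu (fun x => (h x)%:C%C) /\ K (toL2 mu (fun x => (h x)%:C%C)).
  move=> mh hu; have [pi pK] := pos h mh hu.
  have [ni nK] : let hn (x : T) : R[i] := (Num.max (- h x) 0)%:C%C in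
      square_integrable mu hn /\ K (toL2 mu hn).
    by apply: pos; [exact: measurableT_comp|move=> x; rewrite sqrrN].
  have -> : (fun x => (h x)%:C%C) =
      (fun x => (Num.max (h x) 0)%:C%C + (-1) * (Num.max (- h x) 0)%:C%C) :> (T -> R[i]).
    apply/funext => x; rewrite mulN1r -rmorphB; congr (_%:C)%C.
    by rewrite /Num.max oppr_lt0; case: ltgtP => [h0|h0|->]; lra.
  split; first by apply: sqintD => //; exact: sqintZ.
  by rewrite toL2D //; [rewrite toL2Z //; apply: KD => //; exact: KZ|exact: sqintZ].
have re2 x : complex.Re (u x) ^+ 2 <= normsq (u x) by rewrite lerDl sqr_ge0.
have im2 x : complex.Im (u x) ^+ 2 <= normsq (u x) by rewrite lerDr sqr_ge0.
have [ri rK] := signed _ mr re2.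
have [ii iK] := signed _ mi im2.
rewrite -[u]toL2K.
have -> : (u : T -> R[i]) = fun x => (complex.Re (u x))%:C%C + 'i%C * (complex.Im (u x))%:C%C.
  by apply/funext => x; rewrite -complexE.
by rewrite toL2D //; [rewrite toL2Z //; apply: KD => //; exact: KZ|exact: sqintZ].
Qed.

End closed_subspace.
End L2_density.

(** * Density of the span of indicators of balls *)

Section ball_density.
Variables (R : realType) (mu : {measure set finite_adele -> \bar R}).
Hypothesis mu_haar : is_haar mu.
Hypothesis mu_Zhat : mu Zhat = 1%E.
Implicit Types u v s : L2 mu.

(** Linear combinations are built one ball at a time, so that properties of the span are proved by
    induction without coefficient families. *)
Inductive ball_span : L2 mu -> Prop :=
| ball_span0 : ball_span 0
| ball_spanS (c : R[i]) A s : adele_balls A -> ball_span s ->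
    ball_span (c *: toL2 mu (cindic A) + s).

Lemma ball_spanD u v : ball_span u -> ball_span v -> ball_span (u + v).
Proof.
move=> su sv; elim: su => [|c A s bA _ IH]; first by rewrite add0r.
by rewrite -addrA; exact: ball_spanS.
Qed.

Lemma ball_spanZ c u : ball_span u -> ball_span (c *: u).
Proof.
elim=> [|b A s bA _ IH]; first by rewrite scaler0; exact: ball_span0.
by rewrite scalerDr scalerA; exact: ball_spanS.
Qed.

Lemma ball_span_ball A : adele_balls A -> ball_span (toL2 mu (cindic A)).
Proof.
move=> bA; rewrite -[toL2 _ _]scale1r -[_ *: _]addr0.
by apply: ball_spanS => //; exact: ball_span0.
Qed.

Definition ball_closure u := forall e, 0 < e -> exists2 s, ball_span s & Nsq (u - s) < e.

Lemma ball_span_closure u : ball_span u -> ball_closure u.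
Proof.
by move=> su e e0; exists u => //; rewrite subrr Nsq0.
Qed.

Lemma ball_closureD u v : ball_closure u -> ball_closure v -> ball_closure (u + v).
Proof.
move=> cu cv e e0; have e4 : 0 < e / 4 by rewrite divr_gt0.
have [s ss us] := cu _ e4; have [t st vt] := cv _ e4.
exists (s + t); first exact: ball_spanD.
by rewrite opprD addrACA; have := NsqD2 (u - s) (v - t); lra.
Qed.

Lemma ball_closureZ c u : ball_closure u -> ball_closure (c *: u).
Proof.
move=> cu e e0; have c0 := normsq_ge0 c.
(* The summand 1 keeps the denominator positive when [c] is 0. *)
have [|s ss us] := cu (e / (normsq c + 1)); first by rewrite divr_gt0 // ltr_wpDl.
exists (c *: s); first exact: ball_spanZ.
rewrite -scalerBr NsqZ; move: us; rewrite ltr_pdivlMr ?ltr_wpDl //.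
have := Nsq_ge0 (u - s); nra.
Qed.

Lemma ball_closure_closed u :
  (forall e, 0 < e -> exists2 v, ball_closure v & Nsq (u - v) < e) -> ball_closure u.
Proof.
move=> cu e e0; have e4 : 0 < e / 4 by rewrite divr_gt0.
have [v cv uv] := cu _ e4; have [s ss vs] := cv _ e4; exists s => //.
have -> : u - s = (u - v) + (v - s) by rewrite addrA subrK.
by have := NsqD2 (u - v) (v - s); lra.
Qed.

Lemma adele_balls_measurable A : adele_balls A -> measurable A.
Proof. by move=> [->|[a [n ->]]] //; exact: adele_ball_measurable. Qed.

Lemma adele_balls_frak_a n : adele_balls (frak_a n).
Proof. by right; exists 0, n; rewrite adele_ball0. Qed.

Lemma adele_balls_fin A : adele_balls A -> (mu A < +oo)%E.
Proof.
move=> [->|[a [n ->]]]; first by rewrite measure0.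
by rewrite (haar_ball mu_haar) (haar_frak_a_fin mu_haar mu_Zhat).
Qed.

Lemma sqint_balls A : adele_balls A -> square_integrable mu (cindic A).
Proof.
by move=> bA; apply: sqint_cindic; [exact: adele_balls_measurable|exact: adele_balls_fin].
Qed.

Lemma sqint_cindic_frak_a A n : measurable A ->
  square_integrable mu (cindic (A `&` frak_a n)).
Proof.
move=> mA; have mAF : measurable (A `&` frak_a n).
  by apply: measurableI => //; exact: frak_a_measurable.
apply: sqint_cindic => //; apply: le_lt_trans (haar_frak_a_fin mu_haar mu_Zhat n).
by apply: le_measure; rewrite ?inE //; exact: frak_a_measurable.
Qed.

(** Dynkin induction on [A]. Intersecting with a lattice keeps the measure finite, which complements
    and countable unions alone would not. *)
Lemma ball_closure_cindic A (l : nat) : measurable A ->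
  ball_closure (toL2 mu (cindic (A `&` frak_a l))).
Proof.
move=> mA.
pose P (A : set finite_adele) :=
  forall l : nat, ball_closure (toL2 mu (cindic (A `&` frak_a l))).
suff : P A by exact.
move: mA; rewrite adele_measurableE => mA; move: A mA.
apply: (dynkin_induction adele_measurableE adele_balls_setI) => /=.
- move=> k; rewrite setTI; apply: ball_span_closure; apply: ball_span_ball.
  exact: adele_balls_frak_a.
- move=> B bB k; apply: ball_span_closure; apply: ball_span_ball.
  by apply: adele_balls_setI => //; exact: adele_balls_frak_a.
- move=> B mB PB k.
  have -> : toL2 mu (cindic (~` B `&` frak_a k)) =
      toL2 mu (cindic (frak_a k)) + (-1) *: toL2 mu (cindic (B `&` frak_a k)).
    have i1 := sqint_balls (adele_balls_frak_a k).
    have i2 := sqint_cindic_frak_a k mB.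
    rewrite -toL2Z // -toL2D //; last exact: sqintZ.
    congr (toL2 mu _); apply/funext => x; rewrite mulN1r /cindic -rmorphB !in_setI in_setC.
    by case: (x \in B); case: (x \in frak_a k); rewrite /= ?subrr ?subr0.
  apply: ball_closureD; last exact/ball_closureZ/PB.
  by apply: ball_span_closure; apply: ball_span_ball; exact: adele_balls_frak_a.
(* Finite partial unions converge pointwise under the indicator of [frak_a k], and by disjointness
   the indicator of each is a finite sum. *)
- move=> F mF tF PF k.
  pose B N := \bigcup_(i in `I_N) F i.
  have mB N : measurable (B N) by apply: bigcup_measurable.
  have mU : measurable (\bigcup_i F i) by exact: bigcupT_measurable.
  apply: (@closed_subspace_dominated _ _ _ _ ball_closure ball_closure_closed
    (fun N => cindic (B N `&` frak_a k)) _ (cindic (frak_a k))).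
  + by move=> N; exact: sqint_cindic_frak_a.
  + exact: sqint_cindic_frak_a.
  + exact: sqint_balls (adele_balls_frak_a k).
  + move=> x; apply: (@cvg_trans _ ((fun=> 0 : R) @ \oo)); last exact: cvg_cst.
    apply: near_eq_cvg.
    have [[i _ xi]|xU] := pselect ((\bigcup_i F i) x).
      exists i.+1 => // N /= iN.
      have xBN : B N x by exists i.
      have xU : (\bigcup_i F i) x by exists i.
      rewrite /cindic !in_setI (mem_set xBN) (mem_set xU).
      by rewrite subrr /normsq /= expr0n addr0.
    apply: nearW => N; have xBN : ~ B N x by move=> [i _ xi]; apply: xU; exists i.
    rewrite /cindic !in_setI (memNset xBN) (memNset xU).
    by rewrite subrr /normsq /= expr0n addr0.
  + move=> N x; rewrite /cindic !in_setI.
    have [xB|xB] := boolP (x \in B N); have [xU|xU] := boolP (x \in \bigcup_i F i);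
      have [xk|xk] := boolP (x \in frak_a k); rewrite /= ?subrr ?subr0 ?normsq_ge0 //;
      rewrite /normsq /= ?expr0n ?addr0 ?sqr_ge0 //.
    case/negP: xU; move: xB; rewrite !inE => -[i _ xi]; by exists i.
  + elim=> [|N IH].
      have -> : B 0%N `&` frak_a k = set0.
        by apply/seteqP; split => // x [] [j].
      by apply: ball_span_closure; apply: ball_span_ball; left.
    have -> : toL2 mu (cindic (B N.+1 `&` frak_a k)) =
        toL2 mu (cindic (B N `&` frak_a k)) + toL2 mu (cindic (F N `&` frak_a k)).
      rewrite -toL2D; [|exact: sqint_cindic_frak_a|exact: sqint_cindic_frak_a].
      congr (toL2 mu _); apply/funext => x; rewrite /cindic -rmorphD -natrD !in_setI.
      congr ((_ : nat)%:R%:C)%C; case: (x \in frak_a k); rewrite ?andbF ?andbT //.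
      have BS : (x \in B N.+1) = (x \in B N) || (x \in F N).
        apply/idP/idP; rewrite !inE.
          move=> [i /= ]; rewrite ltnS leq_eqVlt => /predU1P[->|iN] xi; apply/orP.
            by right; rewrite inE.
          by left; rewrite inE; exists i.
        move=> /orP[]; rewrite inE; last by exists N => /=.
        by move=> [i /= iN xi]; exists i => //=; exact: ltnW.
      rewrite BS; have [|_] := boolP (x \in B N); last by rewrite add0n.
      rewrite inE => -[i /= iN xi]; rewrite memNset // => xN.
      have /trivIsetP/(_ i N I I) := tF; rewrite neq_ltn iN => /(_ isT) e.
      by have : (F i `&` F N) x by []; rewrite e.
    by apply: ball_closureD; [exact: IH|exact: PF].
Qed.

Lemma ball_span_dense u : ball_closure u.
Proof.
apply: (@closed_subspace_full _ _ _ mu ball_closure _ _ _ ball_closure_closed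
  (fun l : nat => frak_a l)).
- by apply: ball_span_closure; exact: ball_span0.
- exact: ball_closureD.
- exact: ball_closureZ.
- by move=> l; exact: frak_a_measurable.
- by move=> l; exact: haar_frak_a_fin.
- by move=> m n mn; apply: sub_frak_a; rewrite lez_nat.
- apply/seteqP; split => // x _; have [l xl] := bigcup_frak_a x; by exists l.
- by move=> A l; exact: ball_closure_cindic.
Qed.

End ball_density.

(** * The Fourier transform on [L2] *)

(** The premise has the shape $(1+t)M+(1+t^{-1})t^2$ that Young's inequality produces when the
    perturbation has squared norm at most $t^2$. *)
Lemma le_of_approx (R : realFieldType) (a M : R) :
  (forall t, 0 < t -> a <= (1 + t) * M + t + t ^+ 2) -> a <= M.
Proof.
move=> h; rewrite leNgt; apply/negP => Ma.
pose D := a - M; pose c := `|M| + 2 + D; have D0 : 0 < D by rewrite subr_gt0.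
have M0 := normr_ge0 M; have c0 : 0 < c by rewrite /c; lra.
(* Chosen so that $t|M|+t+t^2\le tc=D/2<D$, which contradicts $a=M+D$. *)
pose t := D / (2 * c).
have t0 : 0 < t by rewrite divr_gt0 // mulr_gt0.
have tc : t * c = D / 2 by rewrite /t invfM mulrA mulrVK ?unitfE ?gt_eqF.
have := h t t0; have := ler_norm M.
have tD : t <= D by rewrite ler_pdivrMr ?mulr_gt0 // /c; nra.
move: tc; rewrite /c /D; nra.
Qed.

Section fourier_transform.
Variables (R : realType) (mu : {measure set finite_adele -> \bar R}).
Hypothesis mu_haar : is_haar mu.
Hypothesis mu_Zhat : mu Zhat = 1%E.
Implicit Types u v s : L2 mu.
Notation F := (fourier_partial mu).

(** The conjugate undoes the one taken by [L2dot], and the cut-off to [frak_a l] makes the character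
    square-integrable. *)
Definition kernel_fun (l : nat) (xi x : finite_adele) : R[i] :=
  (add_char R (x * xi))^*%C * cindic (frak_a l) x.

Lemma sqint_kernel_fun l xi : square_integrable mu (kernel_fun l xi).
Proof.
apply: (@sqint_dominated _ _ _ _ _ (cindic (frak_a l))).
- apply: cmeasurableM; last by apply: cmeasurable_indic; exact: frak_a_measurable.
  by apply: cmeasurableJ; exact: cmeasurable_add_char.
- exact: sqint_balls (adele_balls_frak_a l).
- by move=> x; rewrite normsqM normsqJ normsq_add_char mul1r.
Qed.

(* In this form linearity, almost-everywhere invariance and L^2-continuity of the
   truncated transforms come from those of [L2dot]. *)
Lemma fourier_partialE (f : finite_adele -> R[i]) l xi : square_integrable mu f ->
  F f l xi = L2dot (toL2 mu f) (toL2 mu (kernel_fun l xi)).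
Proof.
move=> fi; have ki := sqint_kernel_fun l xi.
rewrite (L2dotE fi ki (toL2_ae fi) (toL2_ae ki)).
rewrite /fourier_partial -(setTI (frak_a l)) -cintegral_setI_indic.
apply: eq_cintegral => x _; rewrite /kernel_fun conjcM conjcK.
by rewrite [(cindic _ _)^*%C]conjc_real mulrA [f x * _]mulrC.
Qed.

Lemma fourier_partial_L2 u l xi : F u l xi = L2dot u (toL2 mu (kernel_fun l xi)).
Proof. by rewrite fourier_partialE ?toL2K. Qed.

Lemma fourier_partial_toL2 f l : square_integrable mu f -> F (toL2 mu f) l = F f l.
Proof.
by move=> fi; apply/funext => xi; rewrite fourier_partial_L2 fourier_partialE.
Qed.

(** On [frak_a l] the character does not see a shift of [xi] by [frak_a (- l)], so the truncated
    transform is locally constant whatever [f] is. *)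
Lemma cmeasurable_fourier_partial (f : finite_adele -> R[i]) l : cmeasurable setT (F f l).
Proof.
apply: (@cmeasurable_locally_constant _ (- l%:Z)) => xi z za.
apply: eq_cintegral => x xa; rewrite mulrDr add_charD.
by rewrite (add_char_frak_a R xa za) mulr1.
Qed.

Lemma fourier_partialD u v l : F (u + v : L2 mu) l = fun xi => F u l xi + F v l xi.
Proof. by apply/funext => xi; rewrite !fourier_partial_L2 L2dotDl. Qed.

Lemma fourier_partialZ c u l : F (c *: u : L2 mu) l = fun xi => c * F u l xi.
Proof. by apply/funext => xi; rewrite !fourier_partial_L2 L2dotZl. Qed.

Lemma fourier_partial0 l : F (0 : L2 mu) l = fun=> 0.
Proof.
by apply/funext => xi; rewrite -(scale0r (0 : L2 mu)) fourier_partialZ mul0r.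
Qed.

Lemma normsq_fourier_partial u l xi :
  normsq (F u l xi) <= Nsq u * Nsq (toL2 mu (kernel_fun l xi)).
Proof. by rewrite fourier_partial_L2; exact: L2_cauchy_schwarz. Qed.

Lemma sqint_fball a n : square_integrable mu (fball R a n).
Proof.
apply: (@sqint_dominated _ _ _ _ _ (fun x => vol R n * cindic (frak_a (- n)) x)).
- exact: cmeasurable_fball.
- by apply: sqintZ; exact: sqint_balls (adele_balls_frak_a _).
- by move=> x; rewrite /fball normsqM normsq_add_char mul1r.
Qed.

Lemma adele_balls_eventually A : adele_balls A ->
  exists l0 : nat, forall l, (l0 <= l)%N -> A `<=` frak_a l.
Proof.
move=> [->|[a [n ->]]]; first by exists 0%N => l _; exact: sub0set.
have [k ak] := bigcup_frak_a a; exists (maxn `|n| k) => l.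
rewrite geq_max => /andP[nl kl] x xa; rewrite -[x](subrK a).
apply: frak_aD; last by apply: sub_frak_a ak; rewrite lez_nat.
by apply: sub_frak_a xa; apply: (le_trans (ler_norm n)); rewrite -abszE lez_nat.
Qed.

Lemma fourier_partial_set0 l : F (cindic set0) l = fun=> 0.
Proof.
apply/funext => xi; rewrite /fourier_partial cintegral_setI_indic setI0.
by congr Complex; exact: Rintegral_set0.
Qed.

Lemma sqint_fourier_partial_ball A (l : nat) : adele_balls A -> A `<=` frak_a l ->
  square_integrable mu (F (cindic A) l).
Proof.
move=> [->|[a [n ->]]] Al; first by rewrite fourier_partial_set0; exact: sqint0.
by rewrite fourier_partial_ball //; exact: sqint_fball.
Qed.

Lemma L2dot_cindic A B : adele_balls A -> adele_balls B ->
  L2dot (toL2 mu (cindic A)) (toL2 mu (cindic B)) = (fine (mu (A `&` B)))%:C%C.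
Proof.
move=> bA bB; have iA := sqint_balls mu_haar mu_Zhat bA.
have iB := sqint_balls mu_haar mu_Zhat bB.
have mAB : measurable (A `&` B) by apply: measurableI; exact: adele_balls_measurable.
rewrite (L2dotE iA iB (toL2_ae iA) (toL2_ae iB)) /cintegral.
have E x : cindic A x * (cindic B x)^*%C = cindic (A `&` B) x :> R[i].
  rewrite [(cindic B x)^*%C]conjc_real /cindic -rmorphM -natrM mulnb in_setI //.
congr Complex.
  under eq_Rintegral do rewrite E /=.
  rewrite /Rintegral; congr fine; rewrite -[in RHS](setIT (A `&` B)) -integral_indic //.
under eq_Rintegral do rewrite E /=.
by rewrite /Rintegral integral0.
Qed.

Lemma fourier_partial_gram A B (l : nat) : adele_balls A -> adele_balls B ->
  A `<=` frak_a l -> B `<=` frak_a l ->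
  L2dot (toL2 mu (F (cindic A) l)) (toL2 mu (F (cindic B) l)) =
  L2dot (toL2 mu (cindic A)) (toL2 mu (cindic B)).
Proof.
move=> bA bB Al Bl; rewrite L2dot_cindic //.
case: bA Al => [->|[a [m ->]]] Al.
  by rewrite fourier_partial_set0 toL2_0 L2dot0l set0I measure0.
case: bB Bl => [->|[b [n ->]]] Bl.
  by rewrite fourier_partial_set0 toL2_0 L2dot0r setI0 measure0.
rewrite !fourier_partial_ball //.
rewrite (L2dotE (sqint_fball a m) (sqint_fball b n) (toL2_ae (sqint_fball a m))
  (toL2_ae (sqint_fball b n))).
exact: fball_gram.
Qed.

(** On the span of balls the l-th truncated transform preserves inner products of these
    restrictions, not of the elements themselves; hence it is only a contraction. *)
Definition cut (l : nat) u : L2 mu := toL2 mu (fun x => u x * cindic (frak_a l) x).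

Lemma sqint_cut l (f : finite_adele -> R[i]) : square_integrable mu f ->
  square_integrable mu (fun x => f x * cindic (frak_a l) x).
Proof.
move=> fi; have [mf _] := (sqintP _ f).1 fi; apply: (sqint_dominated _ fi).
  by apply: cmeasurableM => //; apply: cmeasurable_indic; exact: frak_a_measurable.
move=> x; rewrite /cindic; case: (x \in _); rewrite ?mulr1 ?mulr0 //.
by rewrite /normsq /= expr0n addr0; exact: normsq_ge0.
Qed.

Lemma cut_toL2 l f : square_integrable mu f ->
  cut l (toL2 mu f) = toL2 mu (fun x => f x * cindic (frak_a l) x).
Proof.
move=> fi; apply: toL2_eq; [exact/sqint_cut/L2_sqint|exact: sqint_cut|].
by apply: filterS (toL2_ae fi) => x ->.
Qed.

Lemma cutD l u v : cut l (u + v) = cut l u + cut l v.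
Proof.
rewrite /cut -toL2D; [|exact/sqint_cut/L2_sqint|exact/sqint_cut/L2_sqint].
apply: toL2_eq; first exact/sqint_cut/L2_sqint.
  by apply: sqintD; exact/sqint_cut/L2_sqint.
by apply: filterS (L2D_ae u v) => x ->; rewrite mulrDl.
Qed.

Lemma cutZ l c u : cut l (c *: u) = c *: cut l u.
Proof.
rewrite /cut -toL2Z; last exact/sqint_cut/L2_sqint.
apply: toL2_eq; first exact/sqint_cut/L2_sqint.
  by apply: sqintZ; exact/sqint_cut/L2_sqint.
by apply: filterS (L2Z_ae c u) => x ->; rewrite mulrA.
Qed.

Lemma Nsq_cut l u : Nsq (cut l u) <= Nsq u.
Proof.
rewrite -lee_fin !NsqE nsq_toL2; last exact/sqint_cut/L2_sqint.
have mc : cmeasurable setT (fun x => u x * cindic (frak_a l) x : R[i]).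
  by have [] := (sqintP mu _).1 (sqint_cut l (L2_sqint u)).
apply: ge0_le_integral => //.
- by move=> x _; rewrite lee_fin normsq_ge0.
- exact: cmeasurable_normsq.
- by apply: cmeasurable_normsq; exact: L2_cmeasurable.
move=> x _; rewrite lee_fin /cindic; case: (x \in _); rewrite ?mulr1 ?mulr0 //.
by rewrite {1}/normsq /= expr0n addr0; exact: normsq_ge0.
Qed.

Lemma cut_cindic l A : adele_balls A ->
  cut l (toL2 mu (cindic A)) = toL2 mu (cindic (A `&` frak_a l)).
Proof.
move=> bA; rewrite cut_toL2; last exact: sqint_balls.
congr (toL2 mu _); apply/funext => x; rewrite /cindic -rmorphM -natrM mulnb in_setI //.
Qed.

Lemma fourier_partial_cindic l A : adele_balls A ->
  F (toL2 mu (cindic A)) l = F (cindic (A `&` frak_a l)) l.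
Proof.
move=> bA; rewrite fourier_partial_toL2; last exact: sqint_balls.
apply/funext => xi; rewrite /fourier_partial !cintegral_setI_indic.
by rewrite [A `&` _]setIC setIA setIid.
Qed.

Lemma adele_balls_cut A l : adele_balls A -> adele_balls (A `&` frak_a l).
Proof. by move=> bA; apply: adele_balls_setI bA _; exact: adele_balls_frak_a. Qed.

Lemma sqint_fourier_partial_cut A (l : nat) : adele_balls A ->
  square_integrable mu (F (cindic (A `&` frak_a l)) l).
Proof.
move=> bA; apply: (sqint_fourier_partial_ball (adele_balls_cut l bA)).
exact: subIsetr.
Qed.

Lemma span_sqint (l : nat) s : ball_span s -> square_integrable mu (F s l).
Proof.
elim=> [|c A s' bA _ IH]; first by rewrite fourier_partial0; exact: sqint0.
rewrite fourier_partialD fourier_partialZ (fourier_partial_cindic l bA).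
by apply: sqintD IH; apply: sqintZ; exact: sqint_fourier_partial_cut.
Qed.

Lemma toL2_fourier_partialS (l : nat) (c : R[i]) A s : adele_balls A -> ball_span s ->
  toL2 mu (F (c *: toL2 mu (cindic A) + s : L2 mu) l) =
  c *: toL2 mu (F (cindic (A `&` frak_a l)) l) + toL2 mu (F s l).
Proof.
move=> bA ss; rewrite fourier_partialD fourier_partialZ (fourier_partial_cindic l bA).
have Ai := sqint_fourier_partial_cut l bA.
by rewrite (toL2D (sqintZ c Ai) (span_sqint l ss)) (toL2Z c Ai).
Qed.

(** Restricting a ball to [frak_a l] gives a ball or the empty set, so sesquilinearity reduces the
    claim to balls inside [frak_a l], where [fourier_partial_gram] applies. *)
Lemma span_dot (l : nat) s t : ball_span s -> ball_span t ->
  L2dot (toL2 mu (F s l)) (toL2 mu (F t l)) = L2dot (cut l s) (cut l t).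
Proof.
have cut0 : cut l 0 = 0 by rewrite -(scale0r (0 : L2 mu)) cutZ !scale0r.
have gen A : adele_balls A -> ball_span t ->
    L2dot (toL2 mu (F (cindic (A `&` frak_a l)) l)) (toL2 mu (F t l)) =
    L2dot (toL2 mu (cindic (A `&` frak_a l))) (cut l t).
  move=> bA; elim=> [|b B t' bB tt IHt]; first by rewrite fourier_partial0 toL2_0 cut0 !L2dot0r.
  rewrite (toL2_fourier_partialS l b bB tt) cutD cutZ (cut_cindic l bB) !L2dotDr !L2dotZr.
  rewrite [X in _ + X = _]IHt (fourier_partial_gram (adele_balls_cut l bA) (adele_balls_cut l bB)).
  - by [].
  - exact: subIsetr.
  - exact: subIsetr.
move=> ss st; elim: ss => [|c A s' bA ss IH].
  by rewrite fourier_partial0 toL2_0 cut0 !L2dot0l.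
rewrite (toL2_fourier_partialS l c bA ss) cutD cutZ (cut_cindic l bA) !L2dotDl !L2dotZl.
by rewrite [X in _ + X = _]IH [X in _ * X + _ = _](gen A bA st).
Qed.

Lemma span_Nsq l s : ball_span s -> Nsq (toL2 mu (F s l)) <= Nsq s.
Proof.
move=> ss; have := span_dot l ss ss; rewrite !L2dot_self => /complexI ->.
exact: Nsq_cut.
Qed.

End fourier_transform.

Lemma cvg_of_sqr_le (R : realType) (a : nat -> R) (b K : R) :
  (forall n, (b - a n) ^+ 2 <= n.+1%:R^-1 * K) -> a n @[n --> \oo] --> b.
Proof.
move=> ab; have K0 : 0 <= K.
  by have := ab 0%N; rewrite invr1 mul1r; apply: le_trans; rewrite sqr_ge0.
apply/cvgrPdist_lt => e e0.
have d0 : 0 < e ^+ 2 / (K + 1) by rewrite divr_gt0 ?exprn_gt0 // ltr_wpDl.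
have [N _ Nn] := near_infty_natSinv_lt (PosNum d0).
exists N => // n /Nn /=; rewrite ltr_pdivlMr ?ltr_wpDl // => nK.
rewrite -(ltr_pXn2r (ltn0Sn 1)) ?nnegrE ?(ltW e0) //.
rewrite real_normK ?num_real //; apply: le_lt_trans (ab n) _; apply: le_lt_trans nK.
by rewrite ler_wpM2l ?invr_ge0 // lerDl.
Qed.

(* The next four facts are stated over abstract rings and modules because matching
   elements of [L2 mu] up to conversion is prohibitively slow. *)
Lemma lt_eighths (R : realFieldType) (a b c M e : R) :
  0 < e -> a <= 2 * b + 2 * c -> b <= M -> c <= M ->
  M < e / 8 -> a < e.
Proof. lra. Qed.

Lemma lt_quarters (R : realFieldType) (a b c e : R) :
  a <= 2 * b + 2 * c -> b < e / 4 -> c < e / 4 -> a < e.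
Proof. lra. Qed.

Lemma eq_le_eq (R : numDomainType) (a b c e : R) : a = b -> b <= c -> c = e -> a <= e.
Proof. by move=> -> + <-. Qed.

Lemma sub_shift (V : zmodType) (a b c u s : V) :
  a = b - c -> c = s -> b - u = a - (u - s).
Proof. by move=> -> ->; rewrite opprB addrA subrK. Qed.

(** * The limit transform: contraction, inversion, isometry *)

Section fourier_L2.
Variables (R : realType) (mu : {measure set finite_adele -> \bar R}).
Hypothesis mu_haar : is_haar mu.
Hypothesis mu_Zhat : mu Zhat = 1%E.
Implicit Types u v s : L2 mu.
Notation F := (fourier_partial mu).

(** Span elements approach [u], and by Cauchy-Schwarz against the kernel their truncated transforms
    converge pointwise; Fatou then transfers the contraction bound. *)
Lemma nsq_fourier_partial_approx u l t : 0 < t ->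
  (nsq mu (F u l) <= ((1 + t) * Nsq u + t + t ^+ 2)%:E)%E.
Proof.
(* The bound [t ^+ 2] limits the loss in norm to $(1+t^{-1})t^2=t+t^2$; the bound 1/(j+1) forces
   pointwise convergence. *)
move=> t0; pose e j : R := Num.min (t ^+ 2) j.+1%:R^-1.
have e0 j : 0 < e j by rewrite lt_min exprn_gt0 // invr_gt0 ltr0n.
have /all_sig2[s ss us] j : {s | ball_span s & Nsq (u - s) < e j}.
  by apply: cid2; exact: ball_span_dense.
apply: (@nsq_fatou _ _ _ _ (fun j => F (s j) l)).
- by move=> j; exact: cmeasurable_fourier_partial.
- exact: cmeasurable_fourier_partial.
- apply: aeW => xi; pose K := Nsq (toL2 mu (kernel_fun R l xi)).
  have b j : normsq (F u l xi - F (s j) l xi) <= j.+1%:R^-1 * K.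
    have -> : F u l xi - F (s j) l xi = F (u - s j : L2 mu) l xi.
      rewrite -[- s j]scaleN1r fourier_partialD // fourier_partialZ // mulN1r //.
    apply: le_trans (normsq_fourier_partial mu_haar mu_Zhat _ _ _) _.
    rewrite ler_wpM2r ?Nsq_ge0 // (le_trans (ltW (us j))) // ge_min lexx orbT //.
  split; apply: (@cvg_of_sqr_le _ _ _ K) => j; apply: le_trans (b j).
    by rewrite /normsq cReB lerDl sqr_ge0.
  by rewrite /normsq cImB lerDr sqr_ge0.
move=> j; rewrite -nsq_toL2; last exact: span_sqint.
rewrite -NsqE lee_fin; apply: le_trans (span_Nsq mu_haar mu_Zhat l (ss j)) _.
have -> : s j = u + (- (u - s j)) by rewrite opprB addrC subrK.
apply: le_trans (NsqD _ _ t0) _; rewrite NsqN -addrA lerD2l.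
have h : Nsq (u - s j) <= t ^+ 2 by apply: le_trans (ltW (us j)) _; rewrite ge_min lexx.
apply: le_trans (ler_wpM2l _ h) _; first by rewrite addr_ge0 // invr_ge0 ltW.
rewrite mulrDl mul1r expr2 mulrA mulVf ?gt_eqF // mul1r addrC //.
Qed.

Lemma sqint_fourier_partial u l : square_integrable mu (F u l).
Proof.
apply/sqintP; split; first exact: cmeasurable_fourier_partial.
exact: le_lt_trans (nsq_fourier_partial_approx u l ltr01) (ltry _).
Qed.

Definition fourierl (l : nat) u : L2 mu := toL2 mu (F u l).

Lemma Nsq_fourierl l u : Nsq (fourierl l u) <= Nsq u.
Proof.
apply: le_of_approx => t t0; rewrite -lee_fin NsqE nsq_toL2; last exact: sqint_fourier_partial.
exact: nsq_fourier_partial_approx.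
Qed.

Lemma fourierlD l u v : fourierl l (u + v) = fourierl l u + fourierl l v.
Proof.
rewrite /fourierl (fourier_partialD mu_haar mu_Zhat).
by rewrite (toL2D (sqint_fourier_partial u l) (sqint_fourier_partial v l)).
Qed.

Lemma fourierlZ l c u : fourierl l (c *: u) = c *: fourierl l u.
Proof.
rewrite /fourierl (fourier_partialZ mu_haar mu_Zhat).
by rewrite (toL2Z c (sqint_fourier_partial u l)).
Qed.

Lemma fourierlB l u v : fourierl l (u - v) = fourierl l u - fourierl l v.
Proof. by rewrite -scaleN1r fourierlD fourierlZ scaleN1r. Qed.

Lemma fourier_partial_ball_eventually A : adele_balls A ->
  exists l0, forall l, (l0 <= l)%N -> F (toL2 mu (cindic A)) l = F (toL2 mu (cindic A)) l0.
Proof.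
move=> bA; have [l0 l0P] := adele_balls_eventually bA; exists l0 => l ll.
rewrite !(fourier_partial_cindic mu_haar mu_Zhat _ bA) !(setIidl (l0P _ _)) //.
case: bA l0P => [->|[a [n ->]]] l0P; first by rewrite !fourier_partial_set0.
by rewrite !fourier_partial_ball //; exact: l0P.
Qed.

Lemma fourierl_span_eventually s : ball_span s ->
  exists l0, forall l, (l0 <= l)%N -> fourierl l s = fourierl l0 s.
Proof.
elim=> [|c A s' bA ss [l0 IH]].
  by exists 0%N => l _; rewrite /fourierl !fourier_partial0.
have [l1 H] := fourier_partial_ball_eventually bA.
exists (maxn l0 l1) => l; rewrite geq_max => /andP[l0l l1l].
rewrite !fourierlD !fourierlZ.
have e1 : fourierl l s' = fourierl (maxn l0 l1) s'.
  by rewrite (IH l l0l) (IH (maxn l0 l1) (leq_maxl _ _)).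
have e2 : fourierl l (toL2 mu (cindic A)) = fourierl (maxn l0 l1) (toL2 mu (cindic A)).
  exact: (congr1 (toL2 mu) (etrans (H l l1l) (esym (H (maxn l0 l1) (leq_maxr _ _))))).
exact: (f_equal2 (fun x y => c *: x + y) e2 e1).
Qed.

Lemma fourier_ex u : exists g : L2 mu, L2lim (F u) g.
Proof.
have [|g gP] := @L2_complete _ _ R mu (fun l => fourierl l u).
  (* The transforms of [s] are eventually constant, so differences for [u] are differences for
     [u - s]; two contractions and the factor 2 of [NsqB2] leave less than half of [e]. *)
  move=> e e0; have e8 : 0 < e / 8 by rewrite divr_gt0.
  have [s ss us] := ball_span_dense mu_haar mu_Zhat u e8.
  have [l0 l0P] := fourierl_span_eventually ss; exists l0 => m n ml nl.
  have E : fourierl m u - fourierl n u = fourierl m (u - s) - fourierl n (u - s).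
    by rewrite !fourierlB (l0P m ml) (l0P n nl) opprB addrA subrK.
  rewrite E.
  exact: (lt_eighths e0 (NsqB2 _ _) (Nsq_fourierl m (u - s)) (Nsq_fourierl n (u - s)) us).
exists g; apply/L2limP; split => // n; exact: sqint_fourier_partial.
Qed.

(** Since the limit exists, the default value in the definition of [fourier] is never taken. *)
Lemma fourierP u : L2lim (F u) (fourier u).
Proof. exact: (xgetPex 0 (fourier_ex u)). Qed.

Lemma fourier_unique u g : L2lim (F u) g -> fourier u = g.
Proof. exact: L2lim_unique (fourierP u). Qed.

Lemma fourier_approx u e : 0 < e ->
  exists l0, forall l, (l0 <= l)%N -> Nsq (fourierl l u - fourier u) < e.
Proof. by have /L2limP[_ h] := fourierP u; exact: h. Qed.

Lemma fourierD u v : fourier (u + v) = fourier u + fourier v.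
Proof.
apply: fourier_unique; apply/L2limP; split => [n|e e0]; first exact: sqint_fourier_partial.
have e4 : 0 < e / 4 by rewrite divr_gt0.
have [m mP] := fourier_approx u e4; have [n nP] := fourier_approx v e4.
exists (maxn m n) => l; rewrite geq_max => /andP[/mP ul /nP vl].
rewrite -/(fourierl l (u + v)) fourierlD opprD addrACA.
exact: (lt_quarters (NsqD2 _ _) ul vl).
Qed.

Lemma fourierZ c u : fourier (c *: u) = c *: fourier u.
Proof.
apply: fourier_unique; apply/L2limP; split => [n|e e0]; first exact: sqint_fourier_partial.
have c0 := normsq_ge0 c.
have [|m mP] := @fourier_approx u (e / (normsq c + 1)); first by rewrite divr_gt0 // ltr_wpDl.
exists m => l /mP; rewrite -/(fourierl l (c *: u)) fourierlZ -scalerBr NsqZ.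
rewrite ltr_pdivlMr ?ltr_wpDl //.
have := Nsq_ge0 (fourierl l u - fourier u); nra.
Qed.

Lemma fourierB u v : fourier (u - v) = fourier u - fourier v.
Proof. by rewrite -scaleN1r fourierD fourierZ scaleN1r. Qed.

(** The limit inherits the constant 1: with a truncation error below [t ^+ 2], Young's inequality
    yields the premise of [le_of_approx]. *)
Lemma Nsq_fourier_le u : Nsq (fourier u) <= Nsq u.
Proof.
apply: le_of_approx => t t0.
have t2 : 0 < t ^+ 2 by rewrite exprn_gt0.
have [l /(_ l (leqnn l)) h] := fourier_approx u t2.
have -> : fourier u = fourierl l u + (- (fourierl l u - fourier u)).
  by rewrite opprB addrC subrK.
apply: le_trans (NsqD _ _ t0) _; rewrite NsqN -addrA lerD //.
  by apply: ler_wpM2l; [rewrite addr_ge0 // ltW|exact: Nsq_fourierl].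
apply: le_trans (ler_wpM2l _ (ltW h)) _; first by rewrite addr_ge0 // invr_ge0 ltW.
by rewrite mulrDl mul1r expr2 mulrA mulVf ?gt_eqF // mul1r addrC.
Qed.

Lemma fourier_eventually u g l0 : (forall l, (l0 <= l)%N -> F u l = g) ->
  fourier u = toL2 mu g.
Proof.
move=> h; apply: fourier_unique; apply/L2limP; split => [n|e e0].
  exact: sqint_fourier_partial.
by exists l0 => l /h ->; rewrite subrr Nsq0.
Qed.

Definition reflect_L2 u : L2 mu := toL2 mu (fun x => u (- x)).

Lemma sqint_reflect (f : finite_adele -> R[i]) : square_integrable mu f ->
  square_integrable mu (fun x => f (- x)).
Proof. exact: (sqint_preserving adele_opp_measurable (haar_opp mu_haar mu_Zhat)). Qed.

Lemma reflect_toL2 (f : finite_adele -> R[i]) : square_integrable mu f ->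
  reflect_L2 (toL2 mu f) = toL2 mu (fun x => f (- x)).
Proof.
move=> fi; apply: toL2_eq; [exact/sqint_reflect/L2_sqint|exact: sqint_reflect|].
exact: (ae_preserving adele_opp_measurable (haar_opp mu_haar mu_Zhat) (toL2_ae fi)).
Qed.

Lemma reflectD u v : reflect_L2 (u + v) = reflect_L2 u + reflect_L2 v.
Proof.
have iu := sqint_reflect (L2_sqint u); have iv := sqint_reflect (L2_sqint v).
rewrite /reflect_L2 -toL2D //; apply: toL2_eq; [exact/sqint_reflect/L2_sqint|exact: sqintD|].
exact: (ae_preserving adele_opp_measurable (haar_opp mu_haar mu_Zhat) (L2D_ae u v)).
Qed.

Lemma reflectZ c u : reflect_L2 (c *: u) = c *: reflect_L2 u.
Proof.
have iu := sqint_reflect (L2_sqint u).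
rewrite /reflect_L2 -toL2Z //; apply: toL2_eq; [exact/sqint_reflect/L2_sqint|exact: sqintZ|].
exact: (ae_preserving adele_opp_measurable (haar_opp mu_haar mu_Zhat) (L2Z_ae c u)).
Qed.

Lemma Nsq_reflect u : Nsq (reflect_L2 u) = Nsq u.
Proof.
apply: EFin_inj; rewrite !NsqE nsq_toL2; last exact/sqint_reflect/L2_sqint.
apply: (nsq_preserving adele_opp_measurable (haar_opp mu_haar mu_Zhat)).
exact: L2_cmeasurable.
Qed.

Lemma fball_opp a n xi : fball R a n (- xi) = fball R (- a) n xi.
Proof.
rewrite /fball mulrN mulNr /cindic; congr (_ * (_ * (_ : bool)%:R%:C%C)).
by apply/idP/idP; rewrite !inE => /frak_aNE.
Qed.

Lemma fourier_ball a n : fourier (toL2 mu (cindic (adele_ball a n))) = toL2 mu (fball R a n).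
Proof.
have bA : adele_balls (adele_ball a n) by right; exists a, n.
have [l0 l0P] := adele_balls_eventually bA; apply: (@fourier_eventually _ _ l0) => l /l0P al.
by rewrite fourier_partial_toL2 ?fourier_partial_ball //; exact: sqint_balls.
Qed.

Lemma fourier_fball a n : fourier (toL2 mu (fball R a n)) = toL2 mu (cindic (adele_ball (- a) n)).
Proof.
apply: (@fourier_eventually _ _ `|n|%N) => l nl.
rewrite fourier_partial_toL2 ?fourier_partial_fball //; last exact: sqint_fball.
by apply: (le_trans (ler_norm (- n))); rewrite normrN -abszE lez_nat.
Qed.

Let inv u := fourier (reflect_L2 (fourier u)).

Let invD u v : inv (u + v) = inv u + inv v.
Proof. by rewrite /inv fourierD reflectD fourierD. Qed.

Let invZ c u : inv (c *: u) = c *: inv u.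
Proof. by rewrite /inv fourierZ reflectZ fourierZ. Qed.

Let inv0 : inv 0 = 0.
Proof. by rewrite -[X in inv X](scale0r (0 : L2 mu)) invZ scale0r. Qed.

Lemma fourier_inversion_ball A : adele_balls A ->
  fourier (reflect_L2 (fourier (toL2 mu (cindic A)))) = toL2 mu (cindic A).
Proof.
have es : toL2 mu (cindic set0) = 0.
  rewrite -[RHS]toL2_0; congr (toL2 mu _); apply/funext => x.
  by rewrite /cindic in_set0.
move=> [->|[a [n ->]]]; first by rewrite es -/(inv 0) inv0.
rewrite fourier_ball (reflect_toL2 (sqint_fball mu_haar mu_Zhat a n)).
have -> : (fun x => fball R a n (- x)) = fball R (- a) n.
  by apply/funext => x; exact: fball_opp.
by rewrite fourier_fball opprK.
Qed.

Lemma fourier_inversion_span s : ball_span s -> fourier (reflect_L2 (fourier s)) = s.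
Proof.
elim=> [|c A s' bA ss IH]; first exact: inv0.
apply: (etrans (invD (c *: toL2 mu (cindic A)) s')).
apply: (etrans (congr1 (fun x => x + inv s') (invZ c (toL2 mu (cindic A))))).
exact: (f_equal2 (fun x y => c *: x + y) (fourier_inversion_ball bA) IH).
Qed.

Let invB u v : inv (u - v) = inv u - inv v.
Proof. by rewrite -scaleN1r invD invZ scaleN1r. Qed.

Let Nsq_inv u : Nsq (inv u) <= Nsq u.
Proof.
apply: (le_trans (Nsq_fourier_le (reflect_L2 (fourier u)))).
by rewrite Nsq_reflect; exact: Nsq_fourier_le.
Qed.

Lemma fourier_inversion u : fourier (reflect_L2 (fourier u)) = u.
Proof.
apply/eqP; rewrite -subr_eq0; apply/eqP/Nsq_eq0/eqP; rewrite eq_le Nsq_ge0 andbT.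
apply/ler_addgt0Pl => e e0; rewrite addr0; have e8 : 0 < e / 8 by rewrite divr_gt0.
have [s ss us] := ball_span_dense mu_haar mu_Zhat u e8.
(* [inv] fixes [s], so its deviation from the identity at [u] equals that at the small element
   [u - s]. *)
have E : inv u - u = inv (u - s) - (u - s).
  exact: (sub_shift u (invB u s) (fourier_inversion_span ss)).
rewrite -[fourier _]/(inv u) E.
exact: (ltW (lt_eighths e0 (NsqB2 _ _) (Nsq_inv (u - s)) (lexx _) us)).
Qed.

Lemma Nsq_fourier u : Nsq (fourier u) = Nsq u.
Proof.
apply/eqP; rewrite eq_le; apply/andP; split; first exact: Nsq_fourier_le.
have e : Nsq u = Nsq (inv u) by exact: (esym (congr1 (@Nsq _ _ _ mu) (fourier_inversion u))).
exact: (eq_le_eq e (Nsq_fourier_le (reflect_L2 (fourier u))) (Nsq_reflect (fourier u))).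
Qed.

Lemma fourier_inj : injective (@fourier R mu).
Proof.
move=> u v uv; apply/eqP; rewrite -subr_eq0; apply/eqP/Nsq_eq0.
apply: (etrans (esym (Nsq_fourier (u - v)))).
by rewrite fourierB uv subrr Nsq0.
Qed.

End fourier_L2.

Theorem theorem4p9 (R : realType) (mu : {measure set finite_adele -> \bar R})
  (mu_haar : is_haar mu) (mu_Zhat : mu Zhat = 1%E) :
  [/\ (forall f : L2 mu, L2lim (fourier_partial mu f) (fourier f)),
      unitary (fun f : L2 mu => fourier f),
      (forall f : L2 mu,
         square_integrable mu (fun xi => fourier f (- xi)) /\
         fourier (toL2 mu (fun xi => fourier f (- xi))) = f)
    & (forall f g : L2 mu,
         cintegral mu setT (fun x => f x * (g x)^*%C) =
         cintegral mu setT (fun xi => fourier f xi * (fourier g xi)^*%C))].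
Proof.
have fdot (f g : L2 mu) : L2dot (fourier f) (fourier g) = L2dot f g.
  apply: (@L2dot_polarization _ _ _ _ (@fourier R mu)).
  - exact: fourierD.
  - exact: fourierZ.
  - exact: Nsq_fourier.
split.
- exact: fourierP.
- split => //.
  + by move=> a u v; rewrite fourierD // fourierZ.
  (* Inversion makes this a right inverse; it is also a left inverse because the transform is
     injective. *)
  + exists (fun v => reflect_L2 (fourier v)) => u; last exact: fourier_inversion.
    by apply: (fourier_inj mu_haar mu_Zhat); rewrite fourier_inversion.
- move=> f; split; last exact: fourier_inversion.
  by apply: (sqint_reflect mu_haar mu_Zhat); exact: L2_sqint.
- by move=> f g; rewrite -[LHS]/(L2dot f g) -fdot.
Qed.
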